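(* Let $a,b>0$ be constants with $a+b<\tfrac12$. There exists $\varepsilon_0>0$ such that for every fixed $0<\varepsilon<\varepsilon_0$ the following holds. Consider data $n,\boldsymbol{s},\boldsymbol{t},H$ with $n\to\infty$ such that, uniformly over $j$, $s_j-s$, $x_j$, $t_j-s$, $y_j$ are $O(n^{1/2+\varepsilon})$; $X=O(n^{1+2\varepsilon})$; and $\frac{(1-2\lambda)^2}{3A}\le a\log n$. Let $G$ be uniformly random in $\mathcal{D}(\boldsymbol{s},\boldsymbol{t})$ and $p=s/(n-1)$. Then (i) the probability that $G$ is arc-disjoint from $H$ is $(1-p)^X\,M$ and (ii) the probability that $G$ contains $H$ as a subdigraph (every arc of $H$ is an arc of $G$) is $p^X\,T$, where \begin{align*} M=\exp\Bigl(&\frac{\lambda X}{(1-\lambda)n}+\frac{\lambda X^2}{2(1-\lambda)n^2}-\frac{R_{1,1}+C_{1,1}}{(1-\lambda)n}-\frac{Y}{\lambda(1-\lambda)n^2}+\frac{\lambda(R_{0,2}+C_{0,2})}{2(1-\lambda)n}\\ &+\frac{\lambda(1-2\lambda)(R_{0,3}+C_{0,3})}{6(1-\lambda)^2n^2}-\frac{(1-2\lambda)(R_{1,2}+C_{1,2})}{2(1-\lambda)^2n^2}-\frac{R_{2,1}+C_{2,1}}{2(1-\lambda)^2n^2}+O(n^{-b})\Bigr), \end{align*} \begin{align*} T=\exp\Bigl(&\frac{(1-\lambda)X}{\lambda n}+\frac{(1-\lambda)X^2}{2\lambda n^2}+\frac{R_{1,1}+C_{1,1}}{\lambda n}-\frac{R_{2,1}+C_{2,1}}{2\lambda^2n^2}-\frac{(1+\lambda)(R_{0,2}+C_{0,2})}{2\lambda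 n}\\ &+\frac{(1+2\lambda)(R_{1,2}+C_{1,2})}{2\lambda^2n^2}-\frac{(1+\lambda)(1+2\lambda)(R_{0,3}+C_{0,3})}{6\lambda^2n^2}-\frac{Y-Y_{0,1}-Y_{1,0}+Y_{1,1}}{\lambda(1-\lambda)n^2}+O(n^{-b})\Bigr). \end{align*}
   Context: A simple digraph has no loops and no multiple arcs. $\boldsymbol{s}=(s_1,\dots,s_n)$, $\boldsymbol{t}=(t_1,\dots,t_n)$ are vectors of positive integers with equal sums; $\mathcal{D}(\boldsymbol{s},\boldsymbol{t})$ is the set of simple digraphs on $\{w_1,\dots,w_n\}$ with out-degrees $s_j$ and in-degrees $t_j$. $H$ is a fixed simple digraph on the same vertices with out-degrees $x_j$ and in-degrees $y_j$. $s=n^{-1}\sum_js_j$, $\lambda=s/n$, $A=\tfrac12\lambda(1-\lambda)$, $\delta_j=s_j-s+\lambda x_j$, $\eta_j=t_j-s+\lambda y_j$, $X=\sum_jx_j$ (number of arcs of $H$). For nonnegative integers $h,\ell$: $R_{h,\ell}=\sum_{j=1}^n\delta_j^hx_j^\ell$, $C_{h,\ell}=\sum_{j=1}^n\eta_j^hy_j^\ell$. Sums over arcs $w_jw_k$ (from $w_j$ to $w_k$) of $H$: $Y=\sum\delta_j\eta_k$, $Y_{1,1}=\sum x_jy_k$, $Y_{0,1}=\sum\delta_jy_k$, $Y_{1,0}=\sum x_j\eta_k$. Asymptotic notation refers to $n\to\infty$. *)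

(* Defs.v *)
From HB Require Import structures.
From mathcomp Require Import all_boot all_order all_algebra.
From mathcomp Require Import reals sequences exp.
Set Implicit Arguments. Unset Strict Implicit. Unset Printing Implicit Defensive.
Import Order.TTheory GRing.Theory Num.Theory.
Local Open Scope ring_scope.

(* A digraph on the vertex set {w_1..w_n} = 'I_n is its set of arcs (j,k),
   meaning an arc from j to k.  Representing arcs as a set excludes multiple
   arcs; "simple" additionally requires no loops. *)
Definition digraph (n : nat) := {set 'I_n * 'I_n}.

Definition simple_digraph n (G : digraph n) : bool :=
  [forall j : 'I_n, (j, j) \notin G].

Definition outdeg n (G : digraph n) (j : 'I_n) : nat := #|[set k | (j, k) \in G]|.
Definition indeg  n (G : digraph n) (k : 'I_n) : nat := #|[set j | (j, k) \in G]|.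

Definition Dst n (s t : 'I_n -> nat) : {set digraph n} :=
  [set G : digraph n | [&& simple_digraph G,
                          [forall j, outdeg G j == s j] &
                          [forall j, indeg G j == t j]]].

Definition prob_disjoint (R : realType) n (s t : 'I_n -> nat) (H : digraph n) : R :=
  #|[set G in Dst s t | [disjoint G & H]]|%:R / #|Dst s t|%:R.

Definition prob_contains (R : realType) n (s t : 'I_n -> nat) (H : digraph n) : R :=
  #|[set G in Dst s t | H \subset G]|%:R / #|Dst s t|%:R.

Section Quantities.
Variables (R : realType) (n : nat) (s t : 'I_n -> nat) (H : digraph n).

Definition savg : R := (\sum_j s j)%:R / n%:R.
Definition lam : R := savg / n%:R.
Definition Aq : R := lam * (1 - lam) / 2.
Definition xdeg (j : 'I_n) : R := (outdeg H j)%:R.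
Definition ydeg (j : 'I_n) : R := (indeg H j)%:R.
Definition delta (j : 'I_n) : R := (s j)%:R - savg + lam * xdeg j.
Definition eta (j : 'I_n) : R := (t j)%:R - savg + lam * ydeg j.
Definition Xarcs : R := (#|H|)%:R.
Definition Rsum (h l : nat) : R := \sum_j delta j ^+ h * xdeg j ^+ l.
Definition Csum (h l : nat) : R := \sum_j eta j ^+ h * ydeg j ^+ l.
Definition Yq : R := \sum_(e in H) delta e.1 * eta e.2.
Definition Y11 : R := \sum_(e in H) xdeg e.1 * ydeg e.2.
Definition Y01 : R := \sum_(e in H) delta e.1 * ydeg e.2.
Definition Y10 : R := \sum_(e in H) xdeg e.1 * eta e.2.
Definition pq : R := savg / (n%:R - 1).

Definition RC (h l : nat) : R := Rsum h l + Csum h l.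

Definition M_main : R :=
  let N := n%:R in let l := lam in
    l * Xarcs / ((1 - l) * N)
  + l * Xarcs ^+ 2 / (2 * (1 - l) * N ^+ 2)
  - RC 1 1 / ((1 - l) * N)
  - Yq / (l * (1 - l) * N ^+ 2)
  + l * RC 0 2 / (2 * (1 - l) * N)
  + l * (1 - 2 * l) * RC 0 3 / (6 * (1 - l) ^+ 2 * N ^+ 2)
  - (1 - 2 * l) * RC 1 2 / (2 * (1 - l) ^+ 2 * N ^+ 2)
  - RC 2 1 / (2 * (1 - l) ^+ 2 * N ^+ 2).

Definition T_main : R :=
  let N := n%:R in let l := lam in
    (1 - l) * Xarcs / (l * N)
  + (1 - l) * Xarcs ^+ 2 / (2 * l * N ^+ 2)
  + RC 1 1 / (l * N)
  - RC 2 1 / (2 * l ^+ 2 * N ^+ 2)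
  - (1 + l) * RC 0 2 / (2 * l * N)
  + (1 + 2 * l) * RC 1 2 / (2 * l ^+ 2 * N ^+ 2)
  - (1 + l) * (1 + 2 * l) * RC 0 3 / (6 * l ^+ 2 * N ^+ 2)
  - (Yq - Y01 - Y10 + Y11) / (l * (1 - l) * N ^+ 2).

End Quantities.

(* Main.v *)
Require Import Defs.
From HB Require Import structures.
From mathcomp Require Import all_boot all_order all_algebra perm.
From mathcomp Require Import reals topology normedtype derive realfun sequences exp.
From mathcomp Require Import ring lra.
Set Implicit Arguments. Unset Strict Implicit. Unset Printing Implicit Defensive.
Import Order.TTheory GRing.Theory Num.Theory.
Import numFieldNormedType.Exports.
Local Open Scope ring_scope.

(** The arcs of [H] are forbidden one after the other, so that the probability of
    avoiding [H] is a product of factors [1 - P], where [P] is the probability of a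
    single arc [(a, v)] in a random digraph with the given degrees that avoids a
    set [F] of positions. The exponent [M_main] is a potential whose increments are
    the logarithms of [(1 - P) / (1 - p)] up to [n^(-3/2 + o(1))].

    To find [P] to that precision, fix two rows [a] and [b]. Exchanging the
    columns [u] and [v] in these rows, when [(a, v)] and [(b, u)] are arcs and
    [(a, u)] and [(b, v)] are not, keeps all degrees. Let [D_ab] and [D_ba] be the
    numbers of columns [u] with only [(b, u)], respectively only [(a, u)], present;
    the exchange preserves both, so double counting gives the exact relation
    [P_av - P_bv = E [1_(not av, bv) (D_ba - D_ab) / D_ab]]. The difference
    [D_ba - D_ab] is determined by the degrees and by the few entries in columns
    meeting [F], so it is [O(n^(1/2 + o(1)))], while [D_ab] is of order [n]: a
    switching involving a third row shows that it is exponentially unlikely to be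
    small. Hence [P_av - P_bv] is one order more precise than the joint
    probabilities of boundedly many entries used to compute the right-hand side,
    and since every column has a known sum, so is [P]. Three rounds, each valid
    conditionally on boundedly many entries, give errors [n^(-1/2)], [n^(-1)] and
    [n^(-3/2)] up to [n^(o(1))].

    Containing [H] is avoiding [H] for the complementary digraph. *)

(** * Switchings *)

(** The third round is forced by the length of the product. With about [n^(1 + 2 eps)] factors,
    errors [n^(-1)] would add up to something unbounded, while errors [n^(-3/2)] add up to
    [n^(-1/2)] times a small power of [n], below [n^(-b)]. Every bound must hold uniformly over the
    forbidden sets met on the way, so no asymptotic notation is used: estimates are explicit
    products of powers of [q] and [r]. In the same spirit nothing is divided by the number of
    digraphs that satisfy a condition. Conditioning on the entries in [E] means summing against a
    weight [f], possibly signed, that depends on these entries only, with errors measured against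
    the sum of [|f|]. The nonlinear object is [1 / D_ab], expanded around an approximate mean.
    Because [D_ba - D_ab] is a constant plus a sum of few single entries, even its product with the
    linear term is handled by first moments, and only the quadratic remainder needs a variance. *)

Section Switching.
Variables (n : nat).
Implicit Types (G : digraph n) (a b u v : 'I_n).

Definition flip a b u v (e : 'I_n * 'I_n) : 'I_n * 'I_n :=
  (e.1, if (e.1 == a) || (e.1 == b) then tperm u v e.2 else e.2).

Lemma flipK a b u v : involutive (flip a b u v).
Proof.
by move=> [i w]; rewrite /flip /=; case h: (_ || _); rewrite ?h ?tpermK.
Qed.

Definition switch a b u v G : digraph n := [set e | flip a b u v e \in G].

Lemma in_switch a b u v G e : (e \in switch a b u v G) = (flip a b u v e \in G).
Proof. by rewrite inE. Qed.

Lemma switchK a b u v : involutive (switch a b u v).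
Proof. by move=> G; apply/setP => e; rewrite !in_switch flipK. Qed.

(** The two rows send equally many arcs into [v] and into [u], which is when the exchange keeps both
    in-degrees. *)
Definition balanced a b u v G :=
  (((a, v) \in G) + ((b, v) \in G) == ((a, u) \in G) + ((b, u) \in G))%N.

Lemma balanced_switch a b u v G :
  balanced a b u v (switch a b u v G) = balanced a b u v G.
Proof.
by rewrite /balanced !in_switch /flip /= !eqxx !orbT /= tpermL tpermR eq_sym.
Qed.

Lemma outdeg_switch a b u v G j : outdeg (switch a b u v G) j = outdeg G j.
Proof.
rewrite /outdeg; have [jab|/negbTE jab] := boolP ((j == a) || (j == b)); last first.
  by apply: eq_card => k; rewrite !inE /flip /= jab.
rewrite -[RHS](card_preimset _ (@perm_inj _ (tperm u v))).
by apply: eq_card => k; rewrite !inE /flip /= jab.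
Qed.

Lemma indeg_sum G k : indeg G k = (\sum_j ((j, k) \in G))%N.
Proof.
rewrite /indeg -sum1_card big_mkcond /=. by apply: eq_bigr => j _; rewrite inE; case: (_ \in _).
Qed.

Lemma outdeg_sum G j : outdeg G j = (\sum_k ((j, k) \in G))%N.
Proof.
by rewrite /outdeg -sum1_card big_mkcond /=; apply: eq_bigr => k _; rewrite inE; case: (_ \in _).
Qed.

Lemma indeg_switch a b u v G k : a != b -> balanced a b u v G ->
  indeg (switch a b u v G) k = indeg G k.
Proof.
move=> ab bal; rewrite !indeg_sum.
rewrite (bigD1 a) //= (bigD1 b) 1?eq_sym //= [RHS](bigD1 a) //= [in RHS](bigD1 b) 1?eq_sym //=.
rewrite !addnA; congr (_ + _)%N; last first.
  apply: eq_bigr => j /andP[/negbTE ja /negbTE jb].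
  by rewrite in_switch /flip /= ja jb.
rewrite !in_switch /flip /= !eqxx orbT /=.
by case: tpermP => [->|->|//]; move/eqP: bal => ->.
Qed.

End Switching.

Section RealSums.
Variables (R : realType) (I : finType) (P : pred I).
Implicit Types f : I -> R.

Lemma sumRD f1 f2 : \sum_(i | P i) (f1 i + f2 i) = \sum_(i | P i) f1 i + \sum_(i | P i) f2 i.
Proof. exact: big_split. Qed.

Lemma sumRB f1 f2 : \sum_(i | P i) (f1 i - f2 i) = \sum_(i | P i) f1 i - \sum_(i | P i) f2 i.
Proof. exact: sumrB. Qed.

Lemma sumRZ (c : R) f : \sum_(i | P i) (c * f i) = c * \sum_(i | P i) f i.
Proof. by rewrite mulr_sumr. Qed.

End RealSums.

(** * Sums over digraphs with given degrees that avoid a set *)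

Section Ensemble.
Variables (R : realType) (n : nat) (s t : 'I_n -> nat) (F : digraph n).
Implicit Types (G : digraph n) (a b u v : 'I_n) (f : digraph n -> R).
Implicit Types (e : 'I_n * 'I_n) (E : digraph n).

(* Digraphs with the prescribed degrees avoiding [F]; taking [F] to contain the
   diagonal forbids loops. *)
Definition ensemble : {set digraph n} :=
  [set G : digraph n | [&& [disjoint G & F], [forall j, outdeg G j == s j]
             & [forall k, indeg G k == t k]]].

Definition arc_ind e G : R := (e \in G)%:R.

Definition ens_sum f : R := \sum_(G in ensemble) f G.

Lemma ind_switch a b u v e G : arc_ind e (switch a b u v G) = arc_ind (flip a b u v e) G.
Proof. by rewrite /arc_ind in_switch. Qed.

Lemma switch_Om a b u v G : a != b -> (a, u) \notin F -> (a, v) \notin F ->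
  (b, u) \notin F -> (b, v) \notin F -> balanced a b u v G ->
  (switch a b u v G \in ensemble) = (G \in ensemble).
Proof.
move=> ab au av bu bv bal.
have imp G0 : balanced a b u v G0 -> G0 \in ensemble -> switch a b u v G0 \in ensemble.
  move=> bal0; rewrite !inE => /and3P[dis /forallP out /forallP inn]; apply/and3P; split.
  - apply/pred0P => -[i w] /=; apply/negP => /andP[]; rewrite in_switch => hG hF.
    have := pred0P dis (i, w); rewrite /= hF andbT => hG'.
    move: hG; rewrite /flip /=; case: ifP => [|_]; last by rewrite hG'.
    case: tpermP => [wu|wv|_ _]; rewrite ?hG' //; last first.
    + by case/orP => /eqP ia; move: hF; rewrite ia wv ?(negbTE av) ?(negbTE bv).
    + by case/orP => /eqP ia; move: hF; rewrite ia wu ?(negbTE au) ?(negbTE bu).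
  - by apply/forallP => j; rewrite outdeg_switch.
  - by apply/forallP => j; rewrite indeg_switch.
apply/idP/idP => [|]; last exact: imp.
by move/(imp _); rewrite balanced_switch switchK; exact.
Qed.

(** [switch] is an involution that preserves balance and, on balanced digraphs, membership in the
    ensemble. It is therefore a change of variables for every summand carried by balanced
    digraphs. *)
Lemma Ex_switch a b u v f : a != b -> (a, u) \notin F -> (a, v) \notin F ->
  (b, u) \notin F -> (b, v) \notin F ->
  (forall G, ~~ balanced a b u v G -> f G = 0) ->
  ens_sum f = ens_sum (fun G => f (switch a b u v G)).
Proof.
move=> ab au av bu bv f0; rewrite /ens_sum.
rewrite (bigID (balanced a b u v)) /= [X in _ + X]big1 ?addr0; last first.
  by move=> G /andP[_ /f0].
rewrite [RHS](bigID (balanced a b u v)) /= [X in _ = _ + X]big1 ?addr0; last first.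
  by move=> G /andP[_ h]; apply: f0; rewrite balanced_switch.
rewrite (reindex_inj (inv_inj (switchK a b u v))) /=.
apply: eq_bigl => G; rewrite balanced_switch.
by case bal: (balanced _ _ _ _ _); rewrite ?andbF // !andbT switch_Om.
Qed.

Lemma ExD f1 f2 : ens_sum (fun G => f1 G + f2 G) = ens_sum f1 + ens_sum f2.
Proof. by rewrite /ens_sum big_split. Qed.

Lemma ExB f1 f2 : ens_sum (fun G => f1 G - f2 G) = ens_sum f1 - ens_sum f2.
Proof. by rewrite /ens_sum sumrB. Qed.

Lemma ExZ (c : R) f : ens_sum (fun G => c * f G) = c * ens_sum f.
Proof. by rewrite /ens_sum mulr_sumr. Qed.

Lemma Ex_sum (I : finType) (P : pred I) (f : I -> digraph n -> R) :
  ens_sum (fun G => \sum_(i | P i) f i G) = \sum_(i | P i) ens_sum (f i).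
Proof. by rewrite /ens_sum exchange_big. Qed.

Lemma eq_Ex f1 f2 : (forall G, G \in ensemble -> f1 G = f2 G) -> ens_sum f1 = ens_sum f2.
Proof. by move=> h; apply: eq_bigr => G GO; apply: h. Qed.

Lemma le_Ex f1 f2 : (forall G, G \in ensemble -> f1 G <= f2 G) -> ens_sum f1 <= ens_sum f2.
Proof. by move=> h; apply: ler_sum => G GO; apply: h. Qed.

Lemma Ex_ge0 f : (forall G, G \in ensemble -> 0 <= f G) -> 0 <= ens_sum f.
Proof. by move=> h; apply: sumr_ge0 => G GO; apply: h. Qed.

Lemma normEx f : `|ens_sum f| <= ens_sum (fun G => `|f G|).
Proof. exact: ler_norm_sum. Qed.

Lemma ind_ge0 e G : 0 <= arc_ind e G. Proof. exact: ler0n. Qed.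
Lemma ind_le1 e G : arc_ind e G <= 1. Proof. by rewrite /arc_ind; case: (_ \in _). Qed.
Lemma indP e G : arc_ind e G = 0 \/ arc_ind e G = 1.
Proof. by rewrite /arc_ind; case: (_ \in _); [right|left]. Qed.

Lemma ind_F e G : G \in ensemble -> e \in F -> arc_ind e G = 0.
Proof.
rewrite inE => /and3P[/pred0P/(_ e) /= h _ _] eF.
by rewrite /arc_ind; move: h; rewrite eF andbT => ->.
Qed.

Lemma row_sum G a : G \in ensemble -> \sum_w arc_ind (a, w) G = (s a)%:R.
Proof.
rewrite inE => /and3P[_ /forallP/(_ a)/eqP <- _].
by rewrite outdeg_sum natr_sum.
Qed.

Lemma col_sum G v : G \in ensemble -> \sum_w arc_ind (w, v) G = (t v)%:R.
Proof.
rewrite inE => /and3P[_ _ /forallP/(_ v)/eqP <-].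
by rewrite indeg_sum natr_sum.
Qed.

(** The indicator of a prescribed pattern on [E] is the typical such weight; signed ones arise when
    a centred factor such as [dev] is absorbed into [f]. *)
Definition localE E f := forall G G', (forall e, e \in E -> (e \in G) = (e \in G')) -> f G = f G'.

Lemma localE_norm E f : localE E f -> localE E (fun G => `|f G|).
Proof. by move=> h G G' GG'; rewrite (h G G'). Qed.

Lemma localE_ind E f e : localE E f -> localE (e |: E) (fun G => f G * arc_ind e G).
Proof.
move=> h G G' GG'; rewrite (h G G'); last by move=> e' eE; apply: GG'; rewrite inE eE orbT.
by rewrite /arc_ind GG' // !inE eqxx.
Qed.

Lemma localE_indC E f e : localE E f -> localE (e |: E) (fun G => f G * (1 - arc_ind e G)).
Proof.
move=> h G G' GG'; rewrite (h G G'); last by move=> e' eE; apply: GG'; rewrite inE eE orbT.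
by rewrite /arc_ind GG' // !inE eqxx.
Qed.

Lemma localE_switch E f a b u v G : localE E f -> (a, u) \notin E -> (a, v) \notin E ->
  (b, u) \notin E -> (b, v) \notin E -> f (switch a b u v G) = f G.
Proof.
move=> h au av bu bv; apply: h => -[i w] iwE; rewrite in_switch /flip /=.
case: ifP => // /orP[] /eqP ia; case: tpermP => // wu; move: iwE; rewrite ia wu.
- by rewrite (negbTE au).
- by rewrite (negbTE av).
- by rewrite (negbTE bu).
- by rewrite (negbTE bv).
Qed.

(* Columns in which rows [a] and [b] may both be changed by a switching. *)
Definition swap_col E a b : pred 'I_n :=
  fun u => ((a, u) \notin F :|: E) && ((b, u) \notin F :|: E).

(** The number [D_ab], restricted to the columns that a switching may use. Entries of [E] are left
    out too, so that a weight local to [E] survives every such switching. *)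
Definition discrep E a b G : R :=
  \sum_(u | swap_col E a b u) (1 - arc_ind (a, u) G) * arc_ind (b, u) G.

Lemma swappableC E a b u : swap_col E a b u = swap_col E b a u.
Proof. by rewrite /swap_col andbC. Qed.

Lemma disc_switch E a b u v G : swap_col E a b u -> swap_col E a b v ->
  discrep E a b (switch a b u v G) = discrep E a b G.
Proof.
move=> fu fv; rewrite /discrep [RHS](reindex_inj (@perm_inj _ (tperm u v))) /=.
apply: eq_big => [w|w _].
  by case: tpermP => [->|->|//]; rewrite fu fv.
by rewrite !ind_switch /flip /= !eqxx orbT.
Qed.

(* [discrep E a b] counts the columns available for a switching of the rows [a] and
   [b] and is itself preserved by such switchings, whence the free weight [phi]. *)
Lemma switch_identity E f a b v (phi : R -> R) : a != b -> localE E f -> swap_col E a b v ->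
  ens_sum (fun G => f G * arc_ind (a, v) G * (1 - arc_ind (b, v) G) * (discrep E a b G * phi (discrep E a b G)))
  = ens_sum (fun G => f G * (1 - arc_ind (a, v) G) * arc_ind (b, v) G * (discrep E b a G * phi (discrep E a b G))).
Proof.
move=> ab lf fv.
transitivity (\sum_(u | swap_col E a b u) ens_sum (fun G => f G * arc_ind (a, v) G * (1 - arc_ind (b, v) G) *
   ((1 - arc_ind (a, u) G) * arc_ind (b, u) G) * phi (discrep E a b G))).
  rewrite -Ex_sum; apply: eq_Ex => G _.
  by rewrite {1}/discrep mulr_suml mulr_sumr; apply: eq_bigr => u _; rewrite !mulrA.
transitivity (\sum_(u | swap_col E a b u) ens_sum (fun G => f G * (1 - arc_ind (a, v) G) * arc_ind (b, v) G *
   ((1 - arc_ind (b, u) G) * arc_ind (a, u) G) * phi (discrep E a b G))); last first.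
  rewrite -Ex_sum; apply: eq_Ex => G _.
  rewrite {2}/discrep mulr_suml mulr_sumr.
  by apply: eq_big => [u|u _]; rewrite 1?swappableC // !mulrA.
(* For each [u] a single switching carries one side into the other: the indicator factors already
   force the four entries into a balanced pattern. *)
apply: eq_bigr => u fu.
have [uv|uv] := eqVneq u v.
  rewrite uv; apply: eq_Ex => G _.
  by case: (indP (a, v) G) => ->; case: (indP (b, v) G) => ->; rewrite ?(subrr, mulr0, mul0r).
move: (fu) (fv); rewrite /swap_col !inE !negb_or => /andP[/andP[auF auE] /andP[buF buE]].
move=> /andP[/andP[avF avE] /andP[bvF bvE]].
rewrite (@Ex_switch a b u v) //; last first.
  move=> G; rewrite /balanced /arc_ind.
  by do 4!case: (_ \in _); rewrite ?(subrr, subr0, mulr0, mul0r, mulr1).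
apply: eq_Ex => G _; rewrite disc_switch // (localE_switch G lf) //.
rewrite !ind_switch /flip /= !eqxx orbT /= !tpermL !tpermR; ring.
Qed.

End Ensemble.

(** * Codegrees are rarely large *)

Section Tail.
Variables (R : realType) (n : nat) (s t : 'I_n -> nat) (F : digraph n).
Implicit Types (G : digraph n) (a b u v : 'I_n) (f : digraph n -> R).
Implicit Types (e : 'I_n * 'I_n) (E : digraph n).
Local Notation ind := (@arc_ind R n).
Local Notation disc := (@discrep R n F).
Local Notation Ex := (@ens_sum R n s t F).
Local Notation Om := (@ensemble n s t F).
Local Notation swappable := (@swap_col n F).

Definition codeg a b G : nat := #|[set w | ((a, w) \in G) && ((b, w) \in G)]|.

Lemma codegE a b G : (codeg a b G)%:R = \sum_w ind (a, w) G * ind (b, w) G.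
Proof.
rewrite /codeg -sum1_card big_mkcond natr_sum /=; apply: eq_bigr => w _.
by rewrite inE /arc_ind -natrM mulnb; case: (_ && _).
Qed.

(* Moving an arc [(b, v)] to [(b, u)] and [(d, u)] to [(d, v)], for a third row
   [d], lowers the codegree of [a] and [b] by one. *)
Definition codeg_down E a b G : R :=
  \sum_(d | (d != a) && (d != b))
   (\sum_(v | swappable E b d v) ind (a, v) G * ind (b, v) G * (1 - ind (d, v) G)) *
   (\sum_(u | swappable E b d u) (1 - ind (a, u) G) * (1 - ind (b, u) G) * ind (d, u) G).

Definition codeg_up E a b G : R :=
  \sum_(d | (d != a) && (d != b))
   (\sum_(v | swappable E b d v) ind (a, v) G * (1 - ind (b, v) G) * ind (d, v) G) *
   (\sum_(u | swappable E b d u) (1 - ind (a, u) G) * ind (b, u) G * (1 - ind (d, u) G)).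

Lemma codeg_switch_up a b d u v G : a != b -> d != a -> d != b -> u != v ->
  (a, v) \in G -> (b, v) \notin G -> (a, u) \notin G -> (b, u) \in G ->
  codeg a b (switch b d u v G) = (codeg a b G).+1.
Proof.
move=> ab da db uv av bv au bu; apply/eqP; rewrite -(eqr_nat R) -addn1 natrD !codegE.
rewrite [X in X == _](bigD1 v) //= [X in _ == X + _](bigD1 v) //=.
rewrite [X in _ + X == _](bigD1 u) //= [X in _ == _ + X + _](bigD1 u) //=.
rewrite [X in _ + (_ + X) == _](eq_bigr (fun w => ind (a, w) G * ind (b, w) G)).
  rewrite !ind_switch /flip /= !eqxx /= (negbTE ab) (eq_sym a d) (negbTE da) /= tpermL tpermR.
  rewrite /arc_ind av (negbTE bv) (negbTE au) bu /=; apply/eqP; ring.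
move=> w /andP[wv wu]; rewrite !ind_switch /flip /= !eqxx /= (negbTE ab) (eq_sym a d) (negbTE da) /=.
by rewrite tpermD // eq_sym.
Qed.

(** Double counting of the pairs of digraphs joined by such a move, with codegree [k + 1] at one end
    and [k] at the other. All moved entries lie outside [E], so [f] agrees at both ends. *)
Lemma codeg_switch_identity E f a b k : a != b -> localE E f ->
  Ex (fun G => f G * (codeg a b G == k.+1)%:R * codeg_down E a b G) =
  Ex (fun G => f G * (codeg a b G == k)%:R * codeg_up E a b G).
Proof.
move=> ab lf.
transitivity (\sum_(d | (d != a) && (d != b)) \sum_(v | swappable E b d v) \sum_(u | swappable E b d u)
  Ex (fun G => f G * (codeg a b G == k.+1)%:R *
   ((ind (a, v) G * ind (b, v) G * (1 - ind (d, v) G)) *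
   ((1 - ind (a, u) G) * (1 - ind (b, u) G) * ind (d, u) G)))).
  under eq_bigr do under eq_bigr do rewrite -Ex_sum.
  under eq_bigr do rewrite -Ex_sum.
  rewrite -Ex_sum; apply: eq_Ex => G _; rewrite mulr_sumr; apply: eq_bigr => d _.
  rewrite mulr_suml mulr_sumr; apply: eq_bigr => v _.
  by rewrite !mulr_sumr; apply: eq_bigr => u _.
transitivity (\sum_(d | (d != a) && (d != b)) \sum_(v | swappable E b d v) \sum_(u | swappable E b d u)
  Ex (fun G => f G * (codeg a b G == k)%:R *
   ((ind (a, v) G * (1 - ind (b, v) G) * ind (d, v) G) *
   ((1 - ind (a, u) G) * ind (b, u) G * (1 - ind (d, u) G))))); last first.
  under eq_bigr do under eq_bigr do rewrite -Ex_sum.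
  under eq_bigr do rewrite -Ex_sum.
  rewrite -Ex_sum; apply: eq_Ex => G _; rewrite mulr_sumr; apply: eq_bigr => d _.
  rewrite mulr_suml mulr_sumr; apply: eq_bigr => v _.
  by rewrite !mulr_sumr; apply: eq_bigr => u _.
apply: eq_bigr => d /andP[da db]; apply: eq_bigr => v fv; apply: eq_bigr => u fu.
have [->|uv] := eqVneq u v.
  by apply: eq_Ex => G _; case: (indP R (a, v) G) => ->; rewrite ?(subrr, mulr0, mul0r).
move: (fu) (fv); rewrite /swap_col !inE !negb_or => /andP[/andP[auF auE] /andP[buF buE]].
move=> /andP[/andP[avF avE] /andP[bvF bvE]].
rewrite (@Ex_switch _ _ _ _ _ b d u v) 1?eq_sym //; last first.
  move=> G; rewrite /balanced /arc_ind.
  by do 4!case: (_ \in _); rewrite ?(subrr, subr0, mulr0, mul0r, mulr1).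
apply: eq_Ex => G _; rewrite (localE_switch G lf) //.
rewrite !ind_switch /flip /= !eqxx !orbT /= (negbTE ab) (eq_sym a d) (negbTE da) /= !tpermL !tpermR.
case av: ((a, v) \in G); last by rewrite /arc_ind av !(mul0r, mulr0).
case bv: ((b, v) \in G); first by rewrite /arc_ind bv !(subrr, mul0r, mulr0).
case au: ((a, u) \in G); first by rewrite /arc_ind au !(subrr, mul0r, mulr0).
case bu: ((b, u) \in G); last by rewrite /arc_ind bu !(mul0r, mulr0).
rewrite codeg_switch_up ?av ?bv ?au ?bu // eqSS; ring.
Qed.

(** [S] is the approximate common degree and [Q] bounds all deviations. [K = S (1 - S / n)] is the
    value of [D_ab] to be expected if the rows were independent sets of density [S / n]; the
    codegree would then be about [S - K]. *)
Variables (S Q K : R).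
Hypothesis s_near : forall j, `|(s j)%:R - S| <= Q.
Hypothesis t_near : forall j, `|(t j)%:R - S| <= Q.
Hypothesis x_le : forall j, (outdeg F j)%:R <= Q.
Hypothesis Q_ge1 : 1 <= Q.
Hypothesis S_ge0 : 0 <= S.
Hypothesis S_le : S <= n%:R.
Hypothesis K_def : K * n%:R = S * (n%:R - S).
Hypothesis K_big : 1000 * Q <= K.

Ltac slra := move: Q_ge1 S_ge0 S_le K_big; lra.

Lemma card_nonswappable E a b : \sum_(u | ~~ swappable E a b u) (1 : R) <= 2 * Q + 2 * #|E|%:R.
Proof.
have half j : \sum_(u | (j, u) \in F :|: E) (1 : R) <= Q + #|E|%:R.
  apply: (@le_trans _ _ ((outdeg F j)%:R + #|E|%:R)); last by rewrite lerD2r.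
  rewrite sumr_const -natrD ler_nat.
  apply: (@leq_trans #|[set u | (j, u) \in F] :|: [set u | (j, u) \in E]|).
    apply: subset_leq_card; apply/subsetP => u hu.
    by have : (j, u) \in F :|: E by []; rewrite !inE.
  rewrite cardsU; apply: (leq_trans (leq_subr _ _)); rewrite leq_add2l.
  rewrite -(card_imset (f := pair j)); last by move=> x y [].
  by apply: subset_leq_card; apply/subsetP => e /imsetP[u]; rewrite inE => h ->.
apply: (@le_trans _ _ (\sum_(u | (a, u) \in F :|: E) (1 : R) + \sum_(u | (b, u) \in F :|: E) (1 : R))).
  rewrite [X in _ <= X + _]big_mkcond [X in _ <= _ + X]big_mkcond -big_split big_mkcond /=.
  apply: ler_sum => u _; rewrite /swap_col; do 2!case: (_ \in _); rewrite /= ?addr0 ?add0r //; lra.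
by have := half a; have := half b; lra.
Qed.


Lemma sum_swappable_ge E a b (h : 'I_n -> R) : #|E|%:R <= Q ->
  (forall u, h u <= 1) -> \sum_u h u - 4 * Q <= \sum_(u | swappable E a b u) h u.
Proof.
move=> EQ h1; rewrite (bigID (swappable E a b)) /=.
have : \sum_(u | ~~ swappable E a b u) h u <= \sum_(u | ~~ swappable E a b u) (1 : R).
  by apply: ler_sum.
have := card_nonswappable E a b; lra.
Qed.

(* The tangent bound is linear in [z], so it can be summed over the third row
   [d] when only the average of [z] is known. *)
Lemma mul_ge_tangent (x y z c : R) : 0 <= x -> 0 <= y -> z <= x -> z <= y -> 0 <= c ->
  2 * z * c - c ^+ 2 <= x * y.
Proof.
move=> x0 y0 zx zy c0; have [z0|z0] := leP z 0.
  apply: (@le_trans _ _ 0); last exact: mulr_ge0.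
  have : 0 <= (- z) * c by apply: mulr_ge0; lra.
  have := sqr_ge0 c; lra.
apply: (@le_trans _ _ (z * z)); last by apply: ler_pM => //; exact: ltW.
have := sqr_ge0 (z - c); rewrite sqrrB !expr2; lra.
Qed.

Lemma ind2_ge0 e e' G : 0 <= ind e G * ind e' G.
Proof. by rewrite mulr_ge0 ?ind_ge0. Qed.

Lemma codeg_le_row a b G : G \in Om -> (codeg a b G)%:R <= S + Q.
Proof.
move=> GO; have := s_near a; rewrite ler_distl => /andP[_ h]; apply: le_trans h.
rewrite codegE -(row_sum R a GO); apply: ler_sum => w _.
by rewrite ler_piMr ?ind_ge0 ?ind_le1.
Qed.

(** Let [c] be the codegree and [y d] the number of columns common to the rows [a], [b] and [d].
    Both factors belonging to [d] are at least [z d], which is [S - y d] up to small corrections. By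
    the column sums the [y d] add up to about [c S], so for [c] near [S] the average of [z] is about
    [S - S ^ 2 / n = K]. *)
Lemma codeg_down_ge E a b G : G \in Om -> a != b -> #|E|%:R <= Q ->
  S - K / 16 <= (codeg a b G)%:R -> n%:R * K ^+ 2 / 2 <= codeg_down E a b G.
Proof.
move=> GO ab EQ; set c : R := (codeg a b G)%:R => cK.
have cle : c <= S + Q := codeg_le_row a b GO.
pose y d : R := \sum_w ind (a, w) G * ind (b, w) G * ind (d, w) G.
have y0 d : 0 <= y d by apply: sumr_ge0 => w _; rewrite !mulr_ge0 ?ind_ge0.
(* Of the [7 Q], [4 Q] are lost on columns that are not swappable and [3 Q] on the degrees of [a],
   [b] and [d]. *)
pose z d : R := S - y d - 2 * (S - c) - 7 * Q.
have step d : 2 * z d * (K / 2) - (K / 2) ^+ 2 <=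
   (\sum_(v | swappable E b d v) ind (a, v) G * ind (b, v) G * (1 - ind (d, v) G)) *
   (\sum_(u | swappable E b d u) (1 - ind (a, u) G) * (1 - ind (b, u) G) * ind (d, u) G).
  apply: mul_ge_tangent.
  - by apply: sumr_ge0 => w _; rewrite !mulr_ge0 ?subr_ge0 ?ind_ge0 ?ind_le1.
  - by apply: sumr_ge0 => w _; rewrite !mulr_ge0 ?subr_ge0 ?ind_ge0 ?ind_le1.
  - apply: le_trans (@sum_swappable_ge E b d (fun v => ind (a, v) G * ind (b, v) G * (1 - ind (d, v) G)) EQ _); last first.
      move=> u; case: (indP R (a, u) G) => ->; case: (indP R (b, u) G) => ->;
      case: (indP R (d, u) G) => ->; slra.
    under eq_bigr do rewrite mulrBr mulr1.
    rewrite sumRB -codegE -/c -/(y d) /z; slra.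
  - apply: le_trans (@sum_swappable_ge E b d (fun u => (1 - ind (a, u) G) * (1 - ind (b, u) G) * ind (d, u) G) EQ _); last first.
      move=> u; case: (indP R (a, u) G) => ->; case: (indP R (b, u) G) => ->;
      case: (indP R (d, u) G) => ->; slra.
    have : \sum_u (ind (d, u) G - ind (a, u) G - ind (b, u) G - ind (a, u) G * ind (b, u) G * ind (d, u) G
        + 2 * (ind (a, u) G * ind (b, u) G)) <=
       \sum_u (1 - ind (a, u) G) * (1 - ind (b, u) G) * ind (d, u) G.
      apply: ler_sum => u _.
      case: (indP R (a, u) G) => ->; case: (indP R (b, u) G) => ->;
      case: (indP R (d, u) G) => ->; slra.
    rewrite sumRD !sumRB sumRZ -codegE -/c -/(y d) !(row_sum R _ GO) /z.
    have := s_near a; have := s_near b; have := s_near d; rewrite !ler_distl; slra.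
  - slra.
have sumy : \sum_d y d <= c * (S + Q).
  rewrite /y exchange_big /= /c codegE mulr_suml; apply: ler_sum => w _.
  rewrite -mulr_sumr (col_sum R _ GO); apply: ler_wpM2l; first exact: ind2_ge0.
  by have := t_near w; rewrite ler_distl => /andP[].
have zle d : z d <= S by have := y0 d; rewrite /z; slra.
have sumz : n%:R * (S - 2 * (S - c) - 7 * Q) - c * (S + Q) <= \sum_d z d.
  rewrite /z; have -> : \sum_d (S - y d - 2 * (S - c) - 7 * Q) =
     \sum_(d < n) (S - 2 * (S - c) - 7 * Q) - \sum_d y d.
    by rewrite -sumRB; apply: eq_bigr => d _; ring.
  by rewrite sumr_const card_ord -[in leRHS]mulr_natl; slra.
have K0 : 0 <= K by slra.
(* The tangent is taken at [K / 2]. As [z] averages at least [3 K / 4], shown below, each row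
   contributes [3/4 K^2 - 1/4 K^2 = K^2 / 2]. *)
have main : 2 * (\sum_(d | (d != a) && (d != b)) z d) * (K / 2) - n%:R * (K / 2) ^+ 2 <= codeg_down E a b G.
  apply: (@le_trans _ _ (\sum_(d | (d != a) && (d != b)) (2 * z d * (K / 2) - (K / 2) ^+ 2))); last first.
    by apply: ler_sum => d _; exact: step.
  have -> : \sum_(d | (d != a) && (d != b)) (2 * z d * (K / 2) - (K / 2) ^+ 2) =
     2 * (\sum_(d | (d != a) && (d != b)) z d) * (K / 2)
       - \sum_(d | (d != a) && (d != b)) (K / 2) ^+ 2.
    rewrite [in RHS]mulr_sumr [in RHS]mulr_suml -sumRB; exact: eq_bigr.
  rewrite lerD2l lerN2 sumr_const -[leLHS]mulr_natl.
  apply: ler_wpM2r; first exact: sqr_ge0.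
  by rewrite ler_nat -[X in (_ <= X)%N](card_ord n) max_card.
apply: le_trans main.
have sz : \sum_d z d - 2 * S <= \sum_(d | (d != a) && (d != b)) z d.
  rewrite (bigD1 a) //= [X in _ + X - _](bigD1 b) 1?eq_sym //=.
  have := zle a; have := zle b; slra.
have N0 : 0 <= n%:R :> R by [].
have QN : Q <= n%:R.
  have : K * n%:R <= n%:R * n%:R.
    rewrite K_def; apply: ler_pM => //; slra.
  have [n0|n0] := eqVneq n 0%N; first by move: (a); rewrite n0 => -[].
  have n1 : 0 < n%:R :> R by rewrite ltr0n lt0n.
  rewrite ler_pM2r //; slra.
have key : n%:R * (3 / 4 * K) <= \sum_(d | (d != a) && (d != b)) z d.
  apply: le_trans sz; apply: (@le_trans _ _ (n%:R * (S - 2 * (S - c) - 7 * Q) - c * (S + Q) - 2 * S)); last by slra.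
  have h1 : n%:R * (S - c) <= n%:R * (K / 16) by apply: ler_wpM2l => //; slra.
  have h2 : n%:R * Q <= n%:R * (K / 1000) by apply: ler_wpM2l => //; slra.
  have h3 : S * 1 <= n%:R * Q by apply: ler_pM.
  have h4 : c * (S + Q) <= S * S + 3 * (n%:R * Q).
    have : c * (S + Q) <= (S + Q) * (S + Q) by apply: ler_wpM2r => //; slra.
    have : S * Q <= n%:R * Q by apply: ler_wpM2r => //; slra.
    have : Q * Q <= n%:R * Q by apply: ler_wpM2r => //; slra.
    slra.
  have h5 : K * n%:R = S * n%:R - S * S by rewrite K_def; ring.
  have h6 : n%:R * K = K * n%:R by rewrite mulrC.
  slra.
have : n%:R * (3 / 4 * K) * K <= (\sum_(d | (d != a) && (d != b)) z d) * K by apply: ler_wpM2r.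
rewrite !expr2; slra.
Qed.

(** Both factors count columns met by exactly one of the rows [a] and [b]. With the codegree this
    close to [S] there are at most [K / 10] of either kind; the slack over [K / 16] covers [Q] and
    the [1]. *)
Lemma codeg_up_le E a b G : G \in Om -> a != b -> S - K / 16 <= (codeg a b G)%:R + 1 ->
  codeg_up E a b G <= n%:R * K ^+ 2 / 100.
Proof.
move=> GO ab cK.
have K0 : 0 <= K by slra.
have half (x y z : R) : 0 <= x -> 0 <= y -> x <= z -> y <= z -> x * y <= z * z.
  by move=> *; apply: ler_pM.
have part (h : 'I_n -> R) (P : pred 'I_n) c : (forall w, 0 <= h w <= c w) ->
    \sum_(w | P w) h w <= \sum_w c w.
  move=> hc; rewrite [leRHS](bigID P) /= -[leLHS]addr0; apply: lerD.
    by apply: ler_sum => w _; case/andP: (hc w).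
  by apply: sumr_ge0 => w _; case/andP: (hc w) => h0; exact: le_trans.
have cge : S - K / 16 - 1 <= \sum_w ind (a, w) G * ind (b, w) G by rewrite -codegE; slra.
have term d : (\sum_(v | swappable E b d v) ind (a, v) G * (1 - ind (b, v) G) * ind (d, v) G) *
   (\sum_(u | swappable E b d u) (1 - ind (a, u) G) * ind (b, u) G * (1 - ind (d, u) G))
   <= (K / 10) * (K / 10).
  apply: half.
  - by apply: sumr_ge0 => w _; rewrite !mulr_ge0 ?subr_ge0 ?ind_ge0 ?ind_le1.
  - by apply: sumr_ge0 => w _; rewrite !mulr_ge0 ?subr_ge0 ?ind_ge0 ?ind_le1.
  - apply: le_trans (part _ _ (fun w => ind (a, w) G - ind (a, w) G * ind (b, w) G) _) _.
      move=> w; case: (indP R (a, w) G) => ->; case: (indP R (b, w) G) => ->;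
      case: (indP R (d, w) G) => ->; slra.
    rewrite sumRB (row_sum R _ GO); have := s_near a; rewrite ler_distl; slra.
  - apply: le_trans (part _ _ (fun w => ind (b, w) G - ind (a, w) G * ind (b, w) G) _) _.
      move=> w; case: (indP R (a, w) G) => ->; case: (indP R (b, w) G) => ->;
      case: (indP R (d, w) G) => ->; slra.
    rewrite sumRB (row_sum R _ GO); have := s_near b; rewrite ler_distl; slra.
apply: (@le_trans _ _ (\sum_(d | (d != a) && (d != b)) K / 10 * (K / 10))).
  by apply: ler_sum => d _; exact: term.
rewrite sumr_const -[leLHS]mulr_natl.
have -> : n%:R * K ^+ 2 / 100 = n%:R * (K / 10 * (K / 10)) by rewrite expr2; field.
apply: ler_wpM2r; first by rewrite mulr_ge0 // divr_ge0.
by rewrite ler_nat -[X in (_ <= X)%N](card_ord n) max_card.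
Qed.

(* When the rows [a] and [b] nearly coincide there are many more ways of
   lowering their codegree than of raising it back. *)
Lemma codeg_halves E f a b k : a != b -> #|E|%:R <= Q -> localE E f ->
  (forall G, 0 <= f G) -> S - K / 16 <= k%:R + 1 ->
  Ex (fun G => f G * (codeg a b G == k.+1)%:R) <=
  2^-1 * Ex (fun G => f G * (codeg a b G == k)%:R).
Proof.
move=> ab EQ lf f0 kK.
have nK : 0 < n%:R * K ^+ 2.
  rewrite mulr_gt0 ?exprn_gt0 ?ltr0n //; first exact: leq_ltn_trans (ltn_ord a).
  slra.
have down : Ex (fun G => f G * (codeg a b G == k.+1)%:R) * (n%:R * K ^+ 2 / 2) <=
    Ex (fun G => f G * (codeg a b G == k.+1)%:R * codeg_down E a b G).
  rewrite mulrC -ExZ; apply: le_Ex => G GO; rewrite mulrC.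
  case: eqP => [ck|_]; last by rewrite !mulr0 !mul0r.
  rewrite mulr1; apply: ler_wpM2l => //; apply: codeg_down_ge => //.
  by rewrite ck -[k.+1]addn1 natrD.
have up : Ex (fun G => f G * (codeg a b G == k)%:R * codeg_up E a b G) <=
    Ex (fun G => f G * (codeg a b G == k)%:R) * (n%:R * K ^+ 2 / 100).
  rewrite [leRHS]mulrC -ExZ; apply: le_Ex => G GO; rewrite [leRHS]mulrC.
  case: eqP => [ck|_]; last by rewrite !mulr0 !mul0r.
  by rewrite mulr1; apply: ler_wpM2l => //; apply: codeg_up_le => //; rewrite ck.
have e0 : 0 <= Ex (fun G => f G * (codeg a b G == k)%:R).
  by apply: Ex_ge0 => G _; rewrite mulr_ge0.
rewrite -(ler_pM2r nK).
have := codeg_switch_identity k ab lf => id0.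
have : 0 <= Ex (fun G => f G * (codeg a b G == k)%:R) * (n%:R * K ^+ 2) by rewrite mulr_ge0 // ltW.
slra.
Qed.

(** From a codegree of at least [S - K / 32] one can descend [J <= K / 32] times without leaving the
    range above [S - K / 16], where each step halves the weight. The factor [n + 1] counts the
    possible codegrees. *)
Lemma codeg_tail E f a b J : a != b -> #|E|%:R <= Q -> localE E f ->
  (forall G, 0 <= f G) -> J%:R <= K / 32 ->
  2 ^+ J * Ex (fun G => f G * (S - K / 32 <= (codeg a b G)%:R)%R%:R) <= n.+1%:R * Ex f.
Proof.
move=> ab EQ lf f0 JK.
have e0 k : 0 <= Ex (fun G => f G * (codeg a b G == k)%:R).
  by apply: Ex_ge0 => G _; rewrite mulr_ge0.
have le k : Ex (fun G => f G * (codeg a b G == k)%:R) <= Ex f.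
  by apply: le_Ex => G _; rewrite ler_piMr //; case: (_ == _).
have iter j k : (j <= k)%N -> S - K / 16 <= k%:R - j%:R + 1 ->
    2 ^+ j * Ex (fun G => f G * (codeg a b G == k)%:R) <= Ex f.
  elim: j k => [|j IH] k jk kK; first by rewrite expr0 mul1r.
  case: k jk kK => // k jk kK.
  rewrite -[k.+1%:R]natr1 -[j.+1%:R]natr1 in kK.
  have := codeg_halves (k := k) ab EQ lf f0.
  have -> : S - K / 16 <= k%:R + 1 by have : 0 <= j%:R :> R by []; slra.
  move=> /(_ isT) h; have := IH k jk; have -> : S - K / 16 <= k%:R - j%:R + 1 by slra.
  move=> /(_ isT); apply: le_trans; rewrite exprSr -mulrA ler_wpM2l ?exprn_ge0 //; slra.
rewrite -ExZ; apply: (@le_trans _ _ (\sum_(k < n.+1) Ex f)); last first.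
  by rewrite sumr_const card_ord mulr_natl.
apply: (@le_trans _ _ (\sum_(k < n.+1 | (S - K / 32 <= k%:R)) 2 ^+ J * Ex (fun G => f G * (codeg a b G == k)%:R))).
  under eq_bigr do rewrite -ExZ.
  rewrite -Ex_sum; apply: le_Ex => G _.
  have cn : (codeg a b G < n.+1)%N by rewrite ltnS -[X in (_ <= X)%N](card_ord n) max_card.
  have [h|h] := leP (S - K / 32) (codeg a b G)%:R; last first.
    by rewrite !mulr0; apply: sumr_ge0 => k _; rewrite !mulr_ge0 ?exprn_ge0.
  rewrite (bigD1 (Ordinal cn)) //= eqxx ler_wpDr //.
  by apply: sumr_ge0 => k _; rewrite !mulr_ge0 ?exprn_ge0.
rewrite big_mkcond /=; apply: ler_sum => k _; case: ifP => [h|_]; last exact: Ex_ge0.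
apply: iter; last by slra.
rewrite -(ler_nat R); apply: le_trans JK _; apply: le_trans h.
have : K <= S.
  have n0 : 0 < n%:R :> R by rewrite ltr0n (leq_ltn_trans _ (ltn_ord a)).
  rewrite -(ler_pM2r n0) K_def ler_wpM2l // lerBlDr lerDl //.
slra.
Qed.

(** [disc E a b] is at least [S - 5 Q] minus the codegree, so a small value forces a codegree in the
    range of [codeg_tail]. *)
Lemma disc_tail E f a b J : a != b -> #|E|%:R <= Q -> localE E f ->
  (forall G, 0 <= f G) -> J%:R <= K / 32 ->
  2 ^+ J * Ex (fun G => f G * (disc E a b G <= K / 64)%R%:R) <= n.+1%:R * Ex f.
Proof.
move=> ab EQ lf f0 JK; apply: le_trans (codeg_tail ab EQ lf f0 JK).
apply: ler_wpM2l; first exact: exprn_ge0.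
apply: le_Ex => G GO; apply: ler_wpM2l => //; rewrite ler_nat.
case: (leP _ (K / 64)) => // h; rewrite lt0b.
have := @sum_swappable_ge E a b (fun u => (1 - ind (a, u) G) * ind (b, u) G) EQ.
have le1 u : (1 - ind (a, u) G) * ind (b, u) G <= 1.
  by case: (indP R (a, u) G) => ->; case: (indP R (b, u) G) => ->; slra.
move=> /(_ le1); rewrite -/(disc E a b G).
under eq_bigr do rewrite mulrBl mul1r.
rewrite sumRB (row_sum R _ GO) -codegE => h2.
have := s_near b; rewrite ler_distl => /andP[h3 _]; slra.
Qed.

End Tail.

(** * Orders of magnitude *)

(** An explicit form of [x = O(n^(-k/2 + o(1)))]. Only [k] measures precision; [m] records the
    powers of [q] spent, one for every addition because [2 <= q]. *)
Definition bounded (R : realType) (q r : R) (m k : nat) (x : R) : Prop := `|x| <= q ^+ m * r ^+ k.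

Section Calculus.
Variables (R : realType) (q r : R).
Hypotheses (q2 : 2 <= q) (r0 : 0 < r) (r1 : r <= 1).
Local Notation bnd := (bounded q r).

Lemma qr_pos m k : 0 < q ^+ m * r ^+ k.
Proof. by rewrite mulr_gt0 ?exprn_gt0 //; have := q2; lra. Qed.

Lemma qr_le m k m' k' : (m <= m')%N -> (k' <= k)%N -> q ^+ m * r ^+ k <= q ^+ m' * r ^+ k'.
Proof.
move=> mm kk; apply: ler_pM; rewrite ?exprn_ge0 //; try by have := q2; have := r0; lra.
  by rewrite ler_weXn2l //; have := q2; lra.
by apply: ler_wiXn2l => //; exact: ltW.
Qed.

Lemma bndW m k m' k' x : bnd m k x -> (m <= m')%N -> (k' <= k)%N -> bnd m' k' x.
Proof. by move=> h mm kk; apply: le_trans h _; exact: qr_le. Qed.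

Lemma bndD m k m' k' x y : bnd m k x -> bnd m' k' y ->
  bnd (maxn m m').+1 (minn k k') (x + y).
Proof.
move=> hx hy; apply: (le_trans (ler_normD _ _)).
have h1 : `|x| <= q ^+ maxn m m' * r ^+ minn k k'.
  by apply: le_trans hx (qr_le _ _); rewrite ?leq_maxl ?geq_minl.
have h2 : `|y| <= q ^+ maxn m m' * r ^+ minn k k'.
  by apply: le_trans hy (qr_le _ _); rewrite ?leq_maxr ?geq_minr.
rewrite exprS -mulrA; have := qr_pos (maxn m m') (minn k k').
set z := _ * _ in h1 h2 *; move=> z0.
have : 2 * z <= q * z by rewrite ler_pM2r.
lra.
Qed.

Lemma bndN m k x : bnd m k x -> bnd m k (- x).
Proof. by rewrite /bnd normrN. Qed.

Lemma bndM m k m' k' x y : bnd m k x -> bnd m' k' y -> bnd (m + m') (k + k') (x * y).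
Proof.
move=> hx hy; rewrite /bnd normrM !exprD mulrACA; exact: ler_pM.
Qed.

Lemma bndX m k x j : bnd m k x -> bnd (m * j) (k * j) (x ^+ j).
Proof.
move=> hx; rewrite /bnd normrX !exprM -exprMn; apply: lerXn2r => //.
by rewrite nnegrE ltW ?qr_pos.
Qed.

Lemma bnd_r : bnd 0 1 r.
Proof. by rewrite /bnd expr0 mul1r expr1 ger0_norm // ltW. Qed.

Lemma bnd_q : bnd 1 0 q.
Proof. by rewrite /bnd expr0 mulr1 expr1 ger0_norm //; have := q2; lra. Qed.

Lemma bnd_nat c : bnd (up_log 2 c) 0 c%:R.
Proof.
rewrite /bnd expr0 mulr1 ger0_norm //.
apply: (@le_trans _ _ ((2 ^ up_log 2 c)%:R)); first by rewrite ler_nat up_logP.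
rewrite natrX; apply: lerXn2r => //; rewrite nnegrE; have := q2; lra.
Qed.

Lemma bnd1 : bnd 0 0 1.
Proof. by rewrite /bnd !expr0 mulr1 normr1. Qed.

Lemma bnd0 m k : bnd m k 0.
Proof. by rewrite /bnd normr0 ltW // qr_pos. Qed.

Lemma bnd_natV c : bnd 0 0 (c%:R^-1).
Proof.
rewrite /bnd !expr0 mulr1 ger0_norm ?invr_ge0 //.
case: c => [|c]; first by rewrite invr0.
by rewrite invf_le1 ?ltr0n // ler1n.
Qed.

Lemma bnd_le1 x : `|x| <= 1 -> bnd 0 0 x.
Proof. by rewrite /bnd !expr0 mulr1. Qed.

Lemma bnd_sum (I : finType) (P : pred I) (f : I -> R) m k : #|I|%:R * r ^+ 2 = 1 ->
  (forall i, P i -> bnd m k (f i)) -> bnd m k (r ^+ 2 * \sum_(i | P i) f i).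
Proof.
move=> nr h; rewrite /bnd normrM.
have -> : q ^+ m * r ^+ k = `|r ^+ 2| * (#|I|%:R * (q ^+ m * r ^+ k)).
  have e1 : #|I|%:R * r ^+ 2 * (q ^+ m * r ^+ k) = q ^+ m * r ^+ k by rewrite nr mul1r.
  by rewrite ger0_norm ?exprn_ge0 ?ltW // -[LHS]e1; ring.
apply: ler_wpM2l => //; apply: (le_trans (ler_norm_sum _ _ _)).
apply: (@le_trans _ _ (\sum_(i | P i) q ^+ m * r ^+ k)); first exact: ler_sum.
rewrite sumr_const -[leLHS]mulr_natl; apply: ler_wpM2r; first by rewrite ltW ?qr_pos.
by rewrite ler_nat max_card.
Qed.

End Calculus.

Ltac bnd_hyp := match goal with
  | H : bounded ?q ?r _ _ ?x |- bounded ?q ?r _ _ ?x => exact: H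
  | H : forall _, bounded ?q ?r _ _ _ |- bounded ?q ?r _ _ _ => exact: H
  | H : forall _ _, bounded ?q ?r _ _ _ |- bounded ?q ?r _ _ _ => exact: H
  end.

(* Synthesises the exponents of a [bounded] for an arithmetic expression whose
   atoms are bounded in the context. *)
Ltac bnd_synth q2 r0 r1 := first
  [ bnd_hyp
  | lazymatch goal with
    | |- bounded ?q ?r _ _ (?x + ?y) => apply: (bndD q2 r0 r1); bnd_synth q2 r0 r1
    | |- bounded ?q ?r _ _ (- ?x) => apply: bndN; bnd_synth q2 r0 r1
    | |- bounded ?q ?r _ _ (?c%:R^-1) => exact: bnd_natV
    | |- bounded ?q ?r _ _ (?x * ?y) => apply: bndM; bnd_synth q2 r0 r1
    | |- bounded ?q ?r _ _ (?x ^+ ?j) => apply: (bndX q2 r0); bnd_synth q2 r0 r1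
    | |- bounded ?q ?r _ _ 1 => exact: bnd1
    | |- bounded ?q ?r _ _ 0 => exact: (bnd0 q2 r0 0 0)
    | |- bounded ?q ?r _ _ (?c%:R) => exact: (bnd_nat r q2)
    | |- bounded ?q ?r _ _ ?r => exact: (bnd_r q r0)
    | |- bounded ?q ?r _ _ ?q => exact: (bnd_q r q2)
    end ].

Ltac bnd_auto q2 r0 r1 :=
  apply: (bndW q2 r0 r1); [bnd_synth q2 r0 r1 | by vm_compute | by vm_compute].

(** * Comparing two entries of a column *)

(* [r] plays the role of n^(-1/2), and [q] that of a small power of n absorbing
   all constants, logarithms and factors n^eps. *)
Record nice (R : realType) (q r l : R) n (s t : 'I_n -> nat) (F : digraph n) : Prop := Nice {
  nice_q : 2 <= q;
  nice_r : 0 < r;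
  nice_n : n%:R * r ^+ 2 = 1;
  nice_qr : q ^+ 100 * r <= 1;
  nice_l0 : 0 <= l;
  nice_l1 : l <= 1;
  nice_L : 1 <= q * (l * (1 - l));
  nice_s : forall j, `|(s j)%:R - l * n%:R| <= q / r;
  nice_t : forall j, `|(t j)%:R - l * n%:R| <= q / r;
  nice_x : forall j, (outdeg F j)%:R <= q / r;
  nice_y : forall j, (indeg F j)%:R <= q / r;
  nice_X : (#|F|)%:R <= q ^+ 2 * n%:R;
  nice_ss : \sum_j (s j)%:R = l * n%:R ^+ 2;
  nice_ts : \sum_j (t j)%:R = l * n%:R ^+ 2 }.

Section Expansion.
Variables (R : realType) (q r l : R) (n : nat) (s t : 'I_n -> nat) (F : digraph n).
Implicit Types (G : digraph n) (a b u v : 'I_n) (f : digraph n -> R).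
Implicit Types (e : 'I_n * 'I_n) (E : digraph n).
Local Notation ind := (@arc_ind R n).
Local Notation Ex := (@ens_sum R n s t F).
Local Notation Om := (@ensemble n s t F).
Local Notation swappable := (@swap_col n F).
Local Notation disc := (@discrep R n F).
Local Notation bnd := (bounded q r).
Local Notation N := (n%:R : R).
Local Notation L := (l * (1 - l)).
Local Notation Q := (q / r).

Hypothesis Hn : nice q r l s t F.

Let q2 := nice_q Hn.
Let r0 := nice_r Hn.
Let Nr := nice_n Hn.

Lemma nice_r_small : q ^+ 99 * r <= 2^-1 /\ r <= 1.
Proof.
have h := nice_qr Hn; have q2' := q2; have r0' := r0.
have q99 : 1 <= q ^+ 99 by rewrite exprn_ege1 //; lra.
have h1 : 2 * (q ^+ 99 * r) <= q * (q ^+ 99 * r).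
  by rewrite ler_pM2r // mulr_gt0 //; lra.
have h2 : 1 * r <= q ^+ 99 * r by rewrite ler_pM2r.
move: h; rewrite exprS -mulrA => h; split; lra.
Qed.

Let r1 : r <= 1 := proj2 nice_r_small.

Lemma n_as_r : N = r ^- 2.
Proof. by apply: (mulIf (x := r ^+ 2)); rewrite ?mulVf ?Nr // expf_neq0 // gt_eqF. Qed.

Lemma L_gt0 : 0 < L.
Proof.
have := nice_L Hn; have := q2; have [//|h] := ltP 0 L.
have : q * L <= 0 by rewrite mulr_ge0_le0 //; have := q2; lra.
lra.
Qed.

Lemma L_le : L <= 4^-1.
Proof. have := sqr_ge0 (l - 2^-1); rewrite expr2; lra. Qed.

Lemma bnd_Linv : bnd 1 0 L^-1.
Proof.
have L0 := L_gt0; rewrite /bounded expr0 mulr1 expr1 ger0_norm ?invr_ge0 ?(ltW L0) //.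
by rewrite -[leLHS]mul1r ler_pdivrMr //; exact: nice_L Hn.
Qed.

(** Constants are paid for in powers of [q]: a constant [c <= q ^ k] uses up [k] of the hundred
    powers that [nice_qr] provides. *)
Lemma pow_q_small (m k : nat) (c : R) : (m + k <= 99)%N -> 0 <= c -> c <= q ^+ k -> c * q ^+ m * r <= 2^-1.
Proof.
move=> mk c0 ck; apply: le_trans (proj1 nice_r_small); rewrite ler_pM2r //.
apply: (@le_trans _ _ (q ^+ k * q ^+ m)).
  by apply: ler_wpM2r => //; rewrite exprn_ge0 //; have := q2; lra.
by rewrite -exprD ler_weXn2l // 1?addnC //; have := q2; lra.
Qed.

Lemma pow2q (k : nat) : (2 ^ k)%:R <= q ^+ k.
Proof. by rewrite natrX; apply: lerXn2r => //; rewrite nnegrE; have := q2; lra. Qed.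

Lemma Q_ge1 : 1 <= Q.
Proof. rewrite ler_pdivlMr // mul1r; have := r1; have := q2; lra. Qed.

Lemma Q_small : 1000 * Q <= L * N.
Proof.
have h : 1000 * q ^+ 2 * r <= 2^-1.
  by apply: (@pow_q_small 2 10) => //; apply: le_trans (pow2q 10); rewrite ler_nat.
have L1 := nice_L Hn; have q0 : 0 < q by have := q2; lra.
rewrite n_as_r.
have r20 : 0 < r ^+ 2 by rewrite exprn_gt0.
rewrite ler_pdivlMr // -(ler_pM2l q0).
have -> : q * (1000 * Q * r ^+ 2) = 1000 * q ^+ 2 * r by field; rewrite gt_eqF.
lra.
Qed.

Lemma Q_ge8 : 8 <= Q.
Proof.
have h : 8 * q ^+ 0 * r <= 2^-1.
  by apply: (@pow_q_small 0 3) => //; apply: le_trans (pow2q 3); rewrite ler_nat.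
rewrite ler_pdivlMr //; move: h; rewrite expr0 mulr1; have := q2; lra.
Qed.

Lemma pow15_le_pow2 (J : nat) : (120 <= J)%N -> (J.+1 ^ 15 <= 2 ^ J)%N.
Proof.
move=> J120; set i := (J %/ 15)%N.
have i8 : (8 <= i)%N by rewrite leq_divRL.
have base m : (15 * (m + 8).+1 <= 2 ^ (m + 8))%N.
  elim: m => [//|m IH]; rewrite addSn expnS mulnS.
  apply: (@leq_trans (2 * (15 * (m + 8).+1))); last by rewrite leq_mul2l.
  by rewrite [leqRHS]mul2n -addnn leq_add2r leq_pmulr.
have h : (J.+1 <= 2 ^ i)%N.
  have := base (i - 8)%N; rewrite subnK // => h8; apply: leq_trans h8.
  by rewrite mulnC ltn_ceil.
apply: (@leq_trans ((2 ^ i) ^ 15)); first by rewrite leq_exp2r.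
by rewrite -expnM leq_exp2l // leq_trunc_div.
Qed.

(** [J], the number of halvings in the tail bound, is the integer part of [1 / r], about the square
    root of [n]: far below [L N], yet [2 ^ J] exceeds every fixed power of [n] needed. It is
    compared with [(J + 1) ^ 15], of which 12 factors match [r ^ 12], two match [n], and one absorbs
    the 2 in [n + 1 <= 2 n]. *)
Lemma nice_J : exists J : nat, J%:R <= L * N / 32 /\ n.+1%:R <= 2 ^+ J * r ^+ 12.
Proof.
have q2' := q2; have r0' := r0.
have rV : 0 < r^-1 by rewrite invr_gt0.
have /andP[J1 J2] := truncn_itv (ltW rV); set J := Num.truncn r^-1 in J1 J2.
exists J; split.
  apply: le_trans J1 _.
  have h : 32 * q ^+ 1 * r <= 2^-1.
    by apply: (@pow_q_small 1 5) => //; apply: le_trans (pow2q 5); rewrite ler_nat.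
  have LL := nice_L Hn; have q0 : 0 < q by lra.
  have c0 : 0 < 32 * q * r ^+ 2 by rewrite !mulr_gt0 ?exprn_gt0.
  rewrite n_as_r -(ler_pM2l c0).
  have -> : 32 * q * r ^+ 2 * r^-1 = 32 * q ^+ 1 * r by field; rewrite gt_eqF.
  have -> : 32 * q * r ^+ 2 * (L * r ^- 2 / 32) = q * L by field; rewrite gt_eqF.
  lra.
have J120 : (120 <= J)%N.
  have h : 128 * q ^+ 0 * r <= 2^-1.
    by apply: (@pow_q_small 0 7) => //; apply: le_trans (pow2q 7); rewrite ler_nat.
  rewrite expr0 mulr1 in h.
  have h2 : 128 <= r^-1 by rewrite -[leRHS]mul1r ler_pdivlMr //; lra.
  have : (127 < J.+1)%N by rewrite -(ltr_nat R); lra.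
  by rewrite ltnS; apply: leq_trans.
have p2 : (J.+1%:R ^+ 15 : R) <= 2 ^+ J.
  by rewrite -!natrX ler_nat pow15_le_pow2.
have r120 : 0 < r ^+ 12 by rewrite exprn_gt0.
have n1 : 1 <= N.
  rewrite ler1n lt0n; apply/eqP => n0; move: Nr; rewrite n0 mul0r => /eqP.
  by rewrite eq_sym oner_eq0.
apply: (@le_trans _ _ (J.+1%:R ^+ 15 * r ^+ 12)); last by apply: ler_wpM2r => //; exact: ltW.
have NJ : N <= J.+1%:R ^+ 2.
  by rewrite n_as_r -exprVn; apply: lerXn2r; rewrite ?nnegrE ?(ltW rV) // ltW.
have J2' : 2 <= J.+1%:R :> R by rewrite ler_nat ltnS (leq_trans _ J120).
have x0 : r ^+ 12 * J.+1%:R ^+ 12 = (r * J.+1%:R) ^+ 12 by rewrite exprMn.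
have h1 : 1 <= (r * J.+1%:R) ^+ 12.
  apply: exprn_ege1; rewrite mulrC -ler_pdivrMr // div1r; exact: ltW.
have -> : J.+1%:R ^+ 15 * r ^+ 12 = (r * J.+1%:R) ^+ 12 * (J.+1%:R ^+ 2 * J.+1%:R) by rewrite -x0; ring.
apply: (@le_trans _ _ (1 * (N * 2))); last by apply: ler_pM => //; [exact: mulr_ge0 | exact: ler_pM].
by rewrite mul1r mulr_natr -natr1; lra.
Qed.

(** The tail bound with [K = L N]. The power [r ^ 12 = n ^ (-6)] stays negligible after
    multiplication by [N ^ 2 Q], which occurs where [1 / D] is bounded by [1] only. *)
Lemma disc_rare E f a b : a != b -> (#|E| <= 8)%N -> localE E f ->
  Ex (fun G => `|f G| * (disc E a b G <= L * N / 64)%R%:R) <= r ^+ 12 * Ex (fun G => `|f G|).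
Proof.
move=> ab E8 lf; have [J [J1 J2]] := nice_J.
have N0 : 0 < N by rewrite ltr0n (leq_ltn_trans _ (ltn_ord a)).
have EQ : #|E|%:R <= Q by apply: le_trans Q_ge8; rewrite ler_nat.
have Sdef : L * N * N = l * N * (N - l * N) by ring.
have S0 : 0 <= l * N by rewrite mulr_ge0 ?(nice_l0 Hn) // ltW.
have S1 : l * N <= N by rewrite ger_pMl ?(nice_l1 Hn).
have h := disc_tail (nice_s Hn) (nice_t Hn) (nice_x Hn) Q_ge1 S0 S1 Sdef
  Q_small ab EQ (localE_norm lf) (fun G => normr_ge0 _) J1.
have p2 : 0 < 2 ^+ J :> R by rewrite exprn_gt0.
rewrite -(ler_pM2l p2); apply: le_trans h _; rewrite mulrA; apply: ler_wpM2r => //.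
by apply: Ex_ge0.
Qed.

Lemma sum_nonswap E a b : (#|E| <= 8)%N -> \sum_(u | ~~ swappable E a b u) (1 : R) <= 4 * Q.
Proof.
move=> E8; have := card_nonswappable (nice_x Hn) E a b.
have : #|E|%:R <= Q by apply: le_trans Q_ge8; rewrite ler_nat.
lra.
Qed.

Lemma discB E a b G : G \in Om ->
  disc E b a G - disc E a b G =
  (s a)%:R - (s b)%:R - \sum_(u | ~~ swappable E a b u) (ind (a, u) G - ind (b, u) G).
Proof.
move=> GO; rewrite -(row_sum R a GO) -(row_sum R b GO) -sumRB.
rewrite [X in _ = X - _](bigID (swappable E a b)) /= addrK /discrep.
rewrite [X in X - _](eq_bigl (swappable E a b)); last by move=> u; rewrite swappableC.
by rewrite -sumRB; apply: eq_bigr => u _; ring.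
Qed.

Lemma discB_le E a b G : G \in Om -> (#|E| <= 8)%N ->
  `|disc E b a G - disc E a b G| <= 6 * Q.
Proof.
move=> GO E8; rewrite discB //.
have h1 : `|\sum_(u | ~~ swappable E a b u) (ind (a, u) G - ind (b, u) G)| <= 4 * Q.
  apply: le_trans (sum_nonswap a b E8); apply: (le_trans (ler_norm_sum _ _ _)).
  apply: ler_sum => u _; case: (indP R (a, u) G) => ->; case: (indP R (b, u) G) => ->;
  by rewrite ?subrr ?subr0 ?sub0r ?normrN ?normr0 ?normr1.
have := nice_s Hn a; have := nice_s Hn b; move: h1; rewrite !ler_norml; lra.
Qed.

Lemma disc_leN E a b G : disc E a b G <= N.
Proof.
apply: (@le_trans _ _ (\sum_(u | swappable E a b u) (1 : R))).
  apply: ler_sum => u _; case: (indP R (a, u) G) => ->; case: (indP R (b, u) G) => ->; lra.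
by rewrite sumr_const ler_nat -[X in (_ <= X)%N](card_ord n) max_card.
Qed.

Definition only_second a b v G : R := (1 - ind (a, v) G) * ind (b, v) G.

Lemma wtP a b v G : only_second a b v G = 0 \/ only_second a b v G = 1.
Proof.
rewrite /only_second; case: (indP R (a, v) G) => ->; case: (indP R (b, v) G) => ->;
rewrite ?(subr0, subrr, mulr0, mulr1); by [left | right].
Qed.

Lemma disc_ge1 E a b v G : swappable E a b v -> only_second a b v G = 1 -> 1 <= disc E a b G.
Proof.
move=> fv w1; rewrite /discrep (bigD1 v) //= -/(only_second a b v G) w1 lerDl.
by apply: sumr_ge0 => u _; rewrite mulr_ge0 ?subr_ge0 ?ind_ge0 ?ind_le1.
Qed.

(* The switching identity with the weight [phi x = 1 / x]. The first summand
   collects the digraphs for which no switching is available, where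
   [disc E a b G] vanishes and its inverse is the junk value [0]. *)
Lemma entry_diff E f a b v : a != b -> localE E f -> swappable E a b v ->
  Ex (fun G => f G * (ind (a, v) G - ind (b, v) G)) =
  Ex (fun G => f G * (ind (a, v) G * (1 - ind (b, v) G)) * (disc E a b G == 0)%:R) +
  Ex (fun G => f G * only_second a b v G * ((disc E b a G - disc E a b G) / disc E a b G)).
Proof.
move=> ab lf fv.
have := switch_identity s t (fun x => x^-1) ab lf fv.
set A := (X in X = _ -> _); set B := (X in _ = X -> _) => AB.
have -> : Ex (fun G => f G * only_second a b v G * ((disc E b a G - disc E a b G) / disc E a b G)) =
   B - Ex (fun G => f G * only_second a b v G).
  rewrite -ExB; apply: eq_Ex => G _; rewrite mulrBl.
  have -> : f G * (1 - ind (a, v) G) * ind (b, v) G = f G * only_second a b v G by rewrite /only_second mulrA.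
  case: (wtP a b v G) => w; first by rewrite w; ring.
  have d1 := disc_ge1 fv w; have d0 : disc E a b G != 0 by rewrite gt_eqF //; lra.
  by rewrite divff // w; ring.
rewrite -AB /A.
have -> : forall x y z : R, x + (y - z) = x + y - z by move=> *; ring.
rewrite -ExD -ExB; apply: eq_Ex => G _; rewrite /only_second.
have [->|d0] := eqVneq (disc E a b G) 0; first by rewrite mul0r /=; ring.
by rewrite divff // /=; ring.
Qed.

Lemma entry_diff_rare E f a b v : a != b -> (#|E| <= 8)%N -> localE E f ->
  `|Ex (fun G => f G * (ind (a, v) G * (1 - ind (b, v) G)) * (disc E a b G == 0)%:R)|
   <= r ^+ 12 * Ex (fun G => `|f G|).
Proof.
move=> ab E8 lf; apply: le_trans (disc_rare ab E8 lf).
apply: (le_trans (normEx s t F _)); apply: le_Ex => G _.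
rewrite !normrM -mulrA; apply: ler_wpM2l => //.
case: eqP => [->|_]; last by rewrite normr0 mulr0.
have -> : (0 <= L * N / 64)%R by rewrite divr_ge0 // mulr_ge0 // ltW // L_gt0.
rewrite normr1 mulr1 ger0_norm ?ind_ge0 // ger0_norm ?subr_ge0 ?ind_le1 //.
by rewrite mulr_ile1 ?ind_ge0 ?subr_ge0 ?ind_le1 // gerBl ind_ge0.
Qed.

End Expansion.

(* [p e] approximates, within [c], the probability of the arc [e] conditionally
   on the status of any [k] other arcs. *)
Definition accurate (R : realType) n (s t : 'I_n -> nat) (F : digraph n) (k : nat) (c : R)
    (p : 'I_n * 'I_n -> R) :=
  forall (E : digraph n) (f : digraph n -> R) e, (#|E| <= k)%N -> localE E f -> e \notin E ->
    `|ens_sum s t F (fun G => f G * (arc_ind R e G - p e))| <= c * ens_sum s t F (fun G => `|f G|).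

(** * First and second moments of the number of switchable columns *)

Section Moments.
Variables (R : realType) (q r l : R) (n : nat) (s t : 'I_n -> nat) (F : digraph n).
Implicit Types (G : digraph n) (a b u v : 'I_n) (f : digraph n -> R).
Implicit Types (e : 'I_n * 'I_n) (E : digraph n).
Local Notation ind := (@arc_ind R n).
Local Notation Ex := (@ens_sum R n s t F).
Local Notation Om := (@ensemble n s t F).
Local Notation swappable := (@swap_col n F).
Local Notation disc := (@discrep R n F).
Local Notation bnd := (bounded q r).
Local Notation N := (n%:R : R).
Local Notation L := (l * (1 - l)).
Local Notation Q := (q / r).
Local Notation wt := (@only_second R n).

Variables (k : nat) (c : R) (p : 'I_n * 'I_n -> R).
Hypothesis acc : accurate s t F k c p.
Hypothesis p01 : forall e, 0 <= p e <= 1.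
Hypothesis c0 : 0 <= c.

Definition dev a b u G : R := (1 - ind (a, u) G) * ind (b, u) G - (1 - p (a, u)) * p (b, u).

Lemma dev_le1 a b u G : `|dev a b u G| <= 1.
Proof.
have ha := p01 (a, u); have hb := p01 (b, u).
have : 0 <= (1 - p (a, u)) * p (b, u) <= 1.
  case/andP: ha => a0 a1; case/andP: hb => b0 b1.
  by rewrite mulr_ge0 ?subr_ge0 //= mulr_ile1 ?subr_ge0 // gerBl.
rewrite /dev ler_norml.
case: (indP R (a, u) G) => ->; case: (indP R (b, u) G) => ->; lra.
Qed.

Lemma Ex_norm_mono f f' : (forall G, `|f G| <= `|f' G|) -> Ex (fun G => `|f G|) <= Ex (fun G => `|f' G|).
Proof. by move=> h; apply: le_Ex => G _. Qed.

Lemma Ex_norm_ge0 f : 0 <= Ex (fun G => `|f G|).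
Proof. exact: Ex_ge0. Qed.

(** The two indicators are replaced by their approximate means one at a time. The first replacement
    is conditional on the other entry as well, which is why [#|E| < k] is strict. *)
Lemma Ex_dev E f a b u : a != b -> (#|E| < k)%N -> localE E f ->
  (a, u) \notin E -> (b, u) \notin E ->
  `|Ex (fun G => f G * dev a b u G)| <= 2 * c * Ex (fun G => `|f G|).
Proof.
move=> ab Ek lf au bu.
have -> : Ex (fun G => f G * dev a b u G) =
    Ex (fun G => f G * (1 - ind (a, u) G) * (ind (b, u) G - p (b, u)))
    - p (b, u) * Ex (fun G => f G * (ind (a, u) G - p (a, u))).
  by rewrite -ExZ -ExB; apply: eq_Ex => G _; rewrite /dev; ring.
apply: (le_trans (ler_normB _ _)).
have h1 : `|Ex (fun G => f G * (1 - ind (a, u) G) * (ind (b, u) G - p (b, u)))| <= c * Ex (fun G => `|f G|).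
  have E1 : (#|(a, u) |: E| <= k)%N by rewrite cardsU1 au add1n.
  have bE : (b, u) \notin (a, u) |: E.
    by rewrite !inE negb_or bu andbT xpair_eqE negb_and eq_sym ab.
  apply: (le_trans (acc E1 (localE_indC (e := (a, u)) lf) bE)).
  apply: ler_wpM2l => //; apply: Ex_norm_mono => G; rewrite normrM ler_piMr //.
  by rewrite ger0_norm ?subr_ge0 ?ind_le1 // gerBl ind_ge0.
have h2 : `|p (b, u) * Ex (fun G => f G * (ind (a, u) G - p (a, u)))| <= c * Ex (fun G => `|f G|).
  rewrite normrM; apply: le_trans (acc (ltnW Ek) lf au); rewrite ler_piMl //.
  by case/andP: (p01 (b, u)) => ? ?; rewrite ger0_norm.
rewrite -mulrA; lra.
Qed.

(** One column [v] may have entries in [E], where accuracy says nothing; it costs the trivial bound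
    [1], every other column [2 c]. *)
Lemma Ex_sum_dev E f a b v (P : pred 'I_n) : a != b -> (#|E| < k)%N -> localE E f ->
  (forall w, P w -> w != v -> ((a, w) \notin E) && ((b, w) \notin E)) ->
  `|Ex (fun G => f G * \sum_(w | P w) dev a b w G)| <= (1 + 2 * N * c) * Ex (fun G => `|f G|).
Proof.
move=> ab Ek lf hP.
have -> : Ex (fun G => f G * \sum_(w | P w) dev a b w G) = \sum_(w | P w) Ex (fun G => f G * dev a b w G).
  by rewrite -Ex_sum; apply: eq_Ex => G _; rewrite mulr_sumr.
apply: (le_trans (ler_norm_sum _ _ _)).
have W0 := Ex_norm_ge0 f.
apply: (@le_trans _ _ (\sum_w ((w == v)%:R * Ex (fun G => `|f G|) + 2 * c * Ex (fun G => `|f G|)))); last first.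
  rewrite sumRD sumr_const card_ord -mulr_suml (bigD1 v) //= eqxx big1 ?addr0; last first.
    by move=> w /negbTE ->.
  by rewrite -[X in _ + X <= _]mulr_natl mul1r; lra.
rewrite [leLHS]big_mkcond /=; apply: ler_sum => w _.
have c2 : 0 <= 2 * c * Ex (fun G => `|f G|) by rewrite !mulr_ge0.
case: ifP => Pw; last by rewrite addr_ge0 // mulr_ge0.
have [->|wv] := eqVneq w v; last first.
  by rewrite mul0r add0r; case/andP: (hP _ Pw wv) => h1 h2; exact: Ex_dev h1 h2.
rewrite mul1r; apply: ler_wpDr => //; apply: (le_trans (normEx s t F _)).
by apply: Ex_norm_mono => G; rewrite normrM ler_piMr // dev_le1.
Qed.

Definition mean_discrep E a b : R := \sum_(u | swappable E a b u) (1 - p (a, u)) * p (b, u).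

Lemma disc_sub E a b G : disc E a b G - mean_discrep E a b = \sum_(u | swappable E a b u) dev a b u G.
Proof. by rewrite /discrep /mean_discrep -sumRB. Qed.

Lemma localE_dev E f a b u : localE E f -> localE ((b, u) |: ((a, u) |: E)) (fun G => f G * dev a b u G).
Proof.
move=> h G G' GG'; rewrite (h G G'); last by move=> e' eE; apply: GG'; rewrite !inE eE !orbT.
by rewrite /dev /arc_ind !GG' // !inE eqxx ?orbT.
Qed.

Lemma cardU1_le E e : (#|e |: E| <= #|E|.+1)%N.
Proof. by rewrite cardsU1; case: (_ \notin _). Qed.

(** A variance bound from first moments: one factor of the square is split into its summands [dev],
    each is absorbed into the weight at the price of two more entries in [E], and the other factor
    then has small mean by [Ex_sum_dev]. *)
Lemma Ex_disc_sqr E f a b : a != b -> (#|E|.+2 < k)%N -> localE E f ->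
  Ex (fun G => `|f G| * (disc E a b G - mean_discrep E a b) ^+ 2) <=
  N * (1 + 2 * N * c) * Ex (fun G => `|f G|).
Proof.
move=> ab Ek lf.
have -> : Ex (fun G => `|f G| * (disc E a b G - mean_discrep E a b) ^+ 2) =
   \sum_(u | swappable E a b u) Ex (fun G => `|f G| * dev a b u G * \sum_(w | swappable E a b w) dev a b w G).
  rewrite -Ex_sum; apply: eq_Ex => G _; rewrite !disc_sub expr2.
  by rewrite [X in _ * X]mulr_suml mulr_sumr; apply: eq_bigr => u _; rewrite mulrA.
have nc : 0 <= 1 + 2 * N * c by rewrite addr_ge0 // !mulr_ge0.
apply: (@le_trans _ _ (\sum_(u : 'I_n) (1 + 2 * N * c) * Ex (fun G => `|f G|))); last first.
  by rewrite sumr_const card_ord -[leLHS]mulr_natl mulrA.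
rewrite [leLHS]big_mkcond /=; apply: ler_sum => u _.
have W0 := Ex_norm_ge0 f.
case: ifP => fu; last by rewrite mulr_ge0.
apply: (le_trans (ler_norm _)).
apply: (le_trans (@Ex_sum_dev ((b, u) |: ((a, u) |: E)) _ a b u _ ab _ (localE_dev (a := a) (b := b) (u := u) (localE_norm lf)) _)).
- by apply: leq_trans Ek; rewrite ltnS (leq_trans (cardU1_le _ _)) // ltnS cardU1_le.
- move=> w; rewrite /swap_col !inE !negb_or => /andP[/andP[_ aE] /andP[_ bE]] wu.
  by rewrite aE bE !andbT !xpair_eqE !negb_and wu !orbT.
apply: ler_wpM2l => //; apply: Ex_norm_mono => G.
by rewrite normrM normr_id ler_piMr // dev_le1.
Qed.

End Moments.

(** The error terms of the expansion collected: the coefficients add up to 4825, below [2 ^ 13], and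
    no power of [q] exceeds the fourth, whence [17 = 13 + 4]. *)
Lemma constants_le (R : realType) (q : R) : 2 <= q ->
  1 + (40 * q ^+ 2 + 32 * q) + 120 * q ^+ 3 + (4608 * q ^+ 4 + 24 * q ^+ 3) <= q ^+ 17.
Proof.
move=> q2; have q1 : 1 <= q by lra.
have p1 : q <= q ^+ 4 by rewrite -[leLHS]expr1 ler_weXn2l.
have p2 : q ^+ 2 <= q ^+ 4 by rewrite ler_weXn2l.
have p3 : q ^+ 3 <= q ^+ 4 by rewrite ler_weXn2l.
have p4 : 1 <= q ^+ 4 by rewrite exprn_ege1.
have p13 : 2 ^+ 13 <= q ^+ 13 by apply: lerXn2r => //; rewrite nnegrE; lra.
rewrite (exprD _ 13 4); apply: (@le_trans _ _ (2 ^+ 13 * q ^+ 4)); last first.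
  by apply: ler_wpM2r => //; lra.
move: (q ^+ 4) p1 p2 p3 p4 => x p1 p2 p3 p4.
lra.
Qed.

Section Comparison.
Variables (R : realType) (q r l : R) (n : nat) (s t : 'I_n -> nat) (F : digraph n).
Implicit Types (G : digraph n) (a b u v : 'I_n) (f : digraph n -> R).
Implicit Types (e : 'I_n * 'I_n) (E : digraph n).
Local Notation ind := (@arc_ind R n).
Local Notation Ex := (@ens_sum R n s t F).
Local Notation Om := (@ensemble n s t F).
Local Notation swappable := (@swap_col n F).
Local Notation disc := (@discrep R n F).
Local Notation N := (n%:R : R).
Local Notation L := (l * (1 - l)).
Local Notation Q := (q / r).
Local Notation wt := (@only_second R n).

Hypothesis Hn : nice q r l s t F.
Variables (k : nat) (c : R) (p : 'I_n * 'I_n -> R).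
Hypothesis acc : accurate s t F k c p.
Hypothesis p01 : forall e, 0 <= p e <= 1.
Hypothesis p_near : forall e, e \notin F -> `|p e - l| <= L / 8.
(** An accuracy no finer than [1 / n]. Then [B <= 3 N c], so the moment bounds can be stated in
    terms of [c] alone. *)
Hypothesis rc : r ^+ 2 <= c.
Local Notation meand := (@mean_discrep R n F p).
Local Notation B := (1 + 2 * N * c).

Lemma acc_c0 : 0 <= c.
Proof. by apply: le_trans rc; rewrite exprn_ge0 // ltW // (nice_r Hn). Qed.

Lemma meand_ge E a b : (#|E| <= 8)%N -> L * N / 2 <= meand E a b.
Proof.
move=> E8.
have L0 := L_gt0 Hn; have L1 := L_le l; have N0 : 0 <= N by [].
have Qs := Q_small Hn.
have ns := sum_nonswap Hn a b E8.
apply: (@le_trans _ _ (\sum_(u | swappable E a b u) 7 / 8 * L)).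
  rewrite -mulr_sumr.
  have -> : \sum_(u | swappable E a b u) L = L * \sum_(u | swappable E a b u) 1.
    by rewrite mulr_sumr; apply: eq_bigr => u _; rewrite mulr1.
  have : \sum_(u | swappable E a b u) (1 : R) = N - \sum_(u | ~~ swappable E a b u) 1.
    have e1 : \sum_(u : 'I_n) (1 : R) = N by rewrite sumr_const card_ord.
    by rewrite -e1 [X in _ = X - _](bigID (swappable E a b)) /= addrK.
  move=> ->.
  set T := \sum_(u | _) _ in ns *.
  have : L * T <= L * (4 * Q) by rewrite ler_pM2l.
  have : L * (4 * Q) <= L * (4 * (L * N / 1000)) by rewrite ler_pM2l //; lra.
  have : L * (L * N) <= 4^-1 * (L * N) by rewrite ler_wpM2r // mulr_ge0 // ltW.
  have : 0 <= L * N by rewrite mulr_ge0 // ltW.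
  lra.
apply: ler_sum => u; rewrite /swap_col !inE !negb_or => /andP[/andP[aF _] /andP[bF _]].
have := p_near aF; have := p_near bF; rewrite !ler_norml => /andP[h1 h2] /andP[h3 h4].
have := nice_l0 Hn; have := nice_l1 Hn => l1' l0'.
have Ll : L <= l by rewrite ler_piMr //; lra.
have Ll2 : L <= 1 - l by rewrite ler_piMl //; lra.
apply: (@le_trans _ _ ((1 - l - L / 8) * (l - L / 8))).
  have := sqr_ge0 L; rewrite expr2; lra.
by apply: ler_pM; lra.
Qed.

Lemma meand_le E a b : meand E a b <= N.
Proof.
apply: (@le_trans _ _ (\sum_(u | swappable E a b u) (1 : R))).
  apply: ler_sum => u _; have := p01 (a, u); have := p01 (b, u) => /andP[? ?] /andP[? ?].
  by rewrite mulr_ile1 ?subr_ge0 // gerBl.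
by rewrite sumr_const ler_nat -[X in (_ <= X)%N](card_ord n) max_card.
Qed.

Lemma localE_wt E f a b v : localE E f -> localE ((b, v) |: ((a, v) |: E)) (fun G => f G * wt a b v G).
Proof.
move=> h G G' GG'; rewrite (h G G'); last by move=> e' eE; apply: GG'; rewrite !inE eE !orbT.
by rewrite /only_second /arc_ind !GG' // !inE eqxx ?orbT.
Qed.

Lemma norm_wt a b v f : Ex (fun G => `|f G * wt a b v G|) <= Ex (fun G => `|f G|).
Proof.
apply: Ex_norm_mono => G; rewrite normrM.
by case: (wtP R a b v G) => ->; rewrite ?normr0 ?mulr0 ?normr1 ?mulr1.
Qed.

Lemma norm_ind e f : Ex (fun G => `|f G * ind e G|) <= Ex (fun G => `|f G|).
Proof.
apply: Ex_norm_mono => G; rewrite normrM.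
by case: (indP R e G) => ->; rewrite ?normr0 ?mulr0 ?normr1 ?mulr1.
Qed.

(** By [discB] the factor [D_ba - D_ab] is a constant plus a signed sum of entries in at most [4 Q]
    columns. Each such entry is absorbed into the weight, and the remaining factor is bounded by its
    first moment [B], which is better than the square root of the variance. Hence
    [10 = 2 + 4 * 2]. *)
Lemma second_term E f a b v : a != b -> (#|E|.+3 < k)%N -> (#|E| <= 8)%N -> localE E f ->
  swappable E a b v ->
  `|Ex (fun G => f G * wt a b v G * ((disc E b a G - disc E a b G) * (disc E a b G - meand E a b)))|
  <= 10 * Q * B * Ex (fun G => `|f G|).
Proof.
move=> ab Ek E8 lf fv.
pose X G := \sum_(w | swappable E a b w) dev p a b w G.
have W0 := Ex_norm_ge0 s t F f; have cc := acc_c0.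
have B0 : 0 <= B by rewrite addr_ge0 // !mulr_ge0.
pose E2 := (b, v) |: ((a, v) |: E).
have E2k : (#|E2| <= #|E|.+2)%N by rewrite (leq_trans (cardU1_le _ _)) // ltnS cardU1_le.
have lf2 : localE E2 (fun G => f G * wt a b v G) by exact: localE_wt.
have base : `|Ex (fun G => f G * wt a b v G * X G)| <= B * Ex (fun G => `|f G|).
  apply: (le_trans (@Ex_sum_dev _ _ s t F k c p acc p01 cc E2 _ a b v _ ab _ lf2 _)).
  - exact: leq_ltn_trans E2k (ltnW Ek).
  - move=> w; rewrite /swap_col !inE !negb_or => /andP[/andP[_ aE] /andP[_ bE]] wv.
    by rewrite aE bE !andbT !xpair_eqE !negb_and wv !orbT.
  by apply: ler_wpM2l => //; exact: norm_wt.
have one e u : e.2 = u -> ~~ swappable E a b u ->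
    `|Ex (fun G => f G * wt a b v G * ind e G * X G)| <= B * Ex (fun G => `|f G|).
  move=> eu nu.
  apply: (le_trans (@Ex_sum_dev _ _ s t F k c p acc p01 cc (e |: E2) _ a b v _ ab _ (localE_ind lf2) _)).
  - by apply: leq_ltn_trans Ek; rewrite (leq_trans (cardU1_le _ _)).
  - move=> w sw wv; move: (sw).
    rewrite /swap_col !inE !negb_or => /andP[/andP[_ aE] /andP[_ bE]].
    have wu : w != u by apply: contraNneq nu => <-.
    rewrite aE bE !andbT !xpair_eqE !negb_and wv !orbT !andbT.
    by rewrite /= eu wu !orbT.
  by apply: ler_wpM2l => //; apply: le_trans (norm_ind _ _) (norm_wt _ _ _ _).
have -> : Ex (fun G => f G * wt a b v G * ((disc E b a G - disc E a b G) * (disc E a b G - meand E a b))) =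
   ((s a)%:R - (s b)%:R) * Ex (fun G => f G * wt a b v G * X G) -
   \sum_(u | ~~ swappable E a b u) (Ex (fun G => f G * wt a b v G * ind (a, u) G * X G)
      - Ex (fun G => f G * wt a b v G * ind (b, u) G * X G)).
  rewrite -ExZ.
  under [X in _ = _ - X]eq_bigr do rewrite -ExB.
  rewrite -Ex_sum -ExB; apply: eq_Ex => G GO; rewrite disc_sub -/(X G) (discB R E a b GO).
  have -> : \sum_(u | ~~ swappable E a b u)
     (f G * wt a b v G * ind (a, u) G * X G - f G * wt a b v G * ind (b, u) G * X G) =
     f G * wt a b v G * (\sum_(u | ~~ swappable E a b u) (ind (a, u) G - ind (b, u) G)) * X G.
    by move: (X G) => x; rewrite mulr_sumr mulr_suml; apply: eq_bigr => u _; ring.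
  ring.
set W := Ex _ in W0 base one *.
apply: (le_trans (ler_normB _ _)).
have h1 : `|((s a)%:R - (s b)%:R) * Ex (fun G => f G * wt a b v G * X G)| <= 2 * Q * (B * W).
  rewrite normrM; apply: ler_pM => //.
  by have := nice_s Hn a; have := nice_s Hn b; rewrite !ler_norml; lra.
have h2 : `|\sum_(u | ~~ swappable E a b u) (Ex (fun G => f G * wt a b v G * ind (a, u) G * X G)
      - Ex (fun G => f G * wt a b v G * ind (b, u) G * X G))| <= 4 * Q * (2 * (B * W)).
  apply: (@le_trans _ _ (\sum_(u | ~~ swappable E a b u) 1 * (2 * (B * W)))).
    apply: (le_trans (ler_norm_sum _ _ _)); apply: ler_sum => u nu.
    apply: (le_trans (ler_normB _ _)); have := one (a, u) u erefl nu.
    by have := one (b, u) u erefl nu; lra.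
  rewrite -mulr_suml; apply: ler_wpM2r; first by rewrite !mulr_ge0.
  exact: (sum_nonswap Hn).
lra.
Qed.

(** Where [D] exceeds [L N / 64] the variance bound suffices. Elsewhere [D >= 1], since column [v]
    itself is counted when the weight [wt] is nonzero, so the quotient is at most [N ^ 2] and the
    rarity of small [D] takes over. *)
Lemma third_term E f a b v : a != b -> (#|E|.+2 < k)%N -> (#|E| <= 8)%N -> localE E f ->
  swappable E a b v ->
  `|Ex (fun G => f G * wt a b v G * ((disc E b a G - disc E a b G) *
      (disc E a b G - meand E a b) ^+ 2 / disc E a b G))|
  <= 6 * Q * (64 / (L * N) * (N * B) + N ^+ 2 * r ^+ 12) * Ex (fun G => `|f G|).
Proof.
move=> ab Ek E8 lf fv.
have L0 := L_gt0 Hn.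
have N0 : 0 < N by rewrite ltr0n (leq_ltn_trans _ (ltn_ord a)).
have LN0 : 0 < L * N by rewrite mulr_gt0.
have Q0 : 0 <= 6 * Q by have := Q_ge1 Hn; lra.
apply: (@le_trans _ _ (Ex (fun G => 6 * Q * (64 / (L * N) * (`|f G| * (disc E a b G - meand E a b) ^+ 2)
    + N ^+ 2 * (`|f G| * (disc E a b G <= L * N / 64)%R%:R))))); last first.
  rewrite ExZ ExD !ExZ; set W := Ex (fun G => `|f G|).
  have -> : 6 * Q * (64 / (L * N) * (N * B) + N ^+ 2 * r ^+ 12) * W =
    6 * Q * (64 / (L * N) * (N * B * W) + N ^+ 2 * (r ^+ 12 * W)) by ring.
  apply: ler_wpM2l => //; apply: lerD; apply: ler_wpM2l; rewrite ?exprn_ge0 ?divr_ge0 ?(ltW LN0) //.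
    by apply: (Ex_disc_sqr acc p01) => //; exact: acc_c0.
  exact: (disc_rare Hn).
apply: (le_trans (normEx s t F _)); apply: le_Ex => G GO.
set D := disc E a b G; set m := meand E a b.
have rhs0 : 0 <= 64 / (L * N) * (`|f G| * (D - m) ^+ 2) + N ^+ 2 * (`|f G| * (D <= L * N / 64)%R%:R).
  by apply: addr_ge0; apply: mulr_ge0; rewrite ?sqr_ge0 ?divr_ge0 ?(ltW LN0) // mulr_ge0 ?sqr_ge0.
case: (wtP R a b v G) => w1; first by rewrite w1 mulr0 mul0r normr0 mulr_ge0.
have D1 : 1 <= D := disc_ge1 fv w1.
have D0 : 0 < D by lra.
have -> : `|f G * wt a b v G * ((disc E b a G - D) * (D - m) ^+ 2 / D)| =
    `|disc E b a G - D| * (`|f G| * ((D - m) ^+ 2 / D)).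
  have n2 : `|(D - m) ^+ 2 / D| = (D - m) ^+ 2 / D.
    by rewrite ger0_norm // divr_ge0 ?sqr_ge0 // ltW.
  by rewrite w1 mulr1 normrM -(mulrA (disc E b a G - D)) normrM n2; ring.
apply: ler_pM => //; first by rewrite mulr_ge0 // divr_ge0 ?sqr_ge0 // ltW.
  exact: (discB_le Hn).
have [small|big] := leP D (L * N / 64); last first.
  rewrite mulr0 mulr0 addr0.
  have -> : `|f G| * ((D - m) ^+ 2 / D) = D^-1 * (`|f G| * (D - m) ^+ 2) by ring.
  apply: ler_wpM2r; first by rewrite mulr_ge0 ?sqr_ge0.
  rewrite -invf_div lef_pV2 ?posrE ?divr_gt0 //; exact: ltW.
rewrite mulr1; apply: ler_wpDl.
  by rewrite mulr_ge0 ?divr_ge0 ?(ltW LN0) // mulr_ge0 ?sqr_ge0.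
rewrite [leRHS]mulrC; apply: ler_wpM2l => //.
apply: (@le_trans _ _ (N ^+ 2 / D)); last first.
  by rewrite ler_pdivrMr // ler_peMr // exprn_ge0.
apply: ler_wpM2r; first by rewrite invr_ge0 ltW.
rewrite -[(D - m) ^+ 2]real_normK ?num_real //; apply: lerXn2r; rewrite ?nnegrE //.
have := disc_leN R F E a b G; have := meand_le E a b; have := meand_ge a b E8; rewrite -/D -/m.
by rewrite ler_norml; lra.
Qed.

(** The approximate mean of [D_ba - D_ab]: the right-hand side of [discB] with [p] in place of the
    indicators. *)
Definition pdiff E a b : R :=
  (s a)%:R - (s b)%:R - \sum_(u | ~~ swappable E a b u) (p (a, u) - p (b, u)).

Lemma pdiff_le E a b : (#|E| <= 8)%N -> `|pdiff E a b| <= 6 * Q.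
Proof.
move=> E8.
have h1 : `|\sum_(u | ~~ swappable E a b u) (p (a, u) - p (b, u))| <= 4 * Q.
  apply: le_trans (sum_nonswap Hn a b E8); apply: (le_trans (ler_norm_sum _ _ _)).
  apply: ler_sum => u _; have := p01 (a, u); have := p01 (b, u); rewrite ler_norml; lra.
have := nice_s Hn a; have := nice_s Hn b; move: h1; rewrite /pdiff !ler_norml; lra.
Qed.

(** The indicators in the columns that are not swappable and then [wt] are replaced by their
    approximate means. Entries that belong to [E] are fixed by the weight and cannot be replaced;
    each costs at most [1], which gives [2 #|E|] for the two rows. *)
Lemma first_term E f a b v : a != b -> (#|E|.+3 < k)%N -> (#|E| <= 8)%N -> localE E f ->
  swappable E a b v ->
  `|Ex (fun G => f G * wt a b v G * (disc E b a G - disc E a b G))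
    - (1 - p (a, v)) * p (b, v) * pdiff E a b * Ex f|
  <= (20 * Q * c + 2 * #|E|%:R) * Ex (fun G => `|f G|).
Proof.
move=> ab Ek E8 lf fv.
have W0 := Ex_norm_ge0 s t F f; have cc := acc_c0.
pose E2 := (b, v) |: ((a, v) |: E).
have E2k : (#|E2| <= #|E|.+2)%N by rewrite (leq_trans (cardU1_le _ _)) // ltnS cardU1_le.
have lf2 : localE E2 (fun G => f G * wt a b v G) by exact: localE_wt.
have [avE bvE] : (a, v) \notin E /\ (b, v) \notin E.
  by move: fv; rewrite /swap_col !inE !negb_or => /andP[/andP[_ ->] /andP[_ ->]].
have -> : Ex (fun G => f G * wt a b v G * (disc E b a G - disc E a b G))
    - (1 - p (a, v)) * p (b, v) * pdiff E a b * Ex f =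
  pdiff E a b * Ex (fun G => f G * dev p a b v G)
  - (\sum_(u | ~~ swappable E a b u) Ex (fun G => f G * wt a b v G * (ind (a, u) G - p (a, u)))
  - \sum_(u | ~~ swappable E a b u) Ex (fun G => f G * wt a b v G * (ind (b, u) G - p (b, u)))).
  rewrite -!Ex_sum -!ExZ -!ExB; apply: eq_Ex => G GO; rewrite (discB R E a b GO) /pdiff /dev -/(wt a b v G).
  rewrite -!mulr_sumr.
  have e1 : \sum_(u | ~~ swappable E a b u) (ind (a, u) G - ind (b, u) G) =
     \sum_(u | ~~ swappable E a b u) (ind (a, u) G - p (a, u))
     - \sum_(u | ~~ swappable E a b u) (ind (b, u) G - p (b, u))
     + \sum_(u | ~~ swappable E a b u) (p (a, u) - p (b, u)).
    by rewrite -sumRB -sumRD; apply: eq_bigr => u _; ring.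
  rewrite e1; ring.
set W := Ex (fun G => `|f G|) in W0 *.
have one i u : i = a \/ i = b -> ~~ swappable E a b u ->
   `|Ex (fun G => f G * wt a b v G * (ind (i, u) G - p (i, u)))| <= (c + ((i, u) \in E)%:R) * W.
  move=> iab nu; have [iE|iE] := boolP ((i, u) \in E).
    apply: (@le_trans _ _ (1 * W)); last by apply: ler_wpM2r => //=; lra.
    rewrite mul1r; apply: (le_trans (normEx s t F _)).
    apply: le_trans (norm_wt a b v f); apply: Ex_norm_mono => G.
    rewrite normrM ler_piMr //; have := p01 (i, u); rewrite ler_norml.
    case: (indP R (i, u) G) => ->; lra.
  rewrite addr0; apply: (le_trans (acc _ lf2 _)).
  - exact: leq_trans E2k (ltnW (ltnW Ek)).
  - rewrite !inE !negb_or iE andbT !xpair_eqE !negb_and.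
    by have -> : u != v; [apply: contraNneq nu => -> | rewrite !orbT].
  - by apply: ler_wpM2l => //; exact: norm_wt.
have sumE i : \sum_(u | ~~ swappable E a b u) (((i, u) \in E)%:R : R) <= #|E|%:R.
  apply: (@le_trans _ _ (\sum_u (((i, u) \in E)%:R : R))).
    by rewrite [leRHS](bigID (swappable E a b)) /= lerDr sumr_ge0.
  rewrite -natr_sum ler_nat -outdeg_sum /outdeg -(card_imset (f := pair i)); last by move=> x y [].
  by apply: subset_leq_card; apply/subsetP => e /imsetP[u]; rewrite inE => h ->.
have tot i : i = a \/ i = b ->
    `|\sum_(u | ~~ swappable E a b u) Ex (fun G => f G * wt a b v G * (ind (i, u) G - p (i, u)))|
    <= (4 * Q * c + #|E|%:R) * W.
  move=> iab; apply: (le_trans (ler_norm_sum _ _ _)).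
  apply: (@le_trans _ _ (\sum_(u | ~~ swappable E a b u) (c + ((i, u) \in E)%:R) * W)).
    by apply: ler_sum => u nu; exact: one.
  rewrite -mulr_suml; apply: ler_wpM2r => //; rewrite sumRD; apply: lerD (sumE i).
  have -> : \sum_(u | ~~ swappable E a b u) c = (\sum_(u | ~~ swappable E a b u) 1) * c.
    by rewrite mulr_suml; apply: eq_bigr => u _; rewrite mul1r.
  by apply: ler_wpM2r => //; exact: (sum_nonswap Hn).
have h0 : `|pdiff E a b * Ex (fun G => f G * dev p a b v G)| <= 6 * Q * (2 * c * W).
  rewrite normrM; apply: ler_pM => //; first exact: pdiff_le.
  have Ek0 : (#|E| < k)%N by do 3!apply: ltnW.
  exact: (Ex_dev acc p01 cc ab Ek0 lf avE bvE).
have := tot a (or_introl erefl); have := tot b (or_intror erefl); move: h0.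
rewrite !ler_norml; lra.
Qed.

(* Expands [1 / D = 1 / m - (D - m) / m ^+ 2 + (D - m) ^+ 2 / (m ^+ 2 * D)] around
   the approximate mean [m] of [D = disc E a b]. *)
Lemma entry_diff_expand E f a b v : a != b -> (#|E|.+3 < k)%N -> (#|E| <= 8)%N -> localE E f ->
  swappable E a b v -> #|E|%:R * r <= 8 * c ->
  `|Ex (fun G => f G * (ind (a, v) G - ind (b, v) G))
    - (1 - p (a, v)) * p (b, v) * pdiff E a b / meand E a b * Ex f|
  <= q ^+ 17 * r * c * Ex (fun G => `|f G|).
Proof.
move=> ab Ek E8 lf fv Er.
have W0 := Ex_norm_ge0 s t F f; have cc := acc_c0.
have L0 := L_gt0 Hn.
have r0 := nice_r Hn; have q2 := nice_q Hn; have r1 := proj2 (nice_r_small Hn).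
have N0 : 0 < N by rewrite ltr0n (leq_ltn_trans _ (ltn_ord a)).
have mge := meand_ge a b E8.
have LN0 : 0 < L * N by rewrite mulr_gt0.
have m0 : 0 < meand E a b by lra.
have m0' : meand E a b != 0 by rewrite gt_eqF.
set m := meand E a b in mge m0 m0' *; set W := Ex (fun G => `|f G|) in W0 *.
rewrite (entry_diff s t ab lf fv).
have -> : Ex (fun G => f G * wt a b v G * ((disc E b a G - disc E a b G) / disc E a b G)) =
   m^-1 * Ex (fun G => f G * wt a b v G * (disc E b a G - disc E a b G))
   - m^-1 ^+ 2 * Ex (fun G => f G * wt a b v G * ((disc E b a G - disc E a b G) * (disc E a b G - m)))
   + m^-1 ^+ 2 * Ex (fun G => f G * wt a b v G * ((disc E b a G - disc E a b G) *
        (disc E a b G - m) ^+ 2 / disc E a b G)).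
  rewrite -!ExZ -ExB -ExD; apply: eq_Ex => G _.
  case: (wtP R a b v G) => w1; first by rewrite w1; ring.
  have D1 := disc_ge1 fv w1; rewrite w1.
  have D0 : disc E a b G != 0 by rewrite gt_eqF //; lra.
  by field; rewrite D0 m0'.
have x0 : 0 < m^-1 by rewrite invr_gt0.
have xle : m^-1 <= 2 * q * r ^+ 2.
  have -> : 2 * q * r ^+ 2 = (N / (2 * q))^-1.
    rewrite (n_as_r Hn) !invfM !invrK; ring.
  rewrite lef_pV2 ?posrE //; last by rewrite divr_gt0 //; lra.
  apply: le_trans mge; rewrite ler_pdivrMr; last by lra.
  have := nice_L Hn => h; have : 1 * N <= q * L * N by rewrite ler_pM2r.
  lra.
have h0 := entry_diff_rare Hn v ab E8 lf.
have h1 := first_term ab Ek E8 lf fv.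
have h2 := second_term ab Ek E8 lf fv.
have h3 := third_term ab (ltnW Ek) E8 lf fv.
rewrite -/W -/m in h0 h1 h2 h3.
set T0 := Ex _ in h0 *; set T1 := Ex _ in h1 *; set T2 := Ex _ in h2 *; set T3 := Ex _ in h3 *.
have -> : T0 + (m^-1 * T1 - m^-1 ^+ 2 * T2 + m^-1 ^+ 2 * T3) -
   (1 - p (a, v)) * p (b, v) * pdiff E a b / m * Ex f =
   T0 + m^-1 * (T1 - (1 - p (a, v)) * p (b, v) * pdiff E a b * Ex f)
   - m^-1 ^+ 2 * T2 + m^-1 ^+ 2 * T3 by ring.
have r2c : r ^+ 12 <= r * c.
  rewrite exprS; apply: ler_wpM2l; first exact: ltW.
  apply: le_trans rc; apply: ler_wiXn2l => //; exact: ltW.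
have Bc : B <= 3 * c / r ^+ 2.
  rewrite (n_as_r Hn); have : 1 <= c / r ^+ 2 by rewrite ler_pdivlMr ?exprn_gt0 // mul1r.
  have -> : 2 * r ^- 2 * c = 2 * (c / r ^+ 2) by ring.
  have -> : 3 * c / r ^+ 2 = 3 * (c / r ^+ 2) by ring.
  lra.
(* The [2 #|E|] of [first_term] meets a factor of order [q r ^ 2] and is absorbed through
   [#|E| r <= 8 c]. For [c] of order [r ^ 2] this leaves only the empty [E]. *)
have k1 : `|m^-1 * (T1 - (1 - p (a, v)) * p (b, v) * pdiff E a b * Ex f)| <=
    (40 * q ^+ 2 + 32 * q) * r * c * W.
  rewrite normrM (ger0_norm (ltW x0)).
  apply: (@le_trans _ _ (2 * q * r ^+ 2 * ((20 * Q * c + 2 * #|E|%:R) * W))).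
    by apply: ler_pM => //; exact: ltW.
  rewrite mulrA; apply: ler_wpM2r => //.
  have -> : 2 * q * r ^+ 2 * (20 * Q * c + 2 * #|E|%:R) = 40 * q ^+ 2 * r * c + 4 * q * r * (#|E|%:R * r).
    by field; rewrite gt_eqF.
  have : 4 * q * r * (#|E|%:R * r) <= 4 * q * r * (8 * c).
    by apply: ler_wpM2l => //; rewrite !mulr_ge0 //; lra.
  lra.
have x20 : 0 <= m^-1 ^+ 2 by rewrite exprn_ge0 // ltW.
have x2le : m^-1 ^+ 2 <= 4 * q ^+ 2 * r ^+ 4.
  have -> : 4 * q ^+ 2 * r ^+ 4 = (2 * q * r ^+ 2) ^+ 2 by ring.
  by apply: lerXn2r => //; rewrite nnegrE ltW // (lt_le_trans x0 xle).
have Q0 : 0 <= Q by have := Q_ge1 Hn; lra.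
have B0 : 0 <= B by rewrite addr_ge0 // !mulr_ge0.
have k2 : `|m^-1 ^+ 2 * T2| <= 120 * q ^+ 3 * r * c * W.
  rewrite normrM (ger0_norm x20).
  apply: (@le_trans _ _ (4 * q ^+ 2 * r ^+ 4 * (10 * Q * (3 * c / r ^+ 2) * W))).
    apply: ler_pM => //; apply: le_trans h2 _; apply: ler_wpM2r => //.
    by apply: ler_wpM2l => //; rewrite mulr_ge0.
  have -> : 4 * q ^+ 2 * r ^+ 4 * (10 * Q * (3 * c / r ^+ 2) * W) = 120 * q ^+ 3 * r * c * W; last by [].
  by field; rewrite gt_eqF.
have LNinv : (L * N)^-1 <= q * r ^+ 2.
  have -> : q * r ^+ 2 = (N / q)^-1 by rewrite (n_as_r Hn) !invfM !invrK; ring.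
  rewrite lef_pV2 ?posrE //; last by rewrite divr_gt0 //; lra.
  rewrite ler_pdivrMr; last by lra.
  have := nice_L Hn => h; have : 1 * N <= q * L * N by rewrite ler_pM2r.
  lra.
have k3 : `|m^-1 ^+ 2 * T3| <= (4608 * q ^+ 4 + 24 * q ^+ 3) * r * c * W.
  rewrite normrM (ger0_norm x20).
  apply: (@le_trans _ _ (4 * q ^+ 2 * r ^+ 4 *
     (6 * Q * (64 * (q * r ^+ 2) * (r ^- 2 * (3 * c / r ^+ 2)) + (r ^- 2) ^+ 2 * (r ^+ 5 * (r ^+ 6 * r))) * W))).
    apply: ler_pM => //; apply: le_trans h3 _; apply: ler_wpM2r => //.
    apply: ler_wpM2l; first by rewrite mulr_ge0.
    rewrite -(n_as_r Hn); apply: lerD.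
      apply: ler_pM => //; rewrite ?mulr_ge0 ?invr_ge0 //; try exact: ltW.
      - by apply: ler_wpM2l.
      - by apply: ler_wpM2l => //; move: Bc; rewrite (n_as_r Hn).
    by rewrite -exprSr -exprD.
  have -> : 4 * q ^+ 2 * r ^+ 4 *
     (6 * Q * (64 * (q * r ^+ 2) * (r ^- 2 * (3 * c / r ^+ 2)) + (r ^- 2) ^+ 2 * (r ^+ 5 * (r ^+ 6 * r))) * W)
     = (4608 * q ^+ 4 * r * c + 24 * q ^+ 3 * r ^+ 11) * W.
    by field; rewrite gt_eqF.
  apply: ler_wpM2r => //.
  have : 24 * q ^+ 3 * r ^+ 11 <= 24 * q ^+ 3 * (r * c).
    apply: ler_wpM2l; first by rewrite mulr_ge0 ?exprn_ge0 //; lra.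
    rewrite exprS; apply: ler_wpM2l; first exact: ltW.
    apply: le_trans rc; apply: ler_wiXn2l => //; exact: ltW.
  lra.
have k0 : `|T0| <= 1 * r * c * W.
  by apply: le_trans h0 _; rewrite mul1r; apply: ler_wpM2r.
apply: (@le_trans _ _ ((1 + (40 * q ^+ 2 + 32 * q) + 120 * q ^+ 3 + (4608 * q ^+ 4 + 24 * q ^+ 3)) * (r * c * W))).
  move: k0 k1 k2 k3; rewrite !ler_norml; lra.
have -> : q ^+ 17 * r * c * W = q ^+ 17 * (r * c * W) by ring.
apply: ler_wpM2r; first by rewrite !mulr_ge0 //; exact: ltW.
exact: constants_le.
Qed.

End Comparison.

(** * Arc probabilities to increasing precision *)

Section Orders.
Variables (R : realType) (q r l : R) (n : nat) (s t : 'I_n -> nat) (F : digraph n).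
Implicit Types (G : digraph n) (a b u v : 'I_n) (f : digraph n -> R).
Implicit Types (e : 'I_n * 'I_n) (E : digraph n).
Local Notation ind := (@arc_ind R n).
Local Notation Ex := (@ens_sum R n s t F).
Local Notation Om := (@ensemble n s t F).
Local Notation swappable := (@swap_col n F).
Local Notation disc := (@discrep R n F).
Local Notation N := (n%:R : R).
Local Notation L := (l * (1 - l)).
Local Notation Q := (q / r).
Local Notation wt := (@only_second R n).

Hypothesis Hn : nice q r l s t F.

Definition open_rows E v : R := \sum_(b | (b, v) \notin F :|: E) 1.

(* The entries of a column have a known sum, so their differences determine them. *)
Lemma column_step E f a v (cb : 'I_n -> R) (eta : R) : 0 <= eta -> (a, v) \notin F :|: E ->
  (forall b, b != a -> (b, v) \notin F :|: E ->
    `|Ex (fun G => f G * (ind (a, v) G - ind (b, v) G)) - cb b * Ex f| <= eta * Ex (fun G => `|f G|)) ->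
  `|Ex (fun G => f G * (open_rows E v * ind (a, v) G - (t v)%:R))
    - (\sum_(b | ((b, v) \notin F :|: E) && (b != a)) cb b) * Ex f|
  <= (N * eta + #|E|%:R) * Ex (fun G => `|f G|).
Proof.
move=> eta0 av H; set W := Ex (fun G => `|f G|).
have W0 : 0 <= W by exact: Ex_norm_ge0.
have -> : Ex (fun G => f G * (open_rows E v * ind (a, v) G - (t v)%:R)) =
   \sum_(b | ((b, v) \notin F :|: E) && (b != a)) Ex (fun G => f G * (ind (a, v) G - ind (b, v) G))
   - Ex (fun G => f G * \sum_(b | (b, v) \in F :|: E) ind (b, v) G).
  rewrite -Ex_sum -ExB; apply: eq_Ex => G GO.
  rewrite -mulr_sumr -mulrBr; congr (_ * _).
  rewrite -(col_sum R v GO) (bigID (fun b => (b, v) \in F :|: E)) /= opprD.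
  have -> : \sum_(b | ((b, v) \notin F :|: E) && (b != a)) (ind (a, v) G - ind (b, v) G) =
     open_rows E v * ind (a, v) G - \sum_(b | (b, v) \notin F :|: E) ind (b, v) G.
    rewrite /open_rows mulr_suml -sumRB [RHS](bigD1 a) //= mul1r subrr add0r.
    by apply: eq_bigr => b _ /=; ring.
  ring.
have h1 : `|\sum_(b | ((b, v) \notin F :|: E) && (b != a)) Ex (fun G => f G * (ind (a, v) G - ind (b, v) G))
    - (\sum_(b | ((b, v) \notin F :|: E) && (b != a)) cb b) * Ex f| <= N * eta * W.
  rewrite mulr_suml -sumRB; apply: (le_trans (ler_norm_sum _ _ _)).
  apply: (@le_trans _ _ (\sum_(b : 'I_n) eta * W)).
    rewrite [leLHS]big_mkcond /=; apply: ler_sum => b _; case: ifP => [/andP[bv ba]|_]; first exact: H.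
    by rewrite mulr_ge0.
  by rewrite sumr_const card_ord -[leLHS]mulr_natl mulrA.
have h2 : `|Ex (fun G => f G * \sum_(b | (b, v) \in F :|: E) ind (b, v) G)| <= #|E|%:R * W.
  apply: (le_trans (normEx s t F _)); rewrite -ExZ; apply: le_Ex => G GO.
  rewrite normrM mulrC; apply: ler_wpM2r => //.
  rewrite ger0_norm; last by apply: sumr_ge0 => b _; exact: ind_ge0.
  apply: (@le_trans _ _ (\sum_b (((b, v) \in E)%:R : R))).
    rewrite [leLHS]big_mkcond /=; apply: ler_sum => b _; rewrite inE.
    case bF : ((b, v) \in F); first by rewrite (ind_F R GO bF).
    by case: (_ \in E) => //=; exact: ind_le1.
  rewrite -natr_sum ler_nat -indeg_sum /indeg -(card_imset (f := fun b => (b, v))); last by move=> x y [].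
  by apply: subset_leq_card; apply/subsetP => e /imsetP[b]; rewrite inE => h ->.
move: h1 h2; rewrite !ler_norml; lra.
Qed.

Lemma colsize_bounds E v : (#|E| <= 8)%N ->
  N - (indeg F v)%:R - #|E|%:R <= open_rows E v <= N - (indeg F v)%:R.
Proof.
move=> E8; rewrite /open_rows.
have e1 : \sum_(b : 'I_n) (1 : R) = N by rewrite sumr_const card_ord.
have e2 : \sum_b (((b, v) \in F)%:R : R) = (indeg F v)%:R by rewrite -natr_sum -indeg_sum.
have e3 : \sum_b (((b, v) \in E)%:R : R) <= #|E|%:R.
  rewrite -natr_sum ler_nat -indeg_sum /indeg -(card_imset (f := fun b => (b, v))); last by move=> x y [].
  by apply: subset_leq_card; apply/subsetP => e /imsetP[b]; rewrite inE => h ->.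
apply/andP; split.
  apply: (@le_trans _ _ (\sum_b (1 - ((b, v) \in F)%:R - ((b, v) \in E)%:R))).
    by rewrite !sumRB e1 e2 lerD2l lerN2.
  rewrite [leRHS]big_mkcond /=; apply: ler_sum => b _; rewrite inE.
  by case: (_ \in F); case: (_ \in E) => /=; lra.
rewrite -e1 -e2 -sumRB [leLHS]big_mkcond /=; apply: ler_sum => b _; rewrite inE.
by case: (_ \in F); case: (_ \in E) => /=; lra.
Qed.

Lemma colsize_ge E v : (#|E| <= 8)%N -> N / 2 <= open_rows E v.
Proof.
move=> E8; have /andP[h _] := colsize_bounds v E8; apply: le_trans h.
have := nice_y Hn v; have E8' : #|E|%:R <= 8 :> R by rewrite ler_nat.
have := Q_ge8 Hn; have := Q_small Hn; have := L_le l => h1 h2 h3 h4.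
have : L * N <= 4^-1 * N by apply: ler_wpM2r.
lra.
Qed.

Definition zeroth_prob e : R := if e \in F then 0 else l.

(** No approximation is available yet, so [6 Q / D] is bounded by [6 Q * 64 / (L N)], of order
    [q ^ 2 r], away from the rare event. The constant is [391 = 384 + 6 + 1]. *)
Lemma zeroth_pair E f a b v : a != b -> (#|E| <= 8)%N -> localE E f -> swappable E a b v ->
  `|Ex (fun G => f G * (ind (a, v) G - ind (b, v) G))| <= 391 * q ^+ 2 * r * Ex (fun G => `|f G|).
Proof.
move=> ab E8 lf fv; rewrite (entry_diff s t ab lf fv).
have h0 := entry_diff_rare Hn v ab E8 lf.
have L0 := L_gt0 Hn.
have r0 := nice_r Hn; have q2 := nice_q Hn; have r1 := proj2 (nice_r_small Hn).
have N0 : 0 < N by rewrite ltr0n (leq_ltn_trans _ (ltn_ord a)).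
have LN0 : 0 < L * N by rewrite mulr_gt0.
have W0 := Ex_norm_ge0 s t F f.
have Q0 : 0 <= 6 * Q by have := Q_ge1 Hn; lra.
set W := Ex (fun G => `|f G|) in h0 W0 *.
have LNinv : (L * N)^-1 <= q * r ^+ 2.
  have -> : q * r ^+ 2 = (N / q)^-1 by rewrite (n_as_r Hn) !invfM !invrK; ring.
  rewrite lef_pV2 ?posrE //; last by rewrite divr_gt0 //; lra.
  rewrite ler_pdivrMr; last by lra.
  have := nice_L Hn => h; have : 1 * N <= q * L * N by rewrite ler_pM2r.
  lra.
have h1 : `|Ex (fun G => f G * wt a b v G * ((disc E b a G - disc E a b G) / disc E a b G))| <=
   6 * Q * (64 / (L * N) * W + r ^+ 12 * W).
  apply: (@le_trans _ _ (Ex (fun G => 6 * Q * (64 / (L * N) * `|f G|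
    + `|f G| * (disc E a b G <= L * N / 64)%R%:R)))); last first.
    rewrite ExZ ExD ExZ; apply: ler_wpM2l => //; rewrite lerD2l; exact: (disc_rare Hn).
  apply: (le_trans (normEx s t F _)); apply: le_Ex => G GO.
  set D := disc E a b G.
  case: (wtP R a b v G) => w1.
    rewrite w1 mulr0 mul0r normr0; apply: mulr_ge0 => //; apply: addr_ge0; apply: mulr_ge0 => //.
    by rewrite divr_ge0 // ltW.
  have D1 : 1 <= D := disc_ge1 fv w1.
  have D0 : 0 < D by lra.
  have -> : `|f G * wt a b v G * ((disc E b a G - D) / D)| =
      `|disc E b a G - D| * (`|f G| * D^-1).
    by rewrite w1 mulr1 !normrM normfV (ger0_norm (ltW D0)); ring.
  apply: ler_pM => //; first by rewrite divr_ge0 // ltW.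
    exact: (discB_le Hn).
  rewrite (mulrC _ `|f G|) -mulrDr; apply: ler_wpM2l => //.
  have [small|big] := leP D (L * N / 64).
    apply: ler_wpDl; first by rewrite divr_ge0 // ltW.
    by rewrite invf_le1.
  by rewrite addr0 -invf_div lef_pV2 ?posrE ?divr_gt0 //; exact: ltW.
have h2 : 6 * Q * (64 / (L * N) * W + r ^+ 12 * W) <= (384 * q ^+ 2 * r + 6 * q * r ^+ 11) * W.
  have -> : (384 * q ^+ 2 * r + 6 * q * r ^+ 11) * W = 6 * Q * (64 * (q * r ^+ 2) * W + r ^+ 12 * W).
    by field; rewrite gt_eqF.
  apply: ler_wpM2l => //; rewrite lerD2r; apply: ler_wpM2r => //; exact: ler_wpM2l.
have rr k : r ^+ k.+1 <= r by rewrite exprS ler_piMr ?exprn_ile1 // ltW.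
have q1 : 1 <= q by lra.
have qq : q <= q ^+ 2 by rewrite -[leLHS]expr1 ler_weXn2l.
have q21 : 1 <= q ^+ 2 by rewrite exprn_ege1.
have h3 : r ^+ 12 * W <= 1 * (r * W) by rewrite mul1r ler_wpM2r.
have h4 : 1 * (r * W) <= q ^+ 2 * (r * W) by apply: ler_wpM2r => //; rewrite mulr_ge0 // ltW.
have h5 : q * (r ^+ 11 * W) <= q ^+ 2 * (r * W).
  by apply: ler_pM; rewrite ?mulr_ge0 ?exprn_ge0 ?ler_wpM2r // ?ltW //; lra.
move: h0 h1; rewrite !ler_norml; lra.
Qed.

Lemma accurate_F k c p : 0 <= c -> (forall e, e \in F -> p e = 0) ->
  (forall E f a v, (#|E| <= k)%N -> localE E f -> (a, v) \notin F :|: E ->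
    `|Ex (fun G => f G * (ind (a, v) G - p (a, v)))| <= c * Ex (fun G => `|f G|)) ->
  accurate s t F k c p.
Proof.
move=> c0 pF H E f [a v] Ek lf eE; have [eF|eF] := boolP ((a, v) \in F).
  rewrite (@eq_Ex _ _ _ _ _ _ (fun _ => 0)).
    by rewrite /ens_sum big1 // normr0 mulr_ge0 // Ex_norm_ge0.
  by move=> G GO; rewrite (ind_F R GO eF) (pF _ eF) subrr mulr0.
have eFE : (a, v) \notin F :|: E by rewrite inE negb_or eF.
exact: H Ek lf eFE.
Qed.

(** Eight entries are enough for two more rounds. Each round uses accuracy given four further
    entries: the two being compared, one in a column that is not swappable, and one inside [dev].
    The successive values are 8, 4 and 0. *)
Lemma zeroth_order : accurate s t F 8 (q ^+ 13 * r) zeroth_prob.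
Proof.
have r0 := nice_r Hn; have q2 := nice_q Hn; have r1 := proj2 (nice_r_small Hn).
apply: accurate_F; first by rewrite mulr_ge0 ?exprn_ge0 //; lra.
  by move=> e eF; rewrite /zeroth_prob eF.
move=> E f a v E8 lf av.
have avF : (a, v) \notin F by move: av; rewrite inE negb_or => /andP[].
rewrite /zeroth_prob (negbTE avF).
have N0 : 0 < N by rewrite ltr0n (leq_ltn_trans _ (ltn_ord a)).
have W0 := Ex_norm_ge0 s t F f.
have eta0 : 0 <= 391 * q ^+ 2 * r by rewrite !mulr_ge0 ?exprn_ge0 //; lra.
have pr b : b != a -> (b, v) \notin F :|: E ->
   `|Ex (fun G => f G * (ind (a, v) G - ind (b, v) G)) - 0 * Ex f| <= 391 * q ^+ 2 * r * Ex (fun G => `|f G|).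
  move=> ba bv; rewrite mul0r subr0; apply: (@zeroth_pair E) => //; first by rewrite eq_sym.
  exact/andP.
have := @column_step E f a v (fun _ => 0) (391 * q ^+ 2 * r) eta0 av pr.
rewrite big1 // mul0r subr0 => h.
have m2 := colsize_ge v E8; have m0 : 0 < open_rows E v by lra.
have /andP[mb1 mb2] := colsize_bounds v E8.
set m := open_rows E v in h m2 m0 mb1 mb2 *; set W := Ex (fun G => `|f G|) in h W0 *.
have E8' : #|E|%:R <= 8 :> R by rewrite ler_nat.
have Q8 := Q_ge8 Hn.
have fW : `|Ex f| <= W by exact: normEx.
(* One [Q] comes from the degree of [v], one from its degree in [F], and one covers the at most
   eight entries of [E]. *)
have tl : `|(t v)%:R - l * m| <= 3 * Q.
  have := nice_t Hn v; have := nice_y Hn v; have l0 := nice_l0 Hn; have l1 := nice_l1 Hn.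
  have : l * (N - m) <= N - m by rewrite ler_piMl //; have : 0 <= (indeg F v)%:R :> R by []; lra.
  have : 0 <= l * (N - m) by rewrite mulr_ge0 //; have : 0 <= (indeg F v)%:R :> R by []; lra.
  rewrite !ler_norml; lra.
have key : m * Ex (fun G => f G * (ind (a, v) G - l)) =
   Ex (fun G => f G * (m * ind (a, v) G - (t v)%:R)) + ((t v)%:R - l * m) * Ex f.
  by rewrite -!ExZ -ExD; apply: eq_Ex => G _; ring.
have k2 : m * `|Ex (fun G => f G * (ind (a, v) G - l))| <= (N * (391 * q ^+ 2 * r) + 8 + 3 * Q) * W.
  rewrite -{1}(ger0_norm (ltW m0)) -normrM key; apply: (le_trans (ler_normD _ _)).
  have : `|((t v)%:R - l * m) * Ex f| <= 3 * Q * W by rewrite normrM; apply: ler_pM.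
  have : #|E|%:R * W <= 8 * W by rewrite ler_wpM2r.
  lra.
have k3 : N / 2 * `|Ex (fun G => f G * (ind (a, v) G - l))| <= (N * (391 * q ^+ 2 * r) + 8 + 3 * Q) * W.
  by apply: le_trans k2; apply: ler_wpM2r.
have N2 : 0 < N / 2 by lra.
rewrite -(ler_pM2l N2); apply: le_trans k3 _.
rewrite [leRHS]mulrA; apply: ler_wpM2r => //.
have q1 : 1 <= q by lra.
have -> : N / 2 * (q ^+ 13 * r) = q ^+ 13 / (2 * r) by rewrite (n_as_r Hn); field; rewrite gt_eqF.
have -> : N * (391 * q ^+ 2 * r) = 391 * q ^+ 2 / r by rewrite (n_as_r Hn); field; rewrite gt_eqF.
rewrite -(ler_pM2r r0).
have -> : q ^+ 13 / (2 * r) * r = q ^+ 11 * q ^+ 2 / 2 by rewrite -exprD; field; rewrite gt_eqF.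
have -> : (391 * q ^+ 2 / r + 8 + 3 * Q) * r = 391 * q ^+ 2 + 8 * r + 3 * q by field; rewrite gt_eqF.
have qq : q <= q ^+ 2 by rewrite -[leLHS]expr1 ler_weXn2l.
have : 2048 * q ^+ 2 <= q ^+ 11 * q ^+ 2.
  apply: ler_wpM2r; first by lra.
  by apply: le_trans (pow2q Hn 11); rewrite ler_nat.
lra.
Qed.

End Orders.

(** * Scaled degree data and the comparison of rows to first order *)

Section FirstOrder.
Variables (R : realType) (q r l : R) (n : nat) (s t : 'I_n -> nat) (F : digraph n).
Implicit Types (G : digraph n) (a b u v : 'I_n) (f : digraph n -> R).
Implicit Types (e : 'I_n * 'I_n) (E : digraph n).
Local Notation ind := (@arc_ind R n).
Local Notation Ex := (@ens_sum R n s t F).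
Local Notation swappable := (@swap_col n F).
Local Notation N := (n%:R : R).
Local Notation L := (l * (1 - l)).
Local Notation Q := (q / r).
Local Notation bnd := (bounded q r).
Local Notation colsize := (@open_rows R n F).

(* Scaled by [r ^+ 2 = 1/n]: the degree deviations of the paper, the degrees
   in [F], and the number of arcs of [F] divided by [n ^ 2]. *)
Definition scaled_delta a : R := r ^+ 2 * ((s a)%:R - l * N + l * (outdeg F a)%:R).
Definition scaled_eta v : R := r ^+ 2 * ((t v)%:R - l * N + l * (indeg F v)%:R).
Definition scaled_out a : R := r ^+ 2 * (outdeg F a)%:R.
Definition scaled_in v : R := r ^+ 2 * (indeg F v)%:R.
Definition scaled_arcs : R := r ^+ 4 * (#|F|)%:R.
Definition first_prob e : R := if e \in F then 0 else l + scaled_delta e.1 + scaled_eta e.2.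

Hypothesis Hn : nice q r l s t F.

Let q2 := nice_q Hn.
Let r0 := nice_r Hn.
Let r1 := proj2 (nice_r_small Hn).
Ltac bnda := bnd_auto q2 r0 r1.

Lemma bnd_l : bnd 0 0 l.
Proof. by apply: bnd_le1; rewrite ger0_norm ?(nice_l0 Hn) ?(nice_l1 Hn). Qed.

Lemma bnd_rQ (x : R) : `|x| <= Q -> bnd 1 1 (r ^+ 2 * x).
Proof.
move=> h; rewrite /bounded normrM ger0_norm ?exprn_ge0 ?(ltW r0) //.
have -> : q ^+ 1 * r ^+ 1 = r ^+ 2 * Q by field; rewrite gt_eqF.
by apply: ler_wpM2l => //; rewrite exprn_ge0 // ltW.
Qed.

Lemma bnd_sx a : bnd 1 1 (scaled_out a).
Proof. by apply: bnd_rQ; rewrite ger0_norm // (nice_x Hn). Qed.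

Lemma bnd_sy a : bnd 1 1 (scaled_in a).
Proof. by apply: bnd_rQ; rewrite ger0_norm // (nice_y Hn). Qed.

Lemma bnd_sd a : bnd 2 1 (scaled_delta a).
Proof.
have h1 := bnd_rQ (nice_s Hn a); have h2 := bnd_sx a; have h3 := bnd_l.
have -> : scaled_delta a = r ^+ 2 * ((s a)%:R - l * N) + l * scaled_out a by rewrite /scaled_delta /scaled_out; ring.
bnda.
Qed.

Lemma bnd_sh a : bnd 2 1 (scaled_eta a).
Proof.
have h1 := bnd_rQ (nice_t Hn a); have h2 := bnd_sy a; have h3 := bnd_l.
have -> : scaled_eta a = r ^+ 2 * ((t a)%:R - l * N) + l * scaled_in a by rewrite /scaled_eta /scaled_in; ring.
bnda.
Qed.

Lemma bnd_sX : bnd 2 2 scaled_arcs.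
Proof.
rewrite /bounded ger0_norm; last by rewrite mulr_ge0 ?exprn_ge0 ?(ltW r0).
have -> : q ^+ 2 * r ^+ 2 = r ^+ 4 * (q ^+ 2 * N).
  by rewrite (n_as_r Hn); field; rewrite gt_eqF.
by apply: ler_wpM2l; [rewrite exprn_ge0 // ltW | exact: nice_X Hn].
Qed.

Lemma card_arcs_out : \sum_a (outdeg F a)%:R = (#|F|)%:R :> R.
Proof.
rewrite -natr_sum; congr (_%:R).
under eq_bigr do rewrite outdeg_sum.
rewrite pair_big /= -sum1_card [RHS]big_mkcond /=.
by apply: eq_bigr => -[i j] _ /=; case: (_ \in _).
Qed.

Lemma card_arcs_in : \sum_a (indeg F a)%:R = (#|F|)%:R :> R.
Proof.
rewrite -natr_sum; congr (_%:R).
under eq_bigr do rewrite indeg_sum.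
rewrite exchange_big pair_big /= -sum1_card [RHS]big_mkcond /=.
by apply: eq_bigr => -[i j] _ /=; case: (_ \in _).
Qed.

Lemma sum_sd : r ^+ 2 * \sum_a scaled_delta a = l * scaled_arcs.
Proof.
rewrite /scaled_delta -mulr_sumr sumRD sumRB sumr_const card_ord sumRZ card_arcs_out (nice_ss Hn).
by rewrite -[X in _ - X]mulr_natl /scaled_arcs; ring.
Qed.

Lemma sum_sh : r ^+ 2 * \sum_a scaled_eta a = l * scaled_arcs.
Proof.
rewrite /scaled_eta -mulr_sumr sumRD sumRB sumr_const card_ord sumRZ card_arcs_in (nice_ts Hn).
by rewrite -[X in _ - X]mulr_natl /scaled_arcs; ring.
Qed.

Lemma cardNr : #|'I_n|%:R * r ^+ 2 = 1 :> R.
Proof. by rewrite card_ord (nice_n Hn). Qed.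

Definition swap_frac E a b : R := r ^+ 2 * \sum_(u | swappable E a b u) 1.

Lemma kapC E a b : 1 - swap_frac E a b = r ^+ 2 * \sum_(u | ~~ swappable E a b u) 1.
Proof.
have e1 : \sum_(u : 'I_n) (1 : R) = N by rewrite sumr_const card_ord.
have e2 : r ^+ 2 * \sum_(u : 'I_n) 1 = 1 by rewrite e1 mulrC (nice_n Hn).
move: e2; rewrite (bigID (swappable E a b)) /= mulrDr => e2.
by apply/eqP; rewrite subr_eq addrC /swap_frac e2.
Qed.

Lemma bnd_kapC E a b : (#|E| <= 8)%N -> bnd 3 1 (1 - swap_frac E a b).
Proof.
move=> E8; rewrite kapC.
have h : bnd 1 1 (r ^+ 2 * (4^-1 * \sum_(u | ~~ swappable E a b u) 1)).
  apply: bnd_rQ; rewrite ger0_norm; last by apply: mulr_ge0; [rewrite invr_ge0 | apply: sumr_ge0].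
  by have := sum_nonswap Hn a b E8; lra.
have -> : r ^+ 2 * \sum_(u | ~~ swappable E a b u) 1 =
   4 * (r ^+ 2 * (4^-1 * \sum_(u | ~~ swappable E a b u) 1)) by field.
bnda.
Qed.

Lemma kap_ge E a b : (#|E| <= 8)%N -> 2^-1 <= swap_frac E a b.
Proof.
move=> E8; have := bnd_kapC a b E8; rewrite /bounded.
have := @pow_q_small _ _ _ _ _ _ _ _ Hn 3 0 1 isT ler01; rewrite expr0 lexx => /(_ isT).
by rewrite mul1r expr1 ler_norml; lra.
Qed.

Lemma bnd_inv_ge (x c : R) m : 0 < c -> c <= x -> c^-1 <= q ^+ m -> bnd m 0 x^-1.
Proof.
move=> c0 cx cm; have x0 : 0 < x by lra.
rewrite /bounded expr0 mulr1 ger0_norm ?invr_ge0 ?(ltW x0) //.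
by apply: le_trans cm; rewrite lef_pV2.
Qed.

Lemma bnd_kapV E a b : (#|E| <= 8)%N -> bnd 1 0 (swap_frac E a b)^-1.
Proof.
move=> E8; apply: (@bnd_inv_ge _ 2^-1) (kap_ge a b E8) _; first by rewrite invr_gt0.
by rewrite invrK expr1.
Qed.

Lemma sum_p0 a : \sum_u zeroth_prob l F (a, u) = l * (N - (outdeg F a)%:R).
Proof.
rewrite -[N](_ : \sum_(u : 'I_n) 1 = _); last by rewrite sumr_const card_ord.
rewrite outdeg_sum natr_sum -sumRB -sumRZ; apply: eq_bigr => u _.
by rewrite /zeroth_prob; case: (_ \in _) => /=; ring.
Qed.

(** For [zeroth_prob] the approximate means are explicit: scaled by [1 / n], [pdiff] is the
    difference of the [scaled_delta] and [mean_discrep] is [L] times the fraction of swappable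
    columns. That fraction is [1] up to order [r], so dropping it costs order [r ^ 2]. *)
Lemma first_pair E f a b v : a != b -> (#|E| <= 4)%N -> localE E f -> swappable E a b v ->
  `|Ex (fun G => f G * (ind (a, v) G - ind (b, v) G)) - (scaled_delta a - scaled_delta b) * Ex f|
  <= q ^+ 31 * r ^+ 2 * Ex (fun G => `|f G|).
Proof.
move=> ab E4 lf fv.
have E8 : (#|E| <= 8)%N by apply: leq_trans E4 _.
have W0 := Ex_norm_ge0 s t F f.
have L0 := L_gt0 Hn; have L1 := L_le l; have l0 := nice_l0 Hn; have l1 := nice_l1 Hn.
have q1 : 1 <= q by have := q2; lra.
have qge k : 1 <= q ^+ k by rewrite exprn_ege1.
have r0' : 0 < r := r0.
have p01 e : 0 <= zeroth_prob l F e <= 1 by rewrite /zeroth_prob; case: ifP; rewrite ?lexx ?ler01 ?l0.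
have pn e : e \notin F -> `|zeroth_prob l F e - l| <= L / 8.
  by move=> /negbTE eF; rewrite /zeroth_prob eF subrr normr0; lra.
have rc : r ^+ 2 <= q ^+ 13 * r.
  rewrite expr2; apply: ler_wpM2r; first exact: ltW.
  by apply: le_trans r1 _.
have Er : #|E|%:R * r <= 8 * (q ^+ 13 * r).
  rewrite mulrA ler_pM2r //; have : #|E|%:R <= 4 :> R by rewrite ler_nat.
  have := qge 13%N; lra.
have k8 : (#|E|.+3 < 8)%N by rewrite !ltnS.
have := entry_diff_expand Hn (zeroth_order Hn) p01 pn rc ab k8 E8 lf fv Er.
have [avF bvF] : (a, v) \notin F /\ (b, v) \notin F.
  by move: fv; rewrite /swap_col !inE !negb_or => /andP[/andP[-> _] /andP[-> _]].
rewrite {1 2}/zeroth_prob (negbTE avF) (negbTE bvF).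
have k0 : 0 < swap_frac E a b by have := kap_ge a b E8; lra.
have sw0 u : swappable E a b u -> zeroth_prob l F (a, u) = l /\ zeroth_prob l F (b, u) = l.
  rewrite /swap_col !inE !negb_or /zeroth_prob => /andP[/andP[h1 _] /andP[h2 _]].
  by rewrite (negbTE h1) (negbTE h2).
have pd : r ^+ 2 * pdiff s F (zeroth_prob l F) E a b = scaled_delta a - scaled_delta b.
  have e1 : \sum_(u | ~~ swappable E a b u) (zeroth_prob l F (a, u) - zeroth_prob l F (b, u)) =
     \sum_u (zeroth_prob l F (a, u) - zeroth_prob l F (b, u)).
    rewrite [RHS](bigID (swappable E a b)) /= [X in _ = X + _]big1 ?add0r //.
    by move=> u /sw0[-> ->]; rewrite subrr.
  by rewrite /pdiff e1 sumRB !sum_p0 /scaled_delta; ring.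
have md : r ^+ 2 * mean_discrep F (zeroth_prob l F) E a b = L * swap_frac E a b.
  rewrite /mean_discrep /swap_frac.
  have -> : \sum_(u | swappable E a b u) (1 - zeroth_prob l F (a, u)) * zeroth_prob l F (b, u) =
      L * \sum_(u | swappable E a b u) 1.
    by rewrite mulr_sumr; apply: eq_bigr => u /sw0[-> ->]; ring.
  ring.
have -> : (1 - l) * l * pdiff s F (zeroth_prob l F) E a b / mean_discrep F (zeroth_prob l F) E a b =
   (scaled_delta a - scaled_delta b) + (scaled_delta a - scaled_delta b) * (1 - swap_frac E a b) / swap_frac E a b.
  have m0 : mean_discrep F (zeroth_prob l F) E a b != 0.
    apply: contraTneq k0 => m0; move: md; rewrite m0 mulr0 => /esym/eqP.
    by rewrite mulf_eq0 (gt_eqF L0) /= => /eqP ->; rewrite ltxx.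
  have -> : (1 - l) * l * pdiff s F (zeroth_prob l F) E a b / mean_discrep F (zeroth_prob l F) E a b =
     L * (r ^+ 2 * pdiff s F (zeroth_prob l F) E a b) / (r ^+ 2 * mean_discrep F (zeroth_prob l F) E a b).
    by field; rewrite m0 gt_eqF.
  rewrite pd md; field.
  by rewrite !gt_eqF //; nra.
set D := Ex (fun G => f G * _); set W := Ex (fun G => `|f G|) in W0 *.
have fW : `|Ex f| <= W by exact: normEx.
have b1 := bnd_sd; have b2 := bnd_kapC a b E8; have b3 := bnd_kapV a b E8.
have : bnd 7 2 ((scaled_delta a - scaled_delta b) * (1 - swap_frac E a b) / swap_frac E a b) by bnda.
set y := (scaled_delta a - scaled_delta b) * (1 - swap_frac E a b) / swap_frac E a b; rewrite /bounded => hy.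
have hyW : `|y * Ex f| <= q ^+ 7 * r ^+ 2 * W by rewrite normrM; apply: ler_pM.
have -> : q ^+ 17 * r * (q ^+ 13 * r) = q ^+ 30 * r ^+ 2 by rewrite (exprD _ 17 13); ring.
have h30 : q ^+ 7 * r ^+ 2 * W <= q ^+ 30 * r ^+ 2 * W.
  by apply: ler_wpM2r => //; apply: (qr_le q2 r0 r1).
have h31 : 2 * (q ^+ 30 * r ^+ 2 * W) <= q ^+ 31 * r ^+ 2 * W.
  have Y0 : 0 <= q ^+ 30 * r ^+ 2 * W.
    by apply: mulr_ge0 => //; apply: ltW; exact: (qr_pos q2 r0 30 2).
  have -> : q ^+ 31 * r ^+ 2 * W = q * (q ^+ 30 * r ^+ 2 * W) by rewrite [q ^+ 31]exprS !mulrA.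
  by apply: ler_wpM2r.
move: hyW; rewrite !ler_norml; lra.
Qed.

End FirstOrder.

Section SecondOrder.
Variables (R : realType) (q r l : R) (n : nat) (s t : 'I_n -> nat) (F : digraph n).
Implicit Types (G : digraph n) (a b u v : 'I_n) (f : digraph n -> R).
Implicit Types (e : 'I_n * 'I_n) (E : digraph n).
Local Notation ind := (@arc_ind R n).
Local Notation Ex := (@ens_sum R n s t F).
Local Notation Om := (@ensemble n s t F).
Local Notation swappable := (@swap_col n F).
Local Notation N := (n%:R : R).
Local Notation L := (l * (1 - l)).
Local Notation Q := (q / r).
Local Notation bnd := (bounded q r).
Local Notation colsize := (@open_rows R n F).
Local Notation sd := (@scaled_delta R r l n s F).
Local Notation sh := (@scaled_eta R r l n t F).
Local Notation sx := (@scaled_out R r n F).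
Local Notation sy := (@scaled_in R r n F).
Local Notation sX := (@scaled_arcs R r n F).
Local Notation p1 := (@first_prob R r l n s t F).
Local Notation kap := (@swap_frac R r n F).

Hypothesis Hn : nice q r l s t F.

Let q2 := nice_q Hn.
Let r0 := nice_r Hn.
Let r1 := proj2 (nice_r_small Hn).
Ltac bnda := bnd_auto q2 r0 r1.

Lemma bnd_sum_on (P : pred 'I_n) (h : 'I_n -> R) m k m' k' :
  bnd m k (r ^+ 2 * \sum_(u | P u) 1) -> (forall u, bnd m' k' (h u)) ->
  bnd (m + m') (k + k') (r ^+ 2 * \sum_(u | P u) h u).
Proof.
move=> hP hh; have r20 : 0 <= r ^+ 2 by rewrite exprn_ge0 // ltW.
rewrite /bounded !exprD mulrACA normrM (ger0_norm r20).
apply: (@le_trans _ _ ((r ^+ 2 * \sum_(u | P u) 1) * (q ^+ m' * r ^+ k'))).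
  rewrite -mulrA; apply: ler_wpM2l => //; apply: (le_trans (ler_norm_sum _ _ _)).
  by rewrite mulr_suml; apply: ler_sum => u _; rewrite mul1r; exact: hh.
apply: ler_wpM2r; first exact: ltW (qr_pos q2 r0 _ _).
by apply: le_trans hP; exact: ler_norm.
Qed.

Lemma scaled_t v : r ^+ 2 * (t v)%:R = l + sh v - l * sy v.
Proof.
rewrite /scaled_eta /scaled_in.
have -> : r ^+ 2 * ((t v)%:R - l * N + l * (indeg F v)%:R) =
  r ^+ 2 * (t v)%:R - l * (N * r ^+ 2) + l * (r ^+ 2 * (indeg F v)%:R) by ring.
rewrite (nice_n Hn); ring.
Qed.

Lemma colsizeC E v : r ^+ 2 * \sum_(b | (b, v) \in F :|: E) 1 = 1 - r ^+ 2 * colsize E v.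
Proof.
have e1 : \sum_(u : 'I_n) (1 : R) = N by rewrite sumr_const card_ord.
have e2 : r ^+ 2 * \sum_(u : 'I_n) 1 = 1 by rewrite e1 mulrC (nice_n Hn).
move: e2; rewrite (bigID (fun b => (b, v) \in F :|: E)) /= mulrDr => e2.
by apply/eqP; rewrite eq_sym subr_eq /open_rows e2.
Qed.

Lemma sum_diff E a v (h : 'I_n -> R) : (a, v) \notin F :|: E ->
  \sum_(b | ((b, v) \notin F :|: E) && (b != a)) (h a - h b) =
  colsize E v * h a - \sum_(b | (b, v) \notin F :|: E) h b.
Proof.
move=> av; rewrite /open_rows mulr_suml -sumRB [RHS](bigD1 a) //= mul1r subrr add0r.
by apply: eq_bigr => b _ /=; ring.
Qed.

(** Let [M] be the fraction of free rows in column [v], that is [1 - y_v / n] up to order [r ^ 2].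
    The column sum contributes [t_v / n = l + eta_v / n - l y_v / n], and division by [M] cancels
    the last term to this order; this is why the deviations include [l] times the degree in [F]. The
    mean of [scaled_delta] over the free rows has order [r ^ 2], because over all rows it is
    [l X / n ^ 2]. *)
Lemma first_order : accurate s t F 4 (q ^+ 34 * r ^+ 2) p1.
Proof.
have q2' : 2 <= q := q2; have r0' : 0 < r := r0; have r1' : r <= 1 := r1.
have q0 : 0 <= q by lra.
apply: accurate_F; first by rewrite mulr_ge0 ?exprn_ge0 // ltW.
  by move=> e eF; rewrite /first_prob eF.
move=> E f a v E4 lf av.
have E8 : (#|E| <= 8)%N by apply: leq_trans E4 _.
have avF : (a, v) \notin F by move: av; rewrite inE negb_or => /andP[].
have W0 := Ex_norm_ge0 s t F f.
have eta0 : 0 <= q ^+ 31 * r ^+ 2 by rewrite mulr_ge0 ?exprn_ge0 // ltW.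
have pr b : b != a -> (b, v) \notin F :|: E ->
   `|Ex (fun G => f G * (ind (a, v) G - ind (b, v) G)) - (sd a - sd b) * Ex f|
   <= q ^+ 31 * r ^+ 2 * Ex (fun G => `|f G|).
  move=> ba bv; apply: (first_pair Hn) lf _ => //; first by rewrite eq_sym.
  exact/andP.
have := @column_step _ _ _ _ _ E f a v (fun b => sd a - sd b) _ eta0 av pr.
rewrite sum_diff //.
set A := Ex (fun G => f G * (colsize E v * ind (a, v) G - (t v)%:R)).
set W := Ex (fun G => `|f G|) in W0 *; set B := colsize E v * sd a - _ => hAB.
have fW : `|Ex f| <= W by exact: normEx.
set M := r ^+ 2 * colsize E v.
have r20 : 0 < r ^+ 2 by rewrite exprn_gt0.
have M2 : 2^-1 <= M.
  have : r ^+ 2 * (N / 2) <= M by apply: ler_wpM2l (colsize_ge Hn v E8); exact: ltW.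
  have -> : r ^+ 2 * (N / 2) = (N * r ^+ 2) / 2 by ring.
  by rewrite (nice_n Hn) mul1r.
pose S := r ^+ 2 * \sum_(b | (b, v) \notin F :|: E) sd b.
pose S' := r ^+ 2 * \sum_(b | (b, v) \in F :|: E) sd b.
have SS : S = l * sX - S'.
  rewrite -(sum_sd Hn) (bigID (fun b => (b, v) \in F :|: E)) /= mulrDr /S /S'; ring.
pose eM : R := 1 - sy v - M.
have beM : bnd 3 2 eM.
  have /andP[h1 h2] := colsize_bounds R F v E8.
  have E8' : #|E|%:R <= 8 :> R by rewrite ler_nat.
  rewrite /bounded (_ : eM = r ^+ 2 * (N - (indeg F v)%:R - colsize E v)); last first.
    rewrite /eM /M /scaled_in -{1}(nice_n Hn); ring.
  rewrite normrM ger0_norm ?(ltW r20) // mulrC; apply: ler_wpM2r; first exact: ltW.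
  apply: (@le_trans _ _ 8); first by rewrite ger0_norm; lra.
  by apply: le_trans (pow2q Hn 3); rewrite ler_nat.
have b1 := bnd_sd Hn; have b2 := bnd_sh Hn; have b3 := bnd_sy Hn; have b4 := bnd_l Hn.
have b5 := bnd_sX Hn.
have bS' : bnd 6 2 S'.
  have h : bnd 4 1 (r ^+ 2 * \sum_(b | (b, v) \in F :|: E) 1).
    rewrite colsizeC -/M; have -> : 1 - M = sy v + eM by rewrite /eM; ring.
    bnda.
  by have := bnd_sum_on h b1.
pose Z : R := sh v * sy v + eM * (l + sh v) - (l * sX - S').
have bZ : bnd 10 2 Z by rewrite /Z; bnda.
rewrite /first_prob (negbTE avF) /=.
set X := Ex (fun G => f G * (ind (a, v) G - _)).
have key : M * X = r ^+ 2 * (A - B * Ex f) + Z * Ex f.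
  have e1 : M * X = r ^+ 2 * A + (r ^+ 2 * (t v)%:R - M * (l + sd a + sh v)) * Ex f.
    by rewrite /X /A -!ExZ -ExD; apply: eq_Ex => G _; rewrite /M; ring.
  have e2 : r ^+ 2 * B = M * sd a - S by rewrite /B /M /S; ring.
  rewrite e1 mulrBr (mulrA (r ^+ 2) B) e2 scaled_t SS /Z.
  have -> : M = 1 - sy v - eM by rewrite /eM; ring.
  ring.
have E4' : #|E|%:R <= 4 :> R by rewrite ler_nat.
have k1 : M * `|X| <= (q ^+ 31 * r ^+ 2 + 4 * r ^+ 2 + q ^+ 10 * r ^+ 2) * W.
  have M0 : 0 <= M by lra.
  rewrite -{1}(ger0_norm M0) -normrM key; apply: (le_trans (ler_normD _ _)).
  rewrite [leRHS]mulrDl; apply: lerD; last by rewrite normrM; apply: ler_pM.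
  rewrite normrM (ger0_norm (ltW r20)).
  apply: (@le_trans _ _ (r ^+ 2 * ((N * (q ^+ 31 * r ^+ 2) + 4) * W))).
    apply: ler_wpM2l; first exact: ltW.
    apply: le_trans hAB _; apply: ler_wpM2r => //; lra.
  have -> : r ^+ 2 * ((N * (q ^+ 31 * r ^+ 2) + 4) * W) =
    (q ^+ 31 * (N * r ^+ 2) * r ^+ 2 + 4 * r ^+ 2) * W by ring.
  by rewrite (nice_n Hn) mulr1.
have k2 : 2^-1 * `|X| <= (q ^+ 31 * r ^+ 2 + 4 * r ^+ 2 + q ^+ 10 * r ^+ 2) * W.
  by apply: le_trans k1; apply: ler_wpM2r.
have rW : 0 <= r ^+ 2 * W by rewrite mulr_ge0 // ltW.
have m1 : q ^+ 10 * (r ^+ 2 * W) <= q ^+ 31 * (r ^+ 2 * W).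
  by apply: ler_wpM2r => //; rewrite ler_weXn2l //; lra.
have m2 : 4 * (r ^+ 2 * W) <= q ^+ 31 * (r ^+ 2 * W).
  apply: ler_wpM2r => //; apply: (@le_trans _ _ (q ^+ 2)).
    by apply: le_trans (pow2q Hn 2); rewrite ler_nat.
  by rewrite ler_weXn2l //; lra.
have -> : q ^+ 34 * r ^+ 2 * W = q ^+ 3 * (q ^+ 31 * (r ^+ 2 * W)) by rewrite (exprD _ 3 31); ring.
have m3 : 8 * (q ^+ 31 * (r ^+ 2 * W)) <= q ^+ 3 * (q ^+ 31 * (r ^+ 2 * W)).
  apply: ler_wpM2r; first by rewrite mulr_ge0 // exprn_ge0.
  by apply: le_trans (pow2q Hn 3); rewrite ler_nat.
lra.
Qed.

(** Up to the factor [n ^ 2], the sum of the column deviations over the heads of the arcs of [F]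
    leaving [a]; [omega] is its counterpart for arcs entering [v]. Such sums reappear in the
    increment of [Y] when an arc is added. *)
Definition zeta a : R := r ^+ 2 * \sum_(u | (a, u) \in F) sh u.
Definition omega v : R := r ^+ 2 * \sum_(b | (b, v) \in F) sd b.

Lemma sxE a : r ^+ 2 * \sum_(u | (a, u) \in F) 1 = sx a.
Proof.
rewrite /scaled_out outdeg_sum natr_sum [in LHS]big_mkcond /=; congr (_ * _).
by apply: eq_bigr => u _; case: (_ \in _).
Qed.

Lemma syE v : r ^+ 2 * \sum_(b | (b, v) \in F) 1 = sy v.
Proof.
rewrite /scaled_in indeg_sum natr_sum [in LHS]big_mkcond /=; congr (_ * _).
by apply: eq_bigr => u _; case: (_ \in _).
Qed.

Lemma bnd_zeta a : bnd 3 2 (zeta a).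
Proof.
have h : bnd 1 1 (r ^+ 2 * \sum_(u | (a, u) \in F) 1) by rewrite sxE; exact: bnd_sx Hn a.
exact: bnd_sum_on h (bnd_sh Hn).
Qed.

Lemma bnd_omega v : bnd 3 2 (omega v).
Proof.
have h : bnd 1 1 (r ^+ 2 * \sum_(b | (b, v) \in F) 1) by rewrite syE; exact: bnd_sy Hn v.
exact: bnd_sum_on h (bnd_sd Hn).
Qed.

Lemma sum_sx : r ^+ 2 * \sum_a sx a = sX.
Proof. by rewrite /scaled_out -mulr_sumr (card_arcs_out R F) /scaled_arcs; ring. Qed.

Lemma sum_p1 a : r ^+ 2 * \sum_u p1 (a, u) = (1 - sx a) * (l + sd a) + l * sX - zeta a.
Proof.
rewrite -(sum_sh Hn) -(sxE a) /zeta.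
have e1 : r ^+ 2 * \sum_(u : 'I_n) 1 = 1 by rewrite sumr_const card_ord mulrC (nice_n Hn).
have -> : \sum_u p1 (a, u) = (\sum_(u : 'I_n) 1 - \sum_(u | (a, u) \in F) 1) * (l + sd a)
    + \sum_u sh u - \sum_(u | (a, u) \in F) sh u.
  rewrite [X in _ = (_ - X) * _ + _ - _]big_mkcond [X in _ = _ - X]big_mkcond /=.
  rewrite -sumRB mulr_suml -sumRD -sumRB; apply: eq_bigr => u _.
  by rewrite /first_prob /=; case: (_ \in _); ring.
by rewrite 2!mulrDr mulrN mulrA [r ^+ 2 * (_ - _)]mulrBr e1.
Qed.

Definition row_term v a : R := sd a + (1 - 2 * l) * sd a * sh v / L + sx a * sd a + zeta a.

Lemma p1_near e : e \notin F -> `|p1 e - l| <= L / 8.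
Proof.
move=> eF; rewrite /first_prob (negbTE eF).
have b1 := bnd_sd Hn; have b2 := bnd_sh Hn.
have : bnd 3 1 (sd e.1 + sh e.2) by bnda.
have -> : l + sd e.1 + sh e.2 - l = sd e.1 + sh e.2 by ring.
move=> h; apply: le_trans h _; rewrite expr1.
have c0 : 0 < 8 * q by have := q2; lra.
have := @pow_q_small _ _ _ _ _ _ _ _ Hn 4 3 8 isT (ler0n R 8) (pow2q Hn 3).
have h := nice_L Hn => h'.
rewrite -(ler_pM2l c0).
have -> : 8 * q * (q ^+ 3 * r) = 8 * q ^+ 4 * r by rewrite [q ^+ 4]exprS; ring.
lra.
Qed.

Lemma p1_01 e : 0 <= p1 e <= 1.
Proof.
have [eF|eF] := boolP (e \in F); first by rewrite /first_prob eF lexx ler01.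
have := p1_near eF; have := nice_l0 Hn; have := nice_l1 Hn => l1 l0.
have Ll : L <= l by rewrite ler_piMr //; lra.
have Ll2 : L <= 1 - l by rewrite ler_piMl //; lra.
rewrite ler_norml; lra.
Qed.

Lemma ratio_identity (d1 d2 h kp rho T : R) (D := kp * ((1 - l - d1) * (l + d2)) + T) :
  D != 0 ->
  (1 - (l + d1 + h)) * (l + d2 + h) * (rho + kp * (d1 - d2)) / D
   - ((d1 - d2) + (1 - 2 * l) * (d1 - d2) * h / L + rho) =
  ((1 - l - d1) * (l + d2) * rho * (1 - kp)
   + (h * (1 - 2 * l - d1 - d2) - h ^+ 2) * rho
   + kp * (d1 - d2) * (- (h * (d1 + d2)) - h ^+ 2
       - ((1 - l) * d2 - l * d1 - d1 * d2) * (1 - 2 * l) * h * L^-1)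
   - T * (d1 - d2 + rho) - T * (1 - 2 * l) * (d1 - d2) * h * L^-1) * D^-1.
Proof.
move=> D0; have L0 := L_gt0 Hn.
have [l0 l1] : l != 0 /\ 1 - l != 0.
  by move: (lt0r_neq0 L0); rewrite mulf_eq0 negb_or => /andP.
rewrite /D in D0 *; field.
by rewrite ?D0 ?l0 ?l1.
Qed.

Lemma pair_expansion a b v : swappable set0 a b v ->
  bnd 40 3 ((1 - p1 (a, v)) * p1 (b, v) * pdiff s F p1 set0 a b / mean_discrep F p1 set0 a b
      - (row_term v a - row_term v b)).
Proof.
move=> fv.
have [avF bvF] : (a, v) \notin F /\ (b, v) \notin F.
  by move: fv; rewrite /swap_col !inE !negb_or => /andP[/andP[-> _] /andP[-> _]].
have L0 := L_gt0 Hn; have L1 := L_le l; have l0 := nice_l0 Hn; have l1 := nice_l1 Hn.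
have q2' : 2 <= q := q2; have r0' : 0 < r := r0.
have ab8 : (#|@set0 ('I_n * 'I_n)%type| <= 8)%N by rewrite cards0.
set kp := kap set0 a b.
have k2 : 2^-1 <= kp := kap_ge Hn a b ab8.
have sw0 u : swappable set0 a b u -> p1 (a, u) = l + sd a + sh u /\ p1 (b, u) = l + sd b + sh u.
  rewrite /swap_col !inE !negb_or /first_prob => /andP[/andP[h1 _] /andP[h2 _]].
  by rewrite (negbTE h1) (negbTE h2).
have scs j : r ^+ 2 * (s j)%:R = l + sd j - l * sx j.
  rewrite /scaled_delta /scaled_out.
  have -> : r ^+ 2 * ((s j)%:R - l * N + l * (outdeg F j)%:R) =
    r ^+ 2 * (s j)%:R - l * (N * r ^+ 2) + l * (r ^+ 2 * (outdeg F j)%:R) by ring.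
  rewrite (nice_n Hn); ring.
have pd : r ^+ 2 * pdiff s F p1 set0 a b =
   (sx a * sd a + zeta a - sx b * sd b - zeta b) + kp * (sd a - sd b).
  have e1 : \sum_(u | ~~ swappable set0 a b u) (p1 (a, u) - p1 (b, u)) =
     \sum_u p1 (a, u) - \sum_u p1 (b, u) - (\sum_(u | swappable set0 a b u) 1) * (sd a - sd b).
    rewrite -[X in _ = X - _]sumRB [X in _ = X - _](bigID (swappable set0 a b)) /=.
    have -> : \sum_(u | swappable set0 a b u) (p1 (a, u) - p1 (b, u)) =
       (\sum_(u | swappable set0 a b u) 1) * (sd a - sd b).
      by rewrite mulr_suml; apply: eq_bigr => u /sw0[-> ->]; ring.
    ring.
  rewrite /pdiff e1.
  have -> : forall A B C D K : R, r ^+ 2 * (A - B - (C - D - K * (sd a - sd b))) =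
     r ^+ 2 * A - r ^+ 2 * B - (r ^+ 2 * C - r ^+ 2 * D) + r ^+ 2 * K * (sd a - sd b) by move=> *; ring.
  rewrite !scs !sum_p1 /kp /swap_frac; ring.
pose H1 : R := r ^+ 2 * \sum_(u | swappable set0 a b u) sh u.
pose H2 : R := r ^+ 2 * \sum_(u | swappable set0 a b u) sh u ^+ 2.
pose P : R := (1 - l - sd a) * (l + sd b).
pose T : R := (1 - 2 * l - sd a - sd b) * H1 - H2.
have md : r ^+ 2 * mean_discrep F p1 set0 a b = kp * P + T.
  have -> : mean_discrep F p1 set0 a b = (\sum_(u | swappable set0 a b u) 1) * P
     + (1 - 2 * l - sd a - sd b) * \sum_(u | swappable set0 a b u) sh u
     - \sum_(u | swappable set0 a b u) sh u ^+ 2.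
    rewrite /mean_discrep [X in _ + X - _]mulr_sumr mulr_suml -sumRD -sumRB.
    by apply: eq_bigr => u /sw0[-> ->]; rewrite /P; ring.
  rewrite /kp /swap_frac /T /H1 /H2; ring.
have b1 := bnd_sd Hn; have b2 := bnd_sh Hn; have b3 := bnd_sy Hn; have b4 := bnd_l Hn.
have b5 := bnd_sX Hn; have b6 := bnd_sx Hn; have b7 := bnd_zeta.
have b8 := (bnd_Linv Hn); have b9 := bnd_kapC Hn a b ab8; rewrite -/kp in b9.
have bk : bnd 4 0 kp by have -> : kp = 1 - (1 - kp) by [ring]; bnda.
(* Over all columns the mean is [l X / n ^ 2], already of order [r ^ 2]; the columns left out are a
   fraction of order [r], with summands of order [r]. *)
have bH1 : bnd 7 2 H1.
  have -> : H1 = l * sX - r ^+ 2 * \sum_(u | ~~ swappable set0 a b u) sh u.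
    rewrite -(sum_sh Hn) [X in _ = _ * X - _](bigID (swappable set0 a b)) /= /H1; ring.
  have h : bnd 3 1 (r ^+ 2 * \sum_(u | ~~ swappable set0 a b u) 1).
    by rewrite -(kapC Hn set0 a b).
  have h' := bnd_sum_on h b2.
  bnda.
have bH2 : bnd 4 2 H2.
  apply: (bnd_sum q2 r0 (cardNr Hn)) => u _.
  by have bu := b2 u; bnda.
have bT : bnd 12 2 T by rewrite /T; bnda.
have DL : L / 2 <= kp * P + T.
  rewrite -md.
  have := meand_ge Hn p1_near a b ab8 => h.
  have r20 : 0 <= r ^+ 2 by rewrite exprn_ge0 // ltW.
  have : r ^+ 2 * (L * N / 2) <= r ^+ 2 * mean_discrep F p1 set0 a b by apply: ler_wpM2l.
  have -> : r ^+ 2 * (L * N / 2) = L * (N * r ^+ 2) / 2 by ring.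
  by rewrite (nice_n Hn) mulr1.
have D0 : kp * P + T != 0 by rewrite gt_eqF //; lra.
have bD : bnd 2 0 (kp * P + T)^-1.
  apply: (@bnd_inv_ge R q r _ (L / 2)) DL _; first by rewrite divr_gt0.
  have := bnd_Linv Hn; rewrite /bounded expr0 mulr1 expr1 ger0_norm ?invr_ge0 ?(ltW L0) // => h.
  rewrite invf_div expr2 mulrC; apply: ler_pM => //; rewrite ?invr_ge0 ?(ltW L0) //.
have m0 : mean_discrep F p1 set0 a b != 0.
  by apply: contraNneq D0 => m0; rewrite -md m0 mulr0.
have pav : p1 (a, v) = l + sd a + sh v by rewrite /first_prob (negbTE avF).
have pbv : p1 (b, v) = l + sd b + sh v by rewrite /first_prob (negbTE bvF).
pose rho : R := sx a * sd a + zeta a - sx b * sd b - zeta b.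
have -> : (1 - p1 (a, v)) * p1 (b, v) * pdiff s F p1 set0 a b / mean_discrep F p1 set0 a b
      - (row_term v a - row_term v b) =
   (1 - (l + sd a + sh v)) * (l + sd b + sh v) * (rho + kp * (sd a - sd b)) / (kp * P + T)
   - ((sd a - sd b) + (1 - 2 * l) * (sd a - sd b) * sh v / L + rho).
  have -> : forall x y : R, x * pdiff s F p1 set0 a b / mean_discrep F p1 set0 a b - y =
      x * (r ^+ 2 * pdiff s F p1 set0 a b) / (r ^+ 2 * mean_discrep F p1 set0 a b) - y.
    by move=> x y; field; rewrite m0 gt_eqF.
  rewrite pd md -/rho pav pbv; congr (_ - _); rewrite /row_term /rho; ring.
rewrite ratio_identity //.
have brho : bnd 8 2 rho by rewrite /rho; bnda.
bnda.
Qed.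

(** Although it is found by comparing rows, the formula is symmetric under exchanging rows and
    columns, as transposing the digraphs requires. *)
Definition second_prob a v : R := row_term v a + l + sh v + sh v * sy v + omega v - l * sX.

Lemma Ex1 : Ex (fun _ => 1) = (#|Om|)%:R.
Proof. by rewrite /ens_sum sumr_const. Qed.

(** The last round runs with weight [1] and empty [E]. Accuracy [q ^ 34 r ^ 2] becomes
    [q ^ (17 + 34) r ^ 3], and one more [q] pays for adding the error of [pair_expansion]. *)
Lemma second_pair a b v : a != b -> swappable set0 a b v ->
  `|Ex (fun G => ind (a, v) G - ind (b, v) G) - (row_term v a - row_term v b) * (#|Om|)%:R|
  <= q ^+ 52 * r ^+ 3 * (#|Om|)%:R.
Proof.
move=> ab fv.
have q2' : 2 <= q := q2; have r0' : 0 < r := r0; have r1' : r <= 1 := r1.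
have l0 : localE (@set0 ('I_n * 'I_n)%type) (fun _ : digraph n => 1 : R) by [].
have c0 : (#|@set0 ('I_n * 'I_n)%type| = 0)%N by rewrite cards0.
have rc : r ^+ 2 <= q ^+ 34 * r ^+ 2.
  by rewrite ler_peMl ?exprn_ge0 ?(ltW r0) // exprn_ege1 //; lra.
have k4 : (#|@set0 ('I_n * 'I_n)%type|.+3 < 4)%N by rewrite c0.
have k8 : (#|@set0 ('I_n * 'I_n)%type| <= 8)%N by rewrite c0.
have Er : #|@set0 ('I_n * 'I_n)%type|%:R * r <= 8 * (q ^+ 34 * r ^+ 2).
  by rewrite c0 mul0r; apply: mulr_ge0 => //; exact: ltW (qr_pos q2 r0 34 2).
have := entry_diff_expand Hn first_order p1_01 p1_near rc ab k4 k8 l0 fv Er.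
have -> : Ex (fun _ => `|1|) = (#|Om|)%:R by rewrite -Ex1; apply: eq_Ex => G _; rewrite normr1.
have -> : Ex (fun G => 1 * (ind (a, v) G - ind (b, v) G)) = Ex (fun G => ind (a, v) G - ind (b, v) G).
  by apply: eq_Ex => G _; rewrite mul1r.
rewrite Ex1; set W := (#|Om|)%:R => h.
have W0 : 0 <= W by [].
have := pair_expansion fv; set y := _ - _; rewrite /bounded => hy.
have hyW : `|y * W| <= q ^+ 51 * r ^+ 3 * W.
  rewrite normrM (ger0_norm W0); apply: ler_wpM2r => //; apply: le_trans hy _.
  exact: (qr_le q2 r0 r1).
have e1 : q ^+ 17 * r * (q ^+ 34 * r ^+ 2) = q ^+ 51 * r ^+ 3 by rewrite (exprD _ 17 34); ring.
rewrite e1 in h.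
have h31 : 2 * (q ^+ 51 * r ^+ 3 * W) <= q ^+ 52 * r ^+ 3 * W.
  have Y0 : 0 <= q ^+ 51 * r ^+ 3 * W.
    by apply: mulr_ge0 => //; apply: ltW; exact: (qr_pos q2 r0 51 3).
  have -> : q ^+ 52 * r ^+ 3 * W = q * (q ^+ 51 * r ^+ 3 * W) by rewrite [q ^+ 52]exprS !mulrA.
  by apply: ler_wpM2r.
move: h hyW; rewrite /y mulrBl !ler_norml; lra.
Qed.

Lemma arc_count a v : (a, v) \notin F ->
  `|(#|[set G in Om | (a, v) \in G]|)%:R - second_prob a v * (#|Om|)%:R| <= q ^+ 55 * r ^+ 3 * (#|Om|)%:R.
Proof.
move=> avF.
have q2' : 2 <= q := q2; have r0' : 0 < r := r0; have r1' : r <= 1 := r1.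
have c0 : (#|@set0 ('I_n * 'I_n)%type| = 0)%N by rewrite cards0.
have k8 : (#|@set0 ('I_n * 'I_n)%type| <= 8)%N by rewrite c0.
have av : (a, v) \notin F :|: set0 by rewrite setU0.
set W := (#|Om|)%:R; have W0 : 0 <= W by [].
have W1 : Ex (fun _ => `|1|) = W by rewrite /W -Ex1; apply: eq_Ex => G _; rewrite normr1.
have eta0 : 0 <= q ^+ 52 * r ^+ 3 by rewrite mulr_ge0 ?exprn_ge0 ?(ltW r0) //; lra.
have pr b : b != a -> (b, v) \notin F :|: set0 ->
   `|Ex (fun G => 1 * (ind (a, v) G - ind (b, v) G)) - (row_term v a - row_term v b) * Ex (fun _ => 1)|
   <= q ^+ 52 * r ^+ 3 * Ex (fun _ => `|1|).
  move=> ba bv; rewrite Ex1 W1.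
  have -> : Ex (fun G => 1 * (ind (a, v) G - ind (b, v) G)) = Ex (fun G => ind (a, v) G - ind (b, v) G).
    by apply: eq_Ex => G _; rewrite mul1r.
  by apply: second_pair; [rewrite eq_sym | exact/andP].
have := @column_step _ _ _ _ _ set0 (fun _ => 1) a v (fun b => row_term v a - row_term v b) _ eta0 av pr.
rewrite sum_diff // W1 Ex1 c0 addr0 -/W.
set A := Ex _; set B := colsize set0 v * row_term v a - _ => hAB.
set M := r ^+ 2 * colsize set0 v.
have r20 : 0 < r ^+ 2 by rewrite exprn_gt0.
have M2 : 2^-1 <= M.
  have : r ^+ 2 * (N / 2) <= M by apply: ler_wpM2l (colsize_ge Hn v k8); exact: ltW.
  have -> : r ^+ 2 * (N / 2) = (N * r ^+ 2) / 2 by ring.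
  by rewrite (nice_n Hn) mul1r.
have ME : M = 1 - sy v.
  have e1 : r ^+ 2 * \sum_(b | (b, v) \in F :|: set0) 1 = sy v by rewrite setU0 syE.
  by rewrite -e1 colsizeC subKr.
pose e1 : R := r ^+ 2 * \sum_b (sx b * sd b + zeta b).
pose e2 : R := r ^+ 2 * \sum_(b | (b, v) \in F) ((1 - 2 * l) * sd b * sh v / L + sx b * sd b + zeta b).
have b1 := bnd_sd Hn; have b2 := bnd_sh Hn; have b3 := bnd_sy Hn; have b4 := bnd_l Hn.
have b5 := bnd_sX Hn; have b6 := bnd_sx Hn; have b7 := bnd_zeta; have b8 := (bnd_Linv Hn).
have b9 := bnd_omega.
have SE : r ^+ 2 * \sum_(b | (b, v) \notin F :|: set0) row_term v b =
    l * sX + (1 - 2 * l) * sh v / L * (l * sX) + e1 - omega v - e2.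
  have h1 : r ^+ 2 * \sum_b row_term v b = l * sX + (1 - 2 * l) * sh v / L * (l * sX) + e1.
    rewrite -(sum_sd Hn) /e1.
    have -> : \sum_b row_term v b = \sum_b sd b + ((1 - 2 * l) * sh v / L) * \sum_b sd b
         + \sum_b (sx b * sd b + zeta b).
      rewrite [X in _ = _ + X + _]mulr_sumr -!sumRD; apply: eq_bigr => b _; rewrite /row_term; ring.
    ring.
  have h2 : r ^+ 2 * \sum_(b | (b, v) \in F) row_term v b = omega v + e2.
    rewrite /omega /e2 -mulrDr -sumRD; congr (_ * _); apply: eq_bigr => b _; rewrite /row_term; ring.
  rewrite setU0 -h1 [in RHS](bigID (fun b => (b, v) \in F)) /= mulrDr h2; ring.
(* Both sides sum [scaled_eta] over the heads of the arcs of [F]. *)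
have zsum : r ^+ 2 * \sum_b zeta b = r ^+ 2 * \sum_u sy u * sh u.
  rewrite /zeta -mulr_sumr; congr (_ * _).
  have -> : \sum_u sy u * sh u = r ^+ 2 * \sum_u \sum_(b | (b, u) \in F) sh u.
    rewrite mulr_sumr; apply: eq_bigr => u _; rewrite -syE -mulrA mulr_suml.
    by congr (_ * _); apply: eq_bigr => b _; rewrite mul1r.
  congr (_ * _); under eq_bigr do rewrite big_mkcond.
  under [in RHS]eq_bigr do rewrite big_mkcond.
  by rewrite exchange_big.
(* Bounding each summand alone gives order [r ^ 2] only. The third order comes from the mean degree
   in [F], which is of order [r ^ 2] after scaling although single degrees are of order [r]. *)
have prodsum (x y : 'I_n -> R) : (forall i, 0 <= x i) -> r ^+ 2 * \sum_i x i = sX ->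
    (forall i, bnd 2 1 (y i)) -> bnd 4 3 (r ^+ 2 * \sum_i x i * y i).
  move=> x0 xX hy; rewrite /bounded normrM (ger0_norm (ltW r20)).
  apply: (@le_trans _ _ (r ^+ 2 * \sum_i x i * (q ^+ 2 * r ^+ 1))).
    apply: ler_wpM2l; first exact: ltW.
    apply: (le_trans (ler_norm_sum _ _ _)); apply: ler_sum => i _.
    by rewrite normrM (ger0_norm (x0 i)); apply: ler_wpM2l => //; exact: hy.
  rewrite -mulr_suml mulrA xX.
  have -> : q ^+ 4 * r ^+ 3 = (q ^+ 2 * r ^+ 2) * (q ^+ 2 * r ^+ 1) by ring.
  apply: ler_wpM2r; first exact: ltW (qr_pos q2 r0 _ _).
  by apply: le_trans b5; exact: ler_norm.
have be1 : bnd 5 3 e1.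
  have -> : e1 = r ^+ 2 * (\sum_b sx b * sd b) + r ^+ 2 * \sum_u sy u * sh u.
    by rewrite -zsum /e1 sumRD mulrDr.
  have g1 : bnd 4 3 (r ^+ 2 * \sum_b sx b * sd b).
    apply: prodsum => //; first by move=> i; rewrite mulr_ge0 // ltW.
    exact: sum_sx.
  have g2 : bnd 4 3 (r ^+ 2 * \sum_b sy b * sh b).
    apply: prodsum => //; first by move=> i; rewrite mulr_ge0 // ltW.
    by rewrite /scaled_in -mulr_sumr (card_arcs_in R F) /scaled_arcs; ring.
  bnda.
have be2 : bnd 13 3 e2.
  have h : bnd 1 1 (r ^+ 2 * \sum_(b | (b, v) \in F) 1) by rewrite syE; exact: b3.
  have h2 u : bnd 12 2 ((1 - 2 * l) * sd u * sh v / L + sx u * sd u + zeta u) by bnda.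
  exact: bnd_sum_on h h2.
pose Z : R := sh v * sy v ^+ 2 + sy v * omega v - sy v * l * sX
   - (1 - 2 * l) * sh v / L * (l * sX) - e1 + e2.
have bZ : bnd 20 3 Z by rewrite /Z; bnda.
have cnt : (#|[set G in Om | (a, v) \in G]|)%:R = Ex (ind (a, v)) :> R.
  rewrite -sum1_card natr_sum /ens_sum.
  rewrite (eq_bigl (fun G => (G \in Om) && ((a, v) \in G))); last by move=> G; rewrite inE.
  by rewrite big_mkcondr /=; apply: eq_bigr => G _; rewrite /arc_ind; case: (_ \in _).
rewrite cnt; set X := Ex (ind (a, v)) - _.
have key : M * X = r ^+ 2 * (A - B * W) + Z * W.
  have x1 : M * Ex (ind (a, v)) = r ^+ 2 * A + r ^+ 2 * (t v)%:R * W.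
    by rewrite /W -Ex1 /A -!ExZ -ExD; apply: eq_Ex => G _; rewrite /M; ring.
  have x2 : r ^+ 2 * B = M * row_term v a - r ^+ 2 * \sum_(b | (b, v) \notin F :|: set0) row_term v b.
    by rewrite /B /M; ring.
  rewrite /X mulrBr x1 mulrBr (mulrA (r ^+ 2) B) x2 SE scaled_t ME /second_prob /Z; ring.
have k1 : M * `|X| <= (q ^+ 52 * r ^+ 3 + q ^+ 20 * r ^+ 3) * W.
  have M0 : 0 <= M by lra.
  rewrite -{1}(ger0_norm M0) -normrM key; apply: (le_trans (ler_normD _ _)).
  rewrite [leRHS]mulrDl; apply: lerD; last by rewrite normrM (ger0_norm W0); apply: ler_wpM2r.
  rewrite normrM (ger0_norm (ltW r20)).
  apply: (@le_trans _ _ (r ^+ 2 * (N * (q ^+ 52 * r ^+ 3) * W))).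
    by apply: ler_wpM2l; first exact: ltW.
  have -> : r ^+ 2 * (N * (q ^+ 52 * r ^+ 3) * W) = q ^+ 52 * (N * r ^+ 2) * r ^+ 3 * W by ring.
  by rewrite (nice_n Hn) mulr1.
have k2 : 2^-1 * `|X| <= (q ^+ 52 * r ^+ 3 + q ^+ 20 * r ^+ 3) * W.
  by apply: le_trans k1; apply: ler_wpM2r.
have rW : 0 <= r ^+ 3 * W by rewrite mulr_ge0 // exprn_ge0 // ltW.
have m1 : q ^+ 20 * (r ^+ 3 * W) <= q ^+ 52 * (r ^+ 3 * W).
  by apply: ler_wpM2r => //; rewrite ler_weXn2l //; lra.
have -> : q ^+ 55 * r ^+ 3 * W = q ^+ 3 * (q ^+ 52 * (r ^+ 3 * W)) by rewrite (exprD _ 3 52); ring.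
have m3 : 8 * (q ^+ 52 * (r ^+ 3 * W)) <= q ^+ 3 * (q ^+ 52 * (r ^+ 3 * W)).
  apply: ler_wpM2r; first by rewrite mulr_ge0 // exprn_ge0 //; lra.
  by apply: le_trans (pow2q Hn 3); rewrite ler_nat.
have : 0 <= q ^+ 52 * (r ^+ 3 * W) by rewrite mulr_ge0 // exprn_ge0 //; lra.
lra.
Qed.

End SecondOrder.

(** * Forbidding one more arc *)

Section Log.
Variable R : realType.
Implicit Types x y z : R.

(** The second-order Taylor remainder of [ln] at [1]. Its derivative is the single term
    [(1 - z) ^ 2 / z], so one use of the mean value theorem gives a cubic bound. *)
Definition lnrem (z : R) : R := ln z + ((1 - z) + 2^-1 * (1 - z) ^+ 2).

Lemma is_derive_lnrem x : 0 < x -> is_derive x 1 lnrem ((1 - x) ^+ 2 / x).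
Proof.
move=> x0; have d1 := is_derive1_ln x0.
have d2 : is_derive x 1 (fun z : R => 1 - z) (- 1).
  by apply: is_derive_eq; ring.
have d3 : is_derive x 1 (fun z : R => (1 - z) + 2^-1 * (1 - z) ^+ 2) (- 1 + 2^-1 * ((1 - x) * (-1) *+ 2)).
  apply: is_derive_eq. rewrite /= /GRing.scale /=; ring.
apply: is_derive_eq.
have x0' : x != 0 by rewrite gt_eqF.
by rewrite /=; field.
Qed.

Lemma ln_taylor2 y : `|y| <= 2^-1 -> `|ln (1 - y) + y + y ^+ 2 / 2| <= 2 * `|y| ^+ 3.
Proof.
rewrite ler_norml => /andP[yl yu].
have -> : ln (1 - y) + y + y ^+ 2 / 2 = lnrem (1 - y) - lnrem 1.
  by rewrite /lnrem ln1; field.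
have bound c : 2^-1 <= c -> `|1 - c| <= `|y| ->
    `|(1 - c) ^+ 2 / c * y| <= 2 * `|y| ^+ 3.
  move=> c2 cy; have c0 : 0 < c by lra.
  rewrite normrM (exprSr _ 2) mulrA; apply: ler_wpM2r => //.
  rewrite normrM normrX mulrC; apply: ler_pM => //; rewrite ?exprn_ge0 //.
    rewrite ger0_norm ?invr_ge0 ?(ltW c0) // -[2]invrK lef_pV2 ?posrE ?invr_gt0 //.
  by apply: lerXn2r.
have mvt a b : 0 < a -> a <= b -> exists2 c, a <= c <= b &
    lnrem b - lnrem a = (1 - c) ^+ 2 / c * (b - a).
  move=> a0 ab.
  have m2 x : x \in `]a, b[%R -> is_derive x 1 lnrem ((1 - x) ^+ 2 / x).
    by rewrite in_itv /= => /andP[h _]; apply: is_derive_lnrem; lra.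
  have [|c] := MVT_segment ab m2; last by rewrite in_itv /= => ? ?; exists c.
  apply: derivable_within_continuous => x; rewrite in_itv /= => /andP[h _].
  by have [] : is_derive x 1 lnrem ((1 - x) ^+ 2 / x) by apply: is_derive_lnrem; lra.
have [y0|y0] := leP 0 y.
  have [||c /andP[c1 c2] e] := @mvt (1 - y) 1; [lra | lra |].
  rewrite -normrN opprB e (_ : 1 - (1 - y) = y); last by ring.
  by apply: bound; [lra | rewrite !ger0_norm //; lra].
have [||c /andP[c1 c2] e] := @mvt 1 (1 - y); [lra | lra |].
rewrite e (_ : 1 - y - 1 = - y); last by ring.
rewrite mulrN normrN; apply: bound; first by lra.
by rewrite -normrN opprB ger0_norm ?ltr0_norm //; lra.
Qed.
End Log.

Definition loops n : digraph n := [set e | e.1 == e.2].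

(** * The increment of the potential *)

Section AddArc.
Variables (n : nat) (H : digraph n) (j k : 'I_n).
Hypothesis jkH : (j, k) \notin H.

Lemma in_addarc i w : ((i, w) \in (j, k) |: H) = (((i == j) && (w == k)) + ((i, w) \in H))%N :> nat.
Proof.
rewrite !inE xpair_eqE; case: eqP => [->|_] //=; case: eqP => [->|_] //=.
by rewrite (negbTE jkH).
Qed.

Lemma outdeg_addarc i : outdeg ((j, k) |: H) i = (outdeg H i + (i == j))%N.
Proof.
rewrite !outdeg_sum; under eq_bigr do rewrite in_addarc.
rewrite big_split /= addnC; congr (_ + _)%N.
rewrite (bigD1 k) //= eqxx andbT big1 ?addn0 // => w /negbTE ->.
by rewrite andbF.
Qed.

Lemma indeg_addarc w : indeg ((j, k) |: H) w = (indeg H w + (w == k))%N.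
Proof.
rewrite !indeg_sum; under eq_bigr do rewrite in_addarc.
rewrite big_split /= addnC; congr (_ + _)%N.
by rewrite (bigD1 j) //= eqxx big1 ?addn0 // => i /negbTE ->.
Qed.

Variables (R : realType) (s t : 'I_n -> nat).
Local Notation l := (lam R s).

Lemma xdeg_addarc i : xdeg R ((j, k) |: H) i = xdeg R H i + (i == j)%:R.
Proof. by rewrite /xdeg outdeg_addarc natrD. Qed.

Lemma ydeg_addarc i : ydeg R ((j, k) |: H) i = ydeg R H i + (i == k)%:R.
Proof. by rewrite /ydeg indeg_addarc natrD. Qed.

Lemma delta_addarc i : delta R s ((j, k) |: H) i = delta R s H i + l * (i == j)%:R.
Proof. by rewrite /delta xdeg_addarc; ring. Qed.

Lemma eta_addarc i : Defs.eta R s t ((j, k) |: H) i = Defs.eta R s t H i + l * (i == k)%:R.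
Proof. by rewrite /Defs.eta ydeg_addarc; ring. Qed.

Lemma Rsum_addarc h m : Rsum R s ((j, k) |: H) h m = Rsum R s H h m
  + ((delta R s H j + l) ^+ h * (xdeg R H j + 1) ^+ m - delta R s H j ^+ h * xdeg R H j ^+ m).
Proof.
rewrite /Rsum (bigD1 j) //= [in RHS](bigD1 j) //= delta_addarc xdeg_addarc eqxx mulr1.
rewrite (eq_bigr (fun i => delta R s H i ^+ h * xdeg R H i ^+ m)); last first.
  by move=> i /negbTE ij; rewrite delta_addarc xdeg_addarc ij mulr0 !addr0.
by rewrite /=; ring.
Qed.

Lemma Csum_addarc h m : Csum R s t ((j, k) |: H) h m = Csum R s t H h m
  + ((Defs.eta R s t H k + l) ^+ h * (ydeg R H k + 1) ^+ m - Defs.eta R s t H k ^+ h * ydeg R H k ^+ m).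
Proof.
rewrite /Csum (bigD1 k) //= [in RHS](bigD1 k) //= eta_addarc ydeg_addarc eqxx mulr1.
rewrite (eq_bigr (fun i => Defs.eta R s t H i ^+ h * ydeg R H i ^+ m)); last first.
  by move=> i /negbTE ij; rewrite eta_addarc ydeg_addarc ij mulr0 !addr0.
by rewrite /=; ring.
Qed.

Lemma sum_pairs (f : 'I_n * 'I_n -> R) : \sum_e f e = \sum_a \sum_b f (a, b).
Proof. by rewrite pair_big /=; apply: eq_bigr => -[]. Qed.

Definition Zsum a : R := \sum_(u | (a, u) \in H) Defs.eta R s t H u.
Definition Wsum v : R := \sum_(b | (b, v) \in H) delta R s H b.

(** A new arc raises [delta] at [j] and [eta] at [k] by [l], so besides its own term it changes
    those of all arcs leaving [j] or entering [k]. No arc of [H] does both, hence no cross term. *)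
Lemma Yq_addarc : Yq R s t ((j, k) |: H) =
  Yq R s t H + (delta R s H j + l) * (Defs.eta R s t H k + l) + l * Zsum j + l * Wsum k.
Proof.
rewrite /Yq big_setU1 //= delta_addarc eta_addarc !eqxx !mulr1.
have -> : \sum_(e in H) delta R s ((j, k) |: H) e.1 * Defs.eta R s t ((j, k) |: H) e.2 =
   \sum_(e in H) delta R s H e.1 * Defs.eta R s t H e.2 + l * Zsum j + l * Wsum k; last by ring.
have Zj : Zsum j = \sum_(e in H) (e.1 == j)%:R * Defs.eta R s t H e.2.
  rewrite /Zsum big_mkcond [RHS]big_mkcond /=.
  rewrite sum_pairs /=.
  rewrite [RHS](bigD1 j) //= [X in _ + X]big1 ?addr0.
    by apply: eq_bigr => u _; rewrite eqxx mul1r.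
  by move=> i /negbTE ij; rewrite big1 // => u _; rewrite ij mul0r if_same.
have Wk : Wsum k = \sum_(e in H) delta R s H e.1 * (e.2 == k)%:R.
  rewrite /Wsum big_mkcond [RHS]big_mkcond /=.
  rewrite sum_pairs /=.
  apply: eq_bigr => i _; rewrite (bigD1 k) //= eqxx mulr1 big1 ?addr0 //.
  by move=> u /negbTE uk; rewrite uk mulr0 if_same.
rewrite Zj Wk !mulr_sumr -!sumRD; apply: eq_bigr => -[a b] abH /=.
rewrite delta_addarc eta_addarc.
have [aj|aj] := eqVneq a j; have [bk|bk] := eqVneq b k; rewrite /=; try ring.
by move: abH jkH; rewrite aj bk => ->.
Qed.

(** An exact increment, sorted by size. The final bracket, where each term has a factor [1 / n]
    beside a scaled deviation, a scaled degree or another [1 / n], is of order [r ^ 3]; the rest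
    must equal the logarithm of one factor. *)
Lemma M_main_addarc (dj := delta R s H j) (ek := Defs.eta R s t H k) (x := xdeg R H j) (y := ydeg R H k)
    (N := n%:R : R) (X := Xarcs R H) : N != 0 -> l != 0 -> 1 - l != 0 ->
  M_main R s t ((j, k) |: H) - M_main R s t H =
  - ((dj + ek) / N) / (1 - l) + l * (X / N ^+ 2) / (1 - l)
  - (Zsum j / N ^+ 2 + Wsum k / N ^+ 2) / (1 - l)
  - (dj / N) * (ek / N) / (l * (1 - l))
  - ((dj / N) * (x / N) + (ek / N) * (y / N)) / (1 - l)
  - ((dj / N) ^+ 2 + (ek / N) ^+ 2) / (2 * (1 - l) ^+ 2)
  + (l / (2 * (1 - l)) * N^-1 ^+ 2
     - (l * N^-1 * (dj / N + ek / N) + l ^+ 2 * N^-1 ^+ 2) / (l * (1 - l))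
     + l * (1 - 2 * l) * (3 * N^-1 * (x / N + y / N) + 2 * N^-1 ^+ 2) / (6 * (1 - l) ^+ 2)
     - (1 - 2 * l) * ((dj / N + ek / N) * N^-1 + 2 * l * (x / N + y / N) * N^-1 + 2 * l * N^-1 ^+ 2)
        / (2 * (1 - l) ^+ 2)
     - (2 * l * (dj / N + ek / N) * N^-1 + l ^+ 2 * (x / N + y / N) * N^-1 + 2 * l ^+ 2 * N^-1 ^+ 2)
        / (2 * (1 - l) ^+ 2)).
Proof.
move=> N0 l0 l1.
have XX : Xarcs R ((j, k) |: H) = X + 1 by rewrite /Xarcs cardsU1 jkH natrD addrC.
rewrite /M_main /RC XX !Rsum_addarc !Csum_addarc Yq_addarc -/X -/dj -/ek -/x -/y -/N.
field; by rewrite N0 l0 l1.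
Qed.

End AddArc.

(** * The logarithm of one factor *)

Section LogStep.
Variables (R : realType) (q r l : R) (n : nat) (s t : 'I_n -> nat) (F : digraph n).
Hypothesis Hn : nice q r l s t F.
Local Notation bnd := (bounded q r).
Local Notation L := (l * (1 - l)).
Local Notation p := (l / (1 - r ^+ 2)).

Let q2 := nice_q Hn.
Let r0 := nice_r Hn.
Let r1 := proj2 (nice_r_small Hn).
Ltac bnda := bnd_auto q2 r0 r1.

Lemma bnd_1lV : bnd 1 0 (1 - l)^-1.
Proof.
have h1 := bnd_Linv Hn; have h2 := bnd_l Hn.
have L0 := L_gt0 Hn.
have l0 : l != 0 by apply: contraTneq L0 => ->; rewrite mul0r ltxx.
have -> : (1 - l)^-1 = l * L^-1 by rewrite invfM mulrA divff // mul1r.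
bnda.
Qed.

Lemma bnd_lV : bnd 2 0 l^-1.
Proof.
have h1 := bnd_Linv Hn; have h2 := bnd_l Hn.
have L0 := L_gt0 Hn.
have l0 : 1 - l != 0 by apply: contraTneq L0 => ->; rewrite mulr0 ltxx.
have -> : l^-1 = (1 - l) * L^-1 by rewrite invfM mulrCA divff // mulr1.
bnda.
Qed.

Lemma r2_small : r ^+ 2 <= L / 8.
Proof.
have h := @pow_q_small _ _ _ _ _ _ _ _ Hn 1 3 8 isT (ler0n R 8) (pow2q Hn 3).
have L0 := L_gt0 Hn; have LL := nice_L Hn; have q0 : 0 < q by have := q2; lra.
have h2 : r ^+ 2 <= r by rewrite expr2 ler_piMr // ltW.
rewrite expr1 in h; apply: le_trans h2 _.
rewrite -(ler_pM2l q0); lra.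
Qed.

Lemma p_lt1 : 0 < 1 - p.
Proof.
have h := r2_small; have L1 := L_le l; have L0 := L_gt0 Hn.
have l1 := nice_l1 Hn; have l0 := nice_l0 Hn.
have Ll2 : L <= 1 - l by rewrite ler_piMl //; lra.
have e : 0 < 1 - r ^+ 2 by lra.
by rewrite subr_gt0 ltr_pdivrMr //; lra.
Qed.

Lemma bnd_1pV : bnd 4 0 (1 - p)^-1.
Proof.
have h := r2_small; have L1 := L_le l; have L0 := L_gt0 Hn.
have l1 := nice_l1 Hn; have l0 := nice_l0 Hn.
have Ll2 : L <= 1 - l by rewrite ler_piMl //; lra.
have e : 0 < 1 - r ^+ 2 by lra.
have b1 : bnd 2 0 (1 - l - r ^+ 2)^-1.
  apply: (@bnd_inv_ge R q r _ (L / 2)); [by rewrite divr_gt0 | by lra |].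
  have := bnd_Linv Hn; rewrite /bounded expr0 mulr1 expr1 ger0_norm ?invr_ge0 ?(ltW L0) // => g.
  by rewrite invf_div expr2 mulrC; apply: ler_pM => //; rewrite ?invr_ge0 ?(ltW L0).
have -> : (1 - p)^-1 = (1 - r ^+ 2) * (1 - l - r ^+ 2)^-1.
  by field; rewrite !gt_eqF //; lra.
bnda.
Qed.

Lemma bnd_1r2V : bnd 1 0 (1 - r ^+ 2)^-1.
Proof.
have h := r2_small; have L1 := L_le l.
apply: (@bnd_inv_ge R q r _ 2^-1); [by rewrite invr_gt0 | by lra |].
by rewrite invrK expr1.
Qed.

(* [A + B] approximates [P - p] to second order, [A] being its first order part,
   and [G] approximates the logarithm of [(1 - P) / (1 - p)]. *)
Lemma log_expansion (d h x y z w X P e : R) (A := d + h)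
    (B := (1 - 2 * l) * d * h / L + (x * d + y * h + z + w - l * X))
    (G := - (d + h) / (1 - l) + l * X / (1 - l) - (z + w) / (1 - l) - d * h / L
       - (d * x + h * y) / (1 - l) - (d ^+ 2 + h ^+ 2) / (2 * (1 - l) ^+ 2)) :
  bnd 4 1 d -> bnd 4 1 h -> bnd 4 1 x -> bnd 4 1 y -> bnd 6 2 z -> bnd 6 2 w -> bnd 4 2 X ->
  bnd 60 3 e -> P = p + A + B + e ->
  exists f, bnd 300 3 f /\ 1 - P = (1 - p) * expR (G + f).
Proof.
move=> bd bh bx by_ bz bw bX be PE.
have b1 := bnd_1lV; have b2 := bnd_1pV; have b3 := bnd_l Hn; have b4 := bnd_Linv Hn.
have p0 := p_lt1; have L0 := L_gt0 Hn.
have r2s := r2_small; have L1 := L_le l.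
have [l0 l1] : l != 0 /\ 1 - l != 0.
  by move: (lt0r_neq0 L0); rewrite mulf_eq0 negb_or => /andP.
have bA : bnd 5 1 A by rewrite /A; bnda.
have bB : bnd 19 2 B by rewrite /B; bnda.
pose Y : R := (A + B + e) * (1 - p)^-1.
have bY : bnd 66 1 Y by rewrite /Y; bnda.
have Yhalf : `|Y| <= 2^-1.
  have := @pow_q_small _ _ _ _ _ _ _ _ Hn 66 0 1 isT ler01 (lexx _).
  by rewrite mul1r; apply: le_trans; rewrite -[r]expr1; exact: bY.
(* The difference between [1 / (1 - p)] and [1 / (1 - l)]. It has order [r ^ 2] and multiplies terms
   of order [r], so [l] may replace [p] in the denominators. *)
pose v : R := l * r ^+ 2 * (1 - p)^-1 * (1 - r ^+ 2)^-1 * (1 - l)^-1.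
have b5 := bnd_1r2V.
have bv : bnd 12 2 v by rewrite /v; bnda.
have vE : (1 - p)^-1 = (1 - l)^-1 + v.
  have l1' := nice_l1 Hn; have l0' := nice_l0 Hn.
  have Ll2 : L <= 1 - l by rewrite ler_piMl //; lra.
  have c1 : 1 - l - r ^+ 2 != 0 by rewrite gt_eqF //; lra.
  have c2 : 1 - r ^+ 2 != 0 by rewrite gt_eqF //; lra.
  have -> : v = l * r ^+ 2 * ((1 - r ^+ 2) * (1 - l - r ^+ 2)^-1) * (1 - r ^+ 2)^-1 * (1 - l)^-1.
    by rewrite /v; field; rewrite c1 c2 l1.
  by field; rewrite c1 c2 l1.
pose e' : R := (A + B) * v + e * (1 - p)^-1.
have be' : bnd 70 3 e' by rewrite /e'; bnda.
pose be2 : R := B * (1 - l)^-1 + e'.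
have bbe : bnd 72 2 be2 by rewrite /be2; bnda.
have YE : Y = A * (1 - l)^-1 + be2 by rewrite /Y /be2 /e' !vE; ring.
have GE : - Y - Y ^+ 2 / 2 = G - e' - be2 * (2 * (A * (1 - l)^-1) + be2) / 2.
  have -> : G = - (A + B) * (1 - l)^-1 - (A * (1 - l)^-1) ^+ 2 / 2.
    by rewrite /G /A /B; field; rewrite l0 l1.
  rewrite YE /be2; field.
  by rewrite l1.
pose el : R := ln (1 - Y) + Y + Y ^+ 2 / 2.
have bel : bnd 200 3 el.
  have h3 : bnd 198 3 (Y ^+ 3) by bnda.
  have h4 : bnd 200 3 (2 * Y ^+ 3) by bnda.
  apply: le_trans (ln_taylor2 Yhalf) _.
  by move: h4; rewrite /bounded normrM normrX (ger0_norm (ler0n R 2)).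
exists (el - e' - be2 * (2 * (A * (1 - l)^-1) + be2) / 2); split; first by bnda.
have -> : G + (el - e' - be2 * (2 * (A * (1 - l)^-1) + be2) / 2) = ln (1 - Y).
  have -> : forall a b c : R, G + (a - b - c) = (G - b - c) + a by move=> *; ring.
  rewrite -GE /el; ring.
rewrite lnK; last by rewrite posrE; move: Yhalf; rewrite ler_norml; lra.
rewrite PE /Y mulrBr mulr1 mulrCA divff ?mulr1; last by rewrite gt_eqF.
ring.
Qed.

End LogStep.

Lemma simple_notin n (H : digraph n) i : simple_digraph H -> (i, i) \notin H.
Proof. by move/forallP. Qed.

Lemma outdeg_loops n (H : digraph n) i : simple_digraph H ->
  outdeg (H :|: loops n) i = (outdeg H i + 1)%N.
Proof.
move=> sH; rewrite !outdeg_sum.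
have <- : (\sum_k (k == i) = 1)%N by rewrite (bigD1 i) //= eqxx big1 ?addn0 // => k /negbTE ->.
rewrite -big_split /=; apply: eq_bigr => k _; rewrite !inE /= (eq_sym k).
by case: eqP => [<-|_]; rewrite ?orbF ?addn0 // orbT (negbTE (simple_notin i sH)).
Qed.

Lemma indeg_loops n (H : digraph n) i : simple_digraph H ->
  indeg (H :|: loops n) i = (indeg H i + 1)%N.
Proof.
move=> sH; rewrite !indeg_sum.
have <- : (\sum_k (k == i) = 1)%N by rewrite (bigD1 i) //= eqxx big1 ?addn0 // => k /negbTE ->.
rewrite -big_split /=; apply: eq_bigr => k _; rewrite !inE /=.
by case: eqP => [->|_]; rewrite ?orbF ?addn0 // orbT (negbTE (simple_notin i sH)).
Qed.

Lemma card_loops n (H : digraph n) : simple_digraph H -> (#|H :|: loops n| = #|H| + n)%N.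
Proof.
move=> sH.
have cl : #|loops n| = n.
  rewrite -[RHS]card_ord -(card_imset (f := fun i : 'I_n => (i, i))); last by move=> x y [].
  apply: eq_card => -[a b]; rewrite !inE /=; apply/eqP/imsetP => [->|[i _ [-> ->]] //].
  by exists b.
rewrite cardsU (_ : H :&: loops n = set0) ?cards0 ?subn0 ?cl //.
apply/setP => -[a b]; rewrite !inE /=; case: eqP => [->|_]; last by rewrite andbF.
by rewrite (negbTE (simple_notin b sH)).
Qed.

Lemma disjoint_addarc n (G : digraph n) e (H D : digraph n) :
  [disjoint G & (e |: H) :|: D] = (e \notin G) && [disjoint G & H :|: D].
Proof.
rewrite -setUA ![[disjoint G & _]]disjoint_sym -disjointU1.
by apply: eq_disjoint => x; rewrite -[RHS]/((x == e) || (x \in H :|: D)) !inE.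
Qed.

Section Step.
Variables (R : realType) (q r : R) (n : nat) (s t : 'I_n -> nat) (H : digraph n).
Variables (j k : 'I_n).
Local Notation l := (lam R s).
Local Notation F := (H :|: loops n).
Local Notation bnd := (bounded q r).
Local Notation L := (l * (1 - l)).
Local Notation N := (n%:R : R).
Hypothesis sH : simple_digraph H.
Hypothesis Hn : nice q r l s t F.
Hypothesis jkH : (j, k) \notin H.
Hypothesis jk : j != k.

Let q2 := nice_q Hn.
Let r0 := nice_r Hn.
Let r1 := proj2 (nice_r_small Hn).
Ltac bnda := bnd_auto q2 r0 r1.

Lemma N_neq0 : N != 0.
Proof. by apply: contra_eq_neq (nice_n Hn) => ->; rewrite mul0r eq_sym oner_eq0. Qed.

Lemma inv_n_as_r : N^-1 = r ^+ 2.
Proof. by rewrite (n_as_r Hn) invrK. Qed.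

Lemma savgE : savg R s = l * N.
Proof. by rewrite /lam divfK // N_neq0. Qed.

Lemma sdE a : scaled_delta r l s F a = delta R s H a / N + l * r ^+ 2.
Proof.
rewrite /scaled_delta outdeg_loops // natrD /delta savgE /xdeg inv_n_as_r; ring.
Qed.

Lemma shE a : scaled_eta r l t F a = Defs.eta R s t H a / N + l * r ^+ 2.
Proof.
rewrite /scaled_eta indeg_loops // natrD /Defs.eta savgE /ydeg inv_n_as_r; ring.
Qed.

Lemma sxE' a : scaled_out r F a = xdeg R H a / N + r ^+ 2.
Proof. rewrite /scaled_out outdeg_loops // natrD /xdeg inv_n_as_r; ring. Qed.

Lemma syE' a : scaled_in r F a = ydeg R H a / N + r ^+ 2.
Proof. rewrite /scaled_in indeg_loops // natrD /ydeg inv_n_as_r; ring. Qed.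

Lemma sXE : scaled_arcs r F = Xarcs R H / N ^+ 2 + r ^+ 2.
Proof.
rewrite /scaled_arcs card_loops // natrD /Xarcs -exprVn inv_n_as_r.
have -> : r ^+ 4 * ((#|H|)%:R + N) = (#|H|)%:R * (r ^+ 2) ^+ 2 + (N * r ^+ 2) * r ^+ 2 by ring.
by rewrite (nice_n Hn) mul1r.
Qed.

Lemma sum_loops_row a (f : 'I_n -> R) :
  \sum_(u | (a, u) \in F) f u = \sum_(u | (a, u) \in H) f u + f a.
Proof.
rewrite (bigD1 a) /=; last by rewrite !inE eqxx orbT.
rewrite addrC; congr (_ + _); apply: eq_bigl => u; rewrite !inE /= (eq_sym u).
by case: eqP => [<-|_]; rewrite ?orbF ?andbT // andbF (negbTE (simple_notin a sH)).
Qed.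

Lemma sum_loops_col a (f : 'I_n -> R) :
  \sum_(u | (u, a) \in F) f u = \sum_(u | (u, a) \in H) f u + f a.
Proof.
rewrite (bigD1 a) /=; last by rewrite !inE eqxx orbT.
rewrite addrC; congr (_ + _); apply: eq_bigl => u; rewrite !inE /=.
by case: eqP => [->|_]; rewrite ?orbF ?andbT // andbF (negbTE (simple_notin a sH)).
Qed.

Lemma zetaE a : zeta r l t F a =
  Zsum H R s t a / N ^+ 2 + l * r ^+ 2 * (xdeg R H a / N) + r ^+ 2 * scaled_eta r l t F a.
Proof.
rewrite /zeta sum_loops_row mulrDr; congr (_ + _).
rewrite (eq_bigr (fun u => N^-1 * Defs.eta R s t H u + l * r ^+ 2 * 1)); last first.
  by move=> u _; rewrite shE; ring.
rewrite sumRD !sumRZ -/(Zsum H R s t a).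
have -> : \sum_(u | (a, u) \in H) 1 = xdeg R H a.
  rewrite /xdeg outdeg_sum natr_sum big_mkcond /=; apply: eq_bigr => u _.
  by case: (_ \in _).
by rewrite -inv_n_as_r; field; exact: N_neq0.
Qed.

Lemma omegaE a : omega r l s F a =
  Wsum H R s a / N ^+ 2 + l * r ^+ 2 * (ydeg R H a / N) + r ^+ 2 * scaled_delta r l s F a.
Proof.
rewrite /omega sum_loops_col mulrDr; congr (_ + _).
rewrite (eq_bigr (fun u => N^-1 * delta R s H u + l * r ^+ 2 * 1)); last first.
  by move=> u _; rewrite sdE; ring.
rewrite sumRD !sumRZ -/(Wsum H R s a).
have -> : \sum_(u | (u, a) \in H) 1 = ydeg R H a.
  rewrite /ydeg indeg_sum natr_sum big_mkcond /=; apply: eq_bigr => u _.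
  by case: (_ \in _).
by rewrite -inv_n_as_r; field; exact: N_neq0.
Qed.

Lemma pqE : pq R s = l / (1 - r ^+ 2).
Proof.
have N0 := N_neq0.
have e : 1 - r ^+ 2 = (N - 1) / N by rewrite -inv_n_as_r; field.
by rewrite /pq savgE e invf_div mulrA.
Qed.

Lemma Om_addarc : (#|ensemble s t (((j, k) |: H) :|: loops n)|)%:R =
  (#|ensemble s t F|)%:R - (#|[set G in ensemble s t F | (j, k) \in G]|)%:R :> R.
Proof.
apply/eqP; rewrite eq_sym subr_eq -natrD eqr_nat; apply/eqP.
rewrite -(cardsID [set G : digraph n | (j, k) \in G] (ensemble s t F)) addnC; congr (_ + _)%N.
  apply: eq_card => G; rewrite !inE; rewrite disjoint_addarc; case: ((j, k) \in G) => /=.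
    by [].
  by [].
by apply: eq_card => G; rewrite !inE.
Qed.

Lemma arc_step : exists f : R, bnd 310 3 f /\
  (#|ensemble s t (((j, k) |: H) :|: loops n)|)%:R =
  (#|ensemble s t F|)%:R * ((1 - pq R s) * expR (M_main R s t ((j, k) |: H) - M_main R s t H + f)) :> R.
Proof.
rewrite Om_addarc; set W := (#|ensemble s t F|)%:R; set c := (#|_|)%:R.
have W0 : 0 <= W :> R by [].
have cW : 0 <= c <= W.
  rewrite /c /W ler_nat ler0n /=; apply: subset_leq_card; apply/subsetP => G.
  by rewrite inE => /andP[].
(* If no digraph avoids [F], both counts vanish; the induction can thus run through an empty
   ensemble. *)
have [Wz|Wn] := eqVneq W 0.
  exists 0; split; first exact: bnd0.
  by move: cW; rewrite Wz => cW; rewrite mul0r; lra.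
have jkF : (j, k) \notin F by rewrite !inE negb_or jkH.
have Wpos : 0 < W by rewrite lt_neqAle eq_sym Wn.
have := arc_count Hn jkF; rewrite -/W -/c => hc.
have b0 := bnd_sd Hn; have b1 := bnd_sh Hn; have b2 := bnd_sx Hn; have b3 := bnd_sy Hn.
have b4 := bnd_sX Hn; have b5 := bnd_zeta Hn; have b6 := bnd_omega Hn; have b7 := bnd_l Hn.
have b8 := bnd_Linv Hn; have b9 := bnd_1lV Hn; have b10 := bnd_1r2V Hn; have b11 := bnd_lV Hn.
set d := delta R s H j / N; set h := Defs.eta R s t H k / N.
set x := xdeg R H j / N; set y := ydeg R H k / N.
set z := Zsum H R s t j / N ^+ 2; set w := Wsum H R s k / N ^+ 2.
set X := Xarcs R H / N ^+ 2.
have bd : bnd 4 1 d by have -> : d = scaled_delta r l s F j - l * r ^+ 2 by [rewrite sdE /d; ring]; bnda.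
have bh : bnd 4 1 h by have -> : h = scaled_eta r l t F k - l * r ^+ 2 by [rewrite shE /h; ring]; bnda.
have bx : bnd 4 1 x by have -> : x = scaled_out r F j - r ^+ 2 by [rewrite sxE' /x; ring]; bnda.
have by_ : bnd 4 1 y by have -> : y = scaled_in r F k - r ^+ 2 by [rewrite syE' /y; ring]; bnda.
have bX : bnd 4 2 X by have -> : X = scaled_arcs r F - r ^+ 2 by [rewrite sXE /X; ring]; bnda.
have bz : bnd 6 2 z.
  have -> : z = zeta r l t F j - (l * r ^+ 2 * x + r ^+ 2 * scaled_eta r l t F j) by rewrite zetaE /z /x; ring.
  bnda.
have bw : bnd 6 2 w.
  have -> : w = omega r l s F k - (l * r ^+ 2 * y + r ^+ 2 * scaled_delta r l s F k) by rewrite omegaE /w /y; ring.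
  bnda.
pose e1 : R := c / W - second_prob r l s t F j k.
have be1 : bnd 55 3 e1.
  have -> : e1 = (c - second_prob r l s t F j k * W) / W by rewrite /e1 mulrBl mulfK.
  by rewrite /bounded normrM normfV (gtr0_norm Wpos) ler_pdivrMr.
(* [F] contains the loops, which shift [d] and [h] by [l / n] each and [X] by [1 / n]. The net
   first-order shift [l / n] turns [l] into [p = l / (1 - 1 / n)] up to [l r ^ 4 / (1 - r ^ 2)], the
   last term here; the other shifts have order [r ^ 3]. *)
pose e2 : R := (1 - 2 * l) * (l * r ^+ 2 * (d + h) + l ^+ 2 * r ^+ 4) * L^-1
   + (l * r ^+ 2 * x + r ^+ 2 * d + l * r ^+ 4) + l * r ^+ 2 * x + r ^+ 2 * scaled_eta r l t F j
   + (h * r ^+ 2 + l * r ^+ 2 * y + l * r ^+ 4) + l * r ^+ 2 * y + r ^+ 2 * scaled_delta r l s F k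
   - l * r ^+ 4 * (1 - r ^+ 2)^-1.
have be2 : bnd 30 3 e2 by rewrite /e2; bnda.
have c2 : 1 - r ^+ 2 != 0.
  have := r2_small Hn; have := L_le l => g1 g2; rewrite gt_eqF //; lra.
have PE : c / W = l / (1 - r ^+ 2) + (d + h) +
   ((1 - 2 * l) * d * h / L + (x * d + y * h + z + w - l * X)) + (e1 + e2).
  have -> : c / W = e1 + second_prob r l s t F j k by rewrite /e1; ring.
  rewrite /second_prob /row_term zetaE omegaE sXE -/z -/w -/X -/x -/y.
  rewrite (sdE j) (shE k) (sxE' j) (syE' k) -/d -/h -/x -/y /e2.
  have L0' := L_gt0 Hn.
  have [l0' l1'] : l != 0 /\ 1 - l != 0.
    by move: (lt0r_neq0 L0'); rewrite mulf_eq0 negb_or => /andP.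
  by move: (scaled_eta r l t F j) (scaled_delta r l s F k) => u1 u2; field; rewrite c2 l0' l1'.
have be : bnd 60 3 (e1 + e2) by bnda.
have [f0 [bf0 f0E]] := log_expansion Hn bd bh bx by_ bz bw bX be PE.
have L0 := L_gt0 Hn.
have [l0 l1] : l != 0 /\ 1 - l != 0.
  by move: (lt0r_neq0 L0); rewrite mulf_eq0 negb_or => /andP.
have := M_main_addarc jkH t N_neq0 l0 l1; rewrite -/d -/h -/x -/y -/z -/w -/X inv_n_as_r.
set err := (X in _ = _ + X -> _); set G := (X in _ = X + err -> _) => ME.
exists (f0 - err); split.
  have i1 : bnd 2 0 (2 * (1 - l))^-1 by rewrite invfM; bnda.
  have i2 : bnd 2 0 (2 * (1 - l) ^+ 2)^-1 by rewrite invfM -exprVn; bnda.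
  have i3 : bnd 2 0 (6 * (1 - l) ^+ 2)^-1 by rewrite invfM -exprVn; bnda.
  have berr : bnd 40 3 err by rewrite /err; bnda.
  bnda.
rewrite ME pqE.
have -> : W - c = W * (1 - c / W) by field.
by rewrite f0E; congr (_ * (_ * expR _)); rewrite /G /d /h inv_n_as_r; ring.
Qed.

End Step.

(** * The probability of avoiding H *)

Lemma outdeg_sub n (H H' : digraph n) i : H' \subset H -> (outdeg H' i <= outdeg H i)%N.
Proof.
by move=> /subsetP sub; apply: subset_leq_card; apply/subsetP => k; rewrite !inE => /sub.
Qed.

Lemma indeg_sub n (H H' : digraph n) i : H' \subset H -> (indeg H' i <= indeg H i)%N.
Proof.
by move=> /subsetP sub; apply: subset_leq_card; apply/subsetP => k; rewrite !inE => /sub.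
Qed.

Lemma nice_sub (R : realType) (q r l : R) n (s t : 'I_n -> nat) (F F' : digraph n) :
  F' \subset F -> nice q r l s t F -> nice q r l s t F'.
Proof.
move=> sub [? ? ? ? ? ? ? ? ? hx hy hX ? ?]; split => //.
- by move=> j; apply: le_trans (hx j); rewrite ler_nat outdeg_sub.
- by move=> j; apply: le_trans (hy j); rewrite ler_nat indeg_sub.
- by apply: le_trans hX; rewrite ler_nat subset_leq_card.
Qed.

Lemma disjoint_loops n (G : digraph n) : [disjoint G & loops n] = simple_digraph G.
Proof.
apply/pred0P/forallP => [h j|h [a b]] /=.
  by have := h (j, j); rewrite /= !inE eqxx andbT => ->.
rewrite !inE /=; case: eqP => [->|_]; last by rewrite andbF.
by rewrite (negbTE (h b)).
Qed.

Lemma disjointUr n (G H D : digraph n) : [disjoint G & H :|: D] = [disjoint G & H] && [disjoint G & D].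
Proof.
rewrite ![[disjoint G & _]]disjoint_sym -disjointU.
by apply: eq_disjoint => x; rewrite -[RHS]/((x \in H) || (x \in D)) inE.
Qed.

Lemma Om_loops n (s t : 'I_n -> nat) : ensemble s t (loops n) = Dst s t.
Proof. by apply/setP => G; rewrite !inE disjoint_loops. Qed.

Lemma Om_disjoint n (s t : 'I_n -> nat) (H : digraph n) :
  ensemble s t (H :|: loops n) = [set G in Dst s t | [disjoint G & H]].
Proof.
apply/setP => G; rewrite !inE disjointUr disjoint_loops.
by case: [disjoint G & H]; case: (simple_digraph G); rewrite ?andbT ?andbF.
Qed.

Lemma deg0 n (i : 'I_n) : outdeg set0 i = 0%N /\ indeg set0 i = 0%N.
Proof. by split; apply: eq_card0 => k; rewrite !inE. Qed.

Lemma M_main0 (R : realType) n (s t : 'I_n -> nat) : M_main R s t set0 = 0.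
Proof.
have x0 j : xdeg R (@set0 ('I_n * 'I_n)%type) j = 0 by rewrite /xdeg (proj1 (deg0 j)).
have y0 j : ydeg R (@set0 ('I_n * 'I_n)%type) j = 0 by rewrite /ydeg (proj2 (deg0 j)).
have rc h m : RC R s t set0 h m.+1 = 0.
  rewrite /RC /Rsum /Csum !big1 ?addr0 // => j _; first by rewrite y0 expr0n mulr0.
  by rewrite x0 expr0n mulr0.
rewrite /M_main !rc /Xarcs cards0 /Yq big_set0; ring.
Qed.

(** Induction over the arcs of [H]: the potential telescopes from [M_main0] and the errors add up.
    The hypotheses on [F] pass to subsets, so one [q] and [r] serve all steps. *)
Lemma disjoint_count (R : realType) (q r : R) n (s t : 'I_n -> nat) (H : digraph n) :
  simple_digraph H -> nice q r (lam R s) s t (H :|: loops n) ->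
  exists f : R, `|f| <= (#|H|)%:R * (q ^+ 310 * r ^+ 3) /\
  (#|ensemble s t (H :|: loops n)|)%:R =
  (#|ensemble s t (loops n)|)%:R * ((1 - pq R s) ^+ #|H| * expR (M_main R s t H + f)) :> R.
Proof.
elim: {H}#|H| {-2}H (erefl #|H|) => [|m IH] H cH sH Hn.
  exists 0; rewrite (cards0_eq cH) set0U M_main0 cards0 mul0r normr0 expr0 addr0 expR0 !mulr1.
  by split.
have [[j k] eH] : exists e, e \in H by apply/set0Pn; rewrite -card_gt0 cH.
pose H' := H :\ (j, k).
have cH' : #|H'| = m by move: cH; rewrite (cardsD1 (j, k)) eH add1n => -[].
have HE : H = (j, k) |: H' by rewrite setD1K.
have eH' : (j, k) \notin H' by rewrite !inE eqxx.
have sub : H' \subset H by exact: subD1set.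
have sH' : simple_digraph H'.
  by apply/forallP => i; apply: contra (simple_notin i sH); exact: (subsetP sub).
have Hn' : nice q r (lam R s) s t (H' :|: loops n) by apply: nice_sub Hn; exact: setSU.
have [f [fb fE]] := IH H' cH' sH' Hn'; rewrite cH' in fb fE; rewrite cH.
have jk : j != k by apply: contraTneq eH => ->; exact: simple_notin.
have [g [gb gE]] := arc_step sH' Hn' eH' jk.
exists (f + g); split.
  apply: (le_trans (ler_normD _ _)); rewrite -natr1 mulrDl mul1r.
  exact: lerD.
rewrite [in LHS]HE gE fE exprSr.
have -> : M_main R s t H + (f + g) = (M_main R s t H' + f) + (M_main R s t H - M_main R s t H' + g) by ring.
rewrite -HE [in RHS]expRD; ring.
Qed.

Theorem prob_disjoint_expansion (R : realType) (q r : R) n (s t : 'I_n -> nat) (H : digraph n) :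
  simple_digraph H -> nice q r (lam R s) s t (H :|: loops n) -> Dst s t != set0 ->
  exists f : R, `|f| <= q ^+ 312 * r /\
    prob_disjoint R s t H = (1 - pq R s) ^+ #|H| * expR (M_main R s t H + f).
Proof.
move=> sH Hn D0; have [f [fb fE]] := disjoint_count sH Hn.
exists f; split.
  (* At most [q ^ 2 n] arcs with error [q ^ 310 r ^ 3] each, and [n r ^ 2 = 1]. *)
  apply: le_trans fb _.
  have q2 := nice_q Hn; have r0 := nice_r Hn.
  have hX : (#|H|)%:R <= q ^+ 2 * n%:R.
    by apply: le_trans (nice_X Hn); rewrite ler_nat subset_leq_card // subsetUl.
  have c0 : 0 <= q ^+ 310 * r ^+ 3 by exact: ltW (qr_pos q2 r0 310 3).
  apply: (@le_trans _ _ (q ^+ 2 * n%:R * (q ^+ 310 * r ^+ 3))); first exact: ler_wpM2r.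
  have -> : q ^+ 2 * n%:R * (q ^+ 310 * r ^+ 3) = q ^+ 2 * q ^+ 310 * r * (n%:R * r ^+ 2).
    by move: (q ^+ 310) => x; ring.
  by rewrite (nice_n Hn) mulr1 -exprD.
have W0 : (#|Dst s t|)%:R != 0 :> R by rewrite pnatr_eq0 cards_eq0.
rewrite /prob_disjoint -Om_disjoint fE Om_loops; field.
exact: W0.
Qed.

(** * The probability of containing H *)

Section Complement.
Variable n : nat.
Implicit Types (G H : digraph n) (s t : 'I_n -> nat).

Definition codigraph G : digraph n := [set e | (e.1 != e.2) && (e \notin G)].

Lemma codigraph_simple G : simple_digraph (codigraph G).
Proof. by apply/forallP => i; rewrite !inE eqxx. Qed.

Lemma codigraphK G : simple_digraph G -> codigraph (codigraph G) = G.
Proof.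
move=> sG; apply/setP => -[a b]; rewrite !inE /=; case: eqP => [->|_] /=.
  by rewrite (negbTE (simple_notin b sG)).
by rewrite negbK.
Qed.

Lemma outdeg_codigraph G i : simple_digraph G -> (outdeg (codigraph G) i + outdeg G i = n.-1)%N.
Proof.
move=> sG; rewrite !outdeg_sum -big_split /=.
have -> : n.-1 = (\sum_(k | k != i) 1)%N by rewrite sum1_card cardC1 card_ord.
rewrite [RHS]big_mkcond /=; apply: eq_bigr => k _; rewrite !inE /= eq_sym.
by case: eqP => [->|_] /=; [rewrite (negbTE (simple_notin i sG)) | case: (_ \in _)].
Qed.

Lemma indeg_codigraph G i : simple_digraph G -> (indeg (codigraph G) i + indeg G i = n.-1)%N.
Proof.
move=> sG; rewrite !indeg_sum -big_split /=.
have -> : n.-1 = (\sum_(k | k != i) 1)%N by rewrite sum1_card cardC1 card_ord.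
rewrite [RHS]big_mkcond /=; apply: eq_bigr => k _; rewrite !inE /=.
by case: eqP => [->|_] /=; [rewrite (negbTE (simple_notin i sG)) | case: (_ \in _)].
Qed.

(** The subtraction is truncated; it gives the true complementary degree because [s j <= n - 1]
    whenever [Dst s t] is nonempty. *)
Definition codeg_seq s (j : 'I_n) : nat := (n.-1 - s j)%N.

Lemma codigraph_Dst s t G : G \in Dst s t -> codigraph G \in Dst (codeg_seq s) (codeg_seq t).
Proof.
rewrite !inE => /and3P[sG /forallP hs /forallP ht]; rewrite codigraph_simple /=.
apply/andP; split; apply/forallP => i; rewrite /codeg_seq.
  by rewrite -(outdeg_codigraph i sG) (eqP (hs i)) addnK.
by rewrite -(indeg_codigraph i sG) (eqP (ht i)) addnK.
Qed.

Lemma Dst_le s t G i : G \in Dst s t -> (s i <= n.-1)%N && (t i <= n.-1)%N.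
Proof.
rewrite !inE => /and3P[sG /forallP hs /forallP ht].
by rewrite -(eqP (hs i)) -(eqP (ht i)) -{1}(outdeg_codigraph i sG) -(indeg_codigraph i sG) !leq_addl.
Qed.

Lemma eq_Dst s t s' t' : s =1 s' -> t =1 t' -> Dst s t = Dst s' t'.
Proof.
move=> hs ht; apply/setP => G; rewrite !inE; congr [&& _, _ & _].
  by apply: eq_forallb => i; rewrite hs.
by apply: eq_forallb => i; rewrite ht.
Qed.

Lemma codigraph_Dst_inv s t G : Dst s t != set0 -> G \in Dst (codeg_seq s) (codeg_seq t) ->
  codigraph G \in Dst s t.
Proof.
move=> /set0Pn[G0 G0D] /codigraph_Dst.
suff -> : Dst (codeg_seq (codeg_seq s)) (codeg_seq (codeg_seq t)) = Dst s t by [].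
by apply: eq_Dst => i; have /andP[h1 h2] := Dst_le i G0D; rewrite /codeg_seq subKn.
Qed.

Lemma sub_codigraph G H : simple_digraph G -> simple_digraph H ->
  (H \subset G) = [disjoint codigraph G & H].
Proof.
move=> sG sH; apply/subsetP/pred0P => [h e|h e eH] /=.
  apply/negP => /andP[]; rewrite inE => /andP[_ eG] eH.
  by rewrite (h e eH) in eG.
have := h e; rewrite /= eH andbT inE; case: eqP => [e12|_] /=; last by move/negbFE.
by move: eH; rewrite (surjective_pairing e) e12 (negbTE (simple_notin _ sH)).
Qed.

Lemma card_codigraph s t (P P' : pred (digraph n)) : Dst s t != set0 ->
  (forall G, G \in Dst s t -> P G = P' (codigraph G)) ->
  #|[set G in Dst s t | P G]| = #|[set G in Dst (codeg_seq s) (codeg_seq t) | P' G]|.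
Proof.
move=> D0 PP.
have simp s0 t0 G : G \in Dst s0 t0 -> simple_digraph G by rewrite inE => /and3P[].
rewrite -[LHS](card_in_imset (f := codigraph)).
  apply: eq_card => G; apply/imsetP/idP => [[G']|].
    rewrite inE => /andP[GD PG] ->; rewrite inE -PP // PG andbT.
    exact: codigraph_Dst.
  rewrite inE => /andP[GD PG]; exists (codigraph G); last by rewrite codigraphK // (simp _ _ _ GD).
  have GD' := codigraph_Dst_inv D0 GD.
  by rewrite inE GD' PP // codigraphK // (simp _ _ _ GD).
move=> G1 G2; rewrite inE => /andP[G1D _]; rewrite inE => /andP[G2D _] e.
by rewrite -(codigraphK (simp _ _ _ G1D)) e codigraphK // (simp _ _ _ G2D).
Qed.

Lemma prob_contains_codigraph (R : realType) s t H : Dst s t != set0 -> simple_digraph H ->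
  prob_contains R s t H = prob_disjoint R (codeg_seq s) (codeg_seq t) H.
Proof.
move=> D0 sH; rewrite /prob_contains /prob_disjoint; congr (_%:R / _%:R).
  apply: card_codigraph => // G; rewrite inE => /and3P[sG _ _].
  exact: sub_codigraph.
have setT s0 t0 : Dst s0 t0 = [set G in Dst s0 t0 | true] by apply/setP => G; rewrite inE andbT.
by rewrite (setT s t) (setT (codeg_seq s)); apply: card_codigraph.
Qed.

End Complement.

(** [M_main] of the complementary data minus [T_main], in variables that are all bounded by powers
    of [q]. Sums divided only by [n] can be as large as [1 / r] and are therefore scaled by an extra
    [r]. The point is the factor [r] in front of the right-hand side. *)
Lemma complement_identity (R : realType) (l r c a2 b21 b12 b03 a11 y y01 y10 y11 : R)
   (l' := 1 - l - r ^+ 2) (k := 1 - r ^+ 2) :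
  r != 0 -> l != 0 -> 1 - l != 0 -> l + r ^+ 2 != 0 -> 1 - l - r ^+ 2 != 0 ->
  let il := l^-1 in let iv := (1 - l)^-1 in
  let u := (l + r ^+ 2)^-1 in let v := (1 - l - r ^+ 2)^-1 in
  (l' * c * u + l' * c ^+ 2 / 2 * u - (- a11 + k * a2) / r * u
   - (y - k * (y01 + y10) + k ^+ 2 * y11) * (v * u) + l' * a2 / (2 * r) * u
   + l' * (1 - 2 * l') * b03 / 6 * u ^+ 2
   - (1 - 2 * l') * (- b12 + k * b03) / 2 * u ^+ 2
   - (b21 - 2 * k * b12 + k ^+ 2 * b03) / 2 * u ^+ 2)
  - ((1 - l) * c * il + (1 - l) * c ^+ 2 / 2 * il + a11 / r * il - b21 / 2 * il ^+ 2
     - (1 + l) * a2 / (2 * r) * il + (1 + 2 * l) * b12 / 2 * il ^+ 2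
     - (1 + l) * (1 + 2 * l) * b03 / 6 * il ^+ 2 - (y - y01 - y10 + y11) * (il * iv))
  = r * (- (r * il * u * (c + c ^+ 2 / 2)) - il * u * a11 + (il * u / 2 + u) * a2
     - r * (iv * v * u - iv * il * u) * (y - y01 - y10 + y11)
     - v * u * (r * (y01 + y10) + (- 2 * r + r ^+ 3) * y11)
     - r * il * u * (u + il) * (- b21 / 2 + (2 * l + 1) / 2 * b12 - (1 + l) * (1 + 2 * l) / 6 * b03)
     + u ^+ 2 * (r ^+ 3 + 2 * r * l) / 6 * b03).
Proof.
move=> r0 l0 l1 u0 v0 /=; rewrite /l' /k.
by field; rewrite ?r0 ?l0 ?l1 ?u0 ?v0.
Qed.

Section ComplementMain.
Variables (R : realType) (q r : R) (n : nat) (s t : 'I_n -> nat) (H : digraph n).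
Local Notation l := (lam R s).
Local Notation F := (H :|: loops n).
Local Notation bnd := (bounded q r).
Local Notation L := (l * (1 - l)).
Local Notation N := (n%:R : R).
Local Notation s' := (codeg_seq s).
Local Notation t' := (codeg_seq t).
Hypothesis sH : simple_digraph H.
Hypothesis Hn : nice q r (lam R s) s t F.
Hypothesis s_le : forall j, (s j <= n.-1)%N.
Hypothesis t_le : forall j, (t j <= n.-1)%N.

Let q2 := nice_q Hn.
Let r0 := nice_r Hn.
Let r1 := proj2 (nice_r_small Hn).
Ltac bnda := bnd_auto q2 r0 r1.

Lemma n_gt0 : (0 < n)%N.
Proof. by have := N_neq0 Hn; rewrite pnatr_eq0 lt0n. Qed.

Lemma codeg_natr (f : 'I_n -> nat) j : (f j <= n.-1)%N -> (codeg_seq f j)%:R = N - 1 - (f j)%:R :> R.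
Proof. by move=> h; rewrite /codeg_seq natrB // -subn1 natrB // n_gt0. Qed.

Lemma savg_codeg : savg R s' = (1 - l - r ^+ 2) * N.
Proof.
have N0 := N_neq0 Hn.
rewrite /savg natr_sum (eq_bigr (fun j => N - 1 - (s j)%:R)); last first.
  by move=> j _; rewrite codeg_natr.
rewrite sumRB sumr_const card_ord -[X in X - _]mulr_natl -natr_sum.
have -> : (\sum_j s j)%:R = l * N ^+ 2 :> R by rewrite /lam /savg; field.
rewrite -(inv_n_as_r Hn); field.
exact: N0.
Qed.

Lemma lam_codeg : lam R s' = 1 - l - r ^+ 2.
Proof. by rewrite {1}/lam savg_codeg mulfK // (N_neq0 Hn). Qed.

(** The coefficient [1 - 1 / n] is the sum of the two densities, loops belonging to neither digraph.
    This substitution turns the terms of [M_main] into the mixed terms of [T_main]. *)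
Lemma delta_codeg j : delta R s' H j = - delta R s H j + (1 - r ^+ 2) * xdeg R H j.
Proof.
rewrite /delta savg_codeg lam_codeg codeg_natr // (savgE Hn).
have -> : (1 - l - r ^+ 2) * N = N - l * N - N * r ^+ 2 by ring.
rewrite (nice_n Hn); ring.
Qed.

Lemma eta_codeg j : Defs.eta R s' t' H j = - Defs.eta R s t H j + (1 - r ^+ 2) * ydeg R H j.
Proof.
rewrite /Defs.eta savg_codeg lam_codeg codeg_natr // (savgE Hn).
have -> : (1 - l - r ^+ 2) * N = N - l * N - N * r ^+ 2 by ring.
rewrite (nice_n Hn); ring.
Qed.

Local Notation kp := (1 - r ^+ 2).

Lemma RC0_codeg m : RC R s' t' H 0 m = RC R s t H 0 m.
Proof. by rewrite /RC /Rsum /Csum; congr (_ + _); apply: eq_bigr => j _; rewrite !expr0. Qed.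

Lemma RC1_codeg m : RC R s' t' H 1 m = - RC R s t H 1 m + kp * RC R s t H 0 m.+1.
Proof.
have hR : Rsum R s' H 1 m = - Rsum R s H 1 m + kp * Rsum R s H 0 m.+1.
  rewrite /Rsum -sumrN -sumRZ -sumRD; apply: eq_bigr => j _.
  by rewrite delta_codeg (exprS (xdeg R H j) m) !expr1 !expr0; ring.
have hC : Csum R s' t' H 1 m = - Csum R s t H 1 m + kp * Csum R s t H 0 m.+1.
  rewrite /Csum -sumrN -sumRZ -sumRD; apply: eq_bigr => j _.
  by rewrite eta_codeg (exprS (ydeg R H j) m) !expr1 !expr0; ring.
rewrite /RC hR hC; ring.
Qed.

Lemma RC2_codeg m : RC R s' t' H 2 m = RC R s t H 2 m - 2 * kp * RC R s t H 1 m.+1 + kp ^+ 2 * RC R s t H 0 m.+2.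
Proof.
have hR : Rsum R s' H 2 m = Rsum R s H 2 m - 2 * kp * Rsum R s H 1 m.+1 + kp ^+ 2 * Rsum R s H 0 m.+2.
  rewrite /Rsum -!sumRZ -sumRB -sumRD; apply: eq_bigr => j _.
  by rewrite delta_codeg (exprS (xdeg R H j) m.+1) (exprS (xdeg R H j) m) !expr1 !expr0; ring.
have hC : Csum R s' t' H 2 m = Csum R s t H 2 m - 2 * kp * Csum R s t H 1 m.+1 + kp ^+ 2 * Csum R s t H 0 m.+2.
  rewrite /Csum -!sumRZ -sumRB -sumRD; apply: eq_bigr => j _.
  by rewrite eta_codeg (exprS (ydeg R H j) m.+1) (exprS (ydeg R H j) m) !expr1 !expr0; ring.
rewrite /RC hR hC; ring.
Qed.

Lemma Yq_codeg : Yq R s' t' H =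
  Yq R s t H - kp * (Y01 R s H + Y10 R s t H) + kp ^+ 2 * Y11 R H.
Proof.
rewrite /Yq /Y01 /Y10 /Y11 -sumRD -!sumRZ -sumRB -sumRD; apply: eq_bigr => e _.
rewrite delta_codeg eta_codeg; ring.
Qed.

Lemma X_le : Xarcs R H <= q ^+ 2 * N.
Proof. by apply: le_trans (nice_X Hn); rewrite ler_nat subset_leq_card // subsetUl. Qed.

Lemma delta_le j : `|delta R s H j| <= q ^+ 4 / r.
Proof.
have N0 := N_neq0 Hn.
have h : bnd 4 1 (delta R s H j / N).
  have b1 := bnd_sd Hn; have b2 := bnd_l Hn.
  have -> : delta R s H j / N = scaled_delta r l s F j - l * r ^+ 2 by rewrite (sdE sH Hn); ring.
  bnda.
have -> : delta R s H j = delta R s H j / N * N by rewrite divfK.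
rewrite normrM (ger0_norm (ler0n R n)).
have -> : q ^+ 4 / r = q ^+ 4 * r ^+ 1 * N by rewrite (n_as_r Hn); field; rewrite gt_eqF.
exact: ler_wpM2r.
Qed.

Lemma eta_le j : `|Defs.eta R s t H j| <= q ^+ 4 / r.
Proof.
have N0 := N_neq0 Hn.
have h : bnd 4 1 (Defs.eta R s t H j / N).
  have b1 := bnd_sh Hn; have b2 := bnd_l Hn.
  have -> : Defs.eta R s t H j / N = scaled_eta r l t F j - l * r ^+ 2 by rewrite (shE sH Hn); ring.
  bnda.
have -> : Defs.eta R s t H j = Defs.eta R s t H j / N * N by rewrite divfK.
rewrite normrM (ger0_norm (ler0n R n)).
have -> : q ^+ 4 / r = q ^+ 4 * r ^+ 1 * N by rewrite (n_as_r Hn); field; rewrite gt_eqF.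
exact: ler_wpM2r.
Qed.

Lemma q_le_q4 : q / r <= q ^+ 4 / r.
Proof.
apply: ler_wpM2r; first by rewrite invr_ge0 ltW.
by rewrite -[leLHS]expr1 ler_weXn2l //; have := q2; lra.
Qed.

Lemma xdeg_le j : `|xdeg R H j| <= q ^+ 4 / r.
Proof.
rewrite ger0_norm //; apply: le_trans q_le_q4; apply: le_trans (nice_x Hn j).
by rewrite ler_nat outdeg_sub // subsetUl.
Qed.

Lemma ydeg_le j : `|ydeg R H j| <= q ^+ 4 / r.
Proof.
rewrite ger0_norm //; apply: le_trans q_le_q4; apply: le_trans (nice_y Hn j).
by rewrite ler_nat indeg_sub // subsetUl.
Qed.

(** One degree factor is kept and sums to [X]; the remaining [h + m] factors are bounded
    individually. *)
Lemma RC_le h m : `|RC R s t H h m.+1| <= 2 * ((q ^+ 4 / r) ^+ (h + m) * (q ^+ 2 * N)).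
Proof.
set B := q ^+ 4 / r.
have B0 : 0 <= B by rewrite divr_ge0 ?exprn_ge0 ?(ltW r0) //; have := q2; lra.
have key (d x : 'I_n -> R) : (forall j, `|d j| <= B) -> (forall j, `|x j| <= B) -> (forall j, 0 <= x j) ->
    \sum_j x j = Xarcs R H -> `|\sum_j d j ^+ h * x j ^+ m.+1| <= B ^+ (h + m) * (q ^+ 2 * N).
  move=> dB xB x0 xX; apply: (@le_trans _ _ (\sum_j B ^+ (h + m) * x j)); last first.
    by rewrite -mulr_sumr xX; apply: ler_wpM2l X_le; rewrite exprn_ge0.
  apply: (le_trans (ler_norm_sum _ _ _)); apply: ler_sum => j _.
  rewrite exprSr mulrA normrM (ger0_norm (x0 j)); apply: ler_wpM2r => //.
  rewrite exprD normrM !normrX; apply: ler_pM; rewrite ?exprn_ge0 //; apply: lerXn2r => //.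
rewrite /RC mulr_natl mulr2n; apply: (le_trans (ler_normD _ _)); apply: lerD; apply: key => //.
- exact: delta_le.
- exact: xdeg_le.
- exact: card_arcs_out.
- exact: eta_le.
- exact: ydeg_le.
- exact: card_arcs_in.
Qed.

Lemma sum_arcs_le (f g : 'I_n -> R) : (forall j, `|f j| <= q ^+ 4 / r) -> (forall j, `|g j| <= q ^+ 4 / r) ->
  `|\sum_(e in H) f e.1 * g e.2| <= (q ^+ 4 / r) ^+ 2 * (q ^+ 2 * N).
Proof.
move=> hf hg; apply: (@le_trans _ _ (\sum_(e in H) (q ^+ 4 / r) ^+ 2)).
  apply: (le_trans (ler_norm_sum _ _ _)); apply: ler_sum => e _.
  by rewrite normrM expr2; apply: ler_pM.
rewrite sumr_const -[leLHS]mulr_natl mulrC; apply: ler_wpM2l; last exact: X_le.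
exact: sqr_ge0.
Qed.

Lemma bnd_arcs2 (x : R) : `|x| <= (q ^+ 4 / r) ^+ 2 * (q ^+ 2 * N) -> bnd 10 0 (x / N ^+ 2).
Proof.
move=> h; rewrite /bounded normrM -exprVn (inv_n_as_r Hn) [X in _ * X]ger0_norm; last first.
  by rewrite !exprn_ge0 // ltW.
rewrite expr0 mulr1.
have -> : q ^+ 10 = (q ^+ 4 / r) ^+ 2 * (q ^+ 2 * N) * (r ^+ 2) ^+ 2.
  by rewrite (n_as_r Hn); field; rewrite gt_eqF.
by apply: ler_wpM2r => //; rewrite !exprn_ge0 // ltW.
Qed.

Lemma bnd_double m k x : bnd m k (x / 2) -> bnd (m + 2) k x.
Proof.
move=> h; have -> : x = 2 * (x / 2) by field.
by apply: (bndW q2 r0 r1); [apply: bndM; [exact: (bnd_nat r q2 2) | exact: h] | rewrite addnC leq_add2l | ].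
Qed.

Lemma M_main_codeg : bnd 100 1 (M_main R s' t' H - T_main R s t H).
Proof.
have N0 := N_neq0 Hn.
have r0n : r != 0 by rewrite gt_eqF.
have L0 := L_gt0 Hn.
have [l0 l1] : l != 0 /\ 1 - l != 0.
  by move: (lt0r_neq0 L0); rewrite mulf_eq0 negb_or => /andP.
have rs := r2_small Hn; have l0' := nice_l0 Hn; have l1' := nice_l1 Hn; have L1 := L_le l.
have Ll2 : L <= 1 - l by rewrite ler_piMl //; lra.
have Ll1 : L <= l by rewrite ler_piMr //; lra.
have v0 : 1 - l - r ^+ 2 != 0 by rewrite gt_eqF //; lra.
have u0 : l + r ^+ 2 != 0.
  have : 0 <= r ^+ 2 by rewrite exprn_ge0 // ltW.
  by move=> h; rewrite gt_eqF //; lra.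
set c := Xarcs R H / N.
set a2 := r * RC R s t H 0 2 / N; set a11 := r * RC R s t H 1 1 / N.
set b21 := RC R s t H 2 1 / N ^+ 2; set b12 := RC R s t H 1 2 / N ^+ 2.
set b03 := RC R s t H 0 3 / N ^+ 2.
set y := Yq R s t H / N ^+ 2; set y01 := Y01 R s H / N ^+ 2.
set y10 := Y10 R s t H / N ^+ 2; set y11 := Y11 R H / N ^+ 2.
have bc : bnd 2 0 c.
  rewrite /bounded expr0 mulr1 /c ger0_norm ?divr_ge0 //.
  by rewrite ler_pdivrMr ?X_le // ltr0n n_gt0.
have b1 h m : (h + m = 1)%N -> bnd 8 0 (r * RC R s t H h m.+1 / N).
  move=> hm; apply: (@bnd_double 6); have := RC_le h m; rewrite hm expr1 => g.
  rewrite /bounded expr0 mulr1 !normrM (gtr0_norm r0) [ `|N^-1|]ger0_norm ?invr_ge0 //.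
  rewrite [ `|2^-1|]ger0_norm ?invr_ge0 //.
  have -> : q ^+ 6 = r * (2 * (q ^+ 4 / r * (q ^+ 2 * N))) / N / 2 by field; rewrite N0 r0n.
  by apply: ler_wpM2r; rewrite ?invr_ge0 //; apply: ler_wpM2r; rewrite ?invr_ge0 //; apply: ler_wpM2l => //; exact: ltW.
have b2 h m : (h + m = 2)%N -> bnd 12 0 (RC R s t H h m.+1 / N ^+ 2).
  move=> hm; apply: (@bnd_double 10); have := RC_le h m; rewrite hm => g.
  rewrite mulrAC; apply: bnd_arcs2; rewrite normrM [ `|2^-1|]ger0_norm ?invr_ge0 //.
  by rewrite ler_pdivrMr // [leRHS]mulrC.
have ba2 : bnd 8 0 a2 by exact: (b1 0 1).
have ba11 : bnd 8 0 a11 by exact: (b1 1 0).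
have bb21 : bnd 12 0 b21 by exact: (b2 2 0).
have bb12 : bnd 12 0 b12 by exact: (b2 1 1).
have bb03 : bnd 12 0 b03 by exact: (b2 0 2).
have by0 : bnd 10 0 y by apply: bnd_arcs2; apply: (sum_arcs_le delta_le eta_le).
have by01 : bnd 10 0 y01 by apply: bnd_arcs2; apply: (sum_arcs_le delta_le ydeg_le).
have by10 : bnd 10 0 y10 by apply: bnd_arcs2; apply: (sum_arcs_le xdeg_le eta_le).
have by11 : bnd 10 0 y11 by apply: bnd_arcs2; apply: (sum_arcs_le xdeg_le ydeg_le).
have iE := @complement_identity R l r c a2 b21 b12 b03 a11 y y01 y10 y11 r0n l0 l1 u0 v0.
set il := l^-1 in iE; set iv := (1 - l)^-1 in iE; set u := (l + r ^+ 2)^-1 in iE; set v := (1 - l - r ^+ 2)^-1 in iE.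
have bil : bnd 2 0 il := bnd_lV Hn.
have biv : bnd 1 0 iv := bnd_1lV Hn.
have bl := bnd_l Hn.
have bLh : (L / 2)^-1 <= q ^+ 2.
  have := bnd_Linv Hn; rewrite /bounded expr0 mulr1 expr1 ger0_norm ?invr_ge0 ?(ltW L0) // => g.
  by rewrite invf_div expr2 mulrC; apply: ler_pM => //; rewrite ?invr_ge0 ?(ltW L0).
have bu : bnd 2 0 u.
  apply: (@bnd_inv_ge R q r _ (L / 2)) bLh; first by rewrite divr_gt0.
  have : 0 <= r ^+ 2 by rewrite exprn_ge0 // ltW.
  lra.
have bv : bnd 2 0 v.
  by apply: (@bnd_inv_ge R q r _ (L / 2)) bLh; [rewrite divr_gt0 | lra].
have -> : M_main R s' t' H - T_main R s t H = r * (- (r * il * u * (c + c ^+ 2 / 2)) - il * u * a11 + (il * u / 2 + u) * a2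
     - r * (iv * v * u - iv * il * u) * (y - y01 - y10 + y11)
     - v * u * (r * (y01 + y10) + (- 2 * r + r ^+ 3) * y11)
     - r * il * u * (u + il) * (- b21 / 2 + (2 * l + 1) / 2 * b12 - (1 + l) * (1 + 2 * l) / 6 * b03)
     + u ^+ 2 * (r ^+ 3 + 2 * r * l) / 6 * b03).
  rewrite -iE /M_main /T_main lam_codeg !RC0_codeg !RC1_codeg !RC2_codeg Yq_codeg; congr (_ - _).
    rewrite /u /v /c /a2 /a11 /b21 /b12 /b03 /y /y01 /y10 /y11.
    have e : 1 - (1 - l - r ^+ 2) = l + r ^+ 2 by ring.
    rewrite !e; field.
    by rewrite ?N0 ?r0n ?u0 ?v0.
  rewrite /il /iv /c /a2 /a11 /b21 /b12 /b03 /y /y01 /y10 /y11; field.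
  by rewrite ?N0 ?r0n ?l0 ?l1.
bnda.
Qed.

Lemma pq_codeg : 1 - pq R s' = pq R s.
Proof.
have N0 := N_neq0 Hn.
rewrite (pqE Hn) /pq savg_codeg -(inv_n_as_r Hn).
have c2 : 1 - r ^+ 2 != 0.
  have := r2_small Hn; have := L_le l => g1 g2; rewrite gt_eqF //; lra.
have N1 : N - 1 != 0.
  by apply: contraNneq c2 => h; rewrite -(inv_n_as_r Hn); have -> : N = 1; [lra | rewrite invr1 subrr].
by field; rewrite N0 N1 ?andbT //; apply: contraNneq c2 => h; rewrite -(inv_n_as_r Hn) -div1r -{1}(divff N0) -mulrBl h mul0r.
Qed.

End ComplementMain.

Section Contains.
Variables (R : realType) (q r : R) (n : nat) (s t : 'I_n -> nat) (H : digraph n).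
Local Notation l := (lam R s).
Local Notation F := (H :|: loops n).
Local Notation L := (l * (1 - l)).
Local Notation N := (n%:R : R).
Hypothesis sH : simple_digraph H.
Hypothesis Hn : nice q r (lam R s) s t F.
Hypothesis q200 : q ^+ 200 * r <= 1.
Hypothesis D0 : Dst s t != set0.

Let q2 := nice_q Hn.
Let r0 := nice_r Hn.
Let r1 := proj2 (nice_r_small Hn).

Lemma s_le_pred j : (s j <= n.-1)%N.
Proof. by have /set0Pn[G GD] := D0; have /andP[] := Dst_le j GD. Qed.

Lemma t_le_pred j : (t j <= n.-1)%N.
Proof. by have /set0Pn[G GD] := D0; have /andP[] := Dst_le j GD. Qed.

(** The complementary density is [1 - l - 1 / n], so the analogue of [L] is only known to be at
    least [L / 2]. Passing from [q] to [q ^ 2] absorbs this factor and doubles the power of [q] that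
    [r] must beat. *)
Lemma nice_codeg : nice (q ^+ 2) r (lam R (codeg_seq s)) (codeg_seq s) (codeg_seq t) F.
Proof.
have q2' := q2; have r0' := r0; have N0 := N_neq0 Hn.
have q1 : 1 <= q by lra.
have qq : q <= q ^+ 2 by rewrite -[leLHS]expr1 ler_weXn2l.
have Qq : q / r <= q ^+ 2 / r by apply: ler_wpM2r => //; rewrite invr_ge0 ltW.
rewrite (lam_codeg Hn s_le_pred).
have rs := r2_small Hn; have l0' := nice_l0 Hn; have l1' := nice_l1 Hn; have L1 := L_le l.
have L0 := L_gt0 Hn.
have Ll2 : L <= 1 - l by rewrite ler_piMl //; lra.
have Ll1 : L <= l by rewrite ler_piMr //; lra.
have r20 : 0 <= r ^+ 2 by rewrite exprn_ge0 // ltW.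
have NE' : (1 - l - r ^+ 2) * N = N - l * N - 1.
  have -> : (1 - l - r ^+ 2) * N = N - l * N - N * r ^+ 2 by ring.
  by rewrite (nice_n Hn).
have near (f : 'I_n -> nat) j : (f j <= n.-1)%N -> `|(f j)%:R - l * N| <= q / r ->
    `|(codeg_seq f j)%:R - (1 - l - r ^+ 2) * N| <= q ^+ 2 / r.
  move=> fj h; rewrite (codeg_natr Hn fj) NE'; apply: le_trans Qq; apply: le_trans h.
  by rewrite -normrN; have -> : - (N - 1 - (f j)%:R - (N - l * N - 1)) = (f j)%:R - l * N by ring.
have sums (f : 'I_n -> nat) : (forall j, f j <= n.-1)%N -> \sum_j (f j)%:R = l * N ^+ 2 ->
    \sum_j (codeg_seq f j)%:R = (1 - l - r ^+ 2) * N ^+ 2.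
  move=> fj h; rewrite (eq_bigr (fun j => N - 1 - (f j)%:R)); last by move=> j _; rewrite (codeg_natr Hn).
  have -> : (1 - l - r ^+ 2) * N ^+ 2 = (1 - l - r ^+ 2) * N * N by ring.
  rewrite sumRB sumr_const card_ord -[X in X - _]mulr_natl h NE'; ring.
split.
- lra.
- exact: r0.
- exact: nice_n Hn.
- by rewrite -exprM.
- lra.
- lra.
- have LL := nice_L Hn.
  have h : L / 2 <= (1 - l - r ^+ 2) * (1 - (1 - l - r ^+ 2)).
    have : r ^+ 2 * r ^+ 2 <= r ^+ 2 * 1 by apply: ler_wpM2l => //; lra.
    have : 0 <= l * r ^+ 2 by rewrite mulr_ge0.
    have : l * r ^+ 2 <= 1 * r ^+ 2 by apply: ler_wpM2r.
    lra.
  have q20 : 0 <= q ^+ 2 by lra.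
  apply: le_trans (ler_wpM2l q20 h).
  have : 2 * 1 <= q * (q * L) by apply: ler_pM => //; lra.
  rewrite expr2; lra.
- by move=> j; apply: near (nice_s Hn j); exact: s_le_pred.
- by move=> j; apply: near (nice_t Hn j); exact: t_le_pred.
- by move=> j; apply: le_trans (nice_x Hn j) Qq.
- by move=> j; apply: le_trans (nice_y Hn j) Qq.
- apply: le_trans (nice_X Hn) _; apply: ler_wpM2r => //.
  rewrite -exprM; apply: ler_weXn2l => //.
- by apply: sums; [exact: s_le_pred | exact: nice_ss Hn].
- by apply: sums; [exact: t_le_pred | exact: nice_ts Hn].
Qed.

Lemma Dst_codeg : Dst (codeg_seq s) (codeg_seq t) != set0.
Proof.
have /set0Pn[G GD] := D0; apply/set0Pn; exists (codigraph G); exact: codigraph_Dst.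
Qed.

(** The exponent is [625 = 2 * 312 + 1]: the base is [q ^ 2], and one [q] pays for adding the error
    of [M_main_codeg]. *)
Theorem prob_contains_expansion :
  exists f : R, `|f| <= q ^+ 625 * r /\
    prob_contains R s t H = pq R s ^+ #|H| * expR (T_main R s t H + f).
Proof.
have [g [gb gE]] := prob_disjoint_expansion sH nice_codeg Dst_codeg.
pose D := M_main R (codeg_seq s) (codeg_seq t) H - T_main R s t H.
have Db : `|D| <= q ^+ 100 * r ^+ 1 := M_main_codeg sH Hn s_le_pred t_le_pred.
exists (g + D); split.
  have gb' : `|g| <= q ^+ 624 * r ^+ 1 by move: gb; rewrite -exprM expr1.
  have := bndD q2 r0 r1 gb' Db.
  by rewrite /bounded expr1.
rewrite prob_contains_codigraph // gE (pq_codeg Hn s_le_pred); congr (_ * expR _).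
rewrite /D; ring.
Qed.

End Contains.

(** * Choice of the scales *)

Section Scales.
Variable R : realType.

Lemma lam_bounds n (s t : 'I_n -> nat) : (0 < n)%N -> (forall j, 0 < s j)%N -> Dst s t != set0 ->
  0 < lam R s < 1.
Proof.
move=> n0 s0 /set0Pn[G GD].
have n0' : 0 < n%:R :> R by rewrite ltr0n.
rewrite /lam /savg ltr_pdivrMr // mul1r ltr_pdivrMr // -natrM ltr_nat.
rewrite divr_gt0 ?divr_gt0 ?ltr0n //=.
  have : (\sum_j s j <= \sum_(j < n) n.-1)%N by apply: leq_sum => j _; have /andP[] := Dst_le j GD.
  rewrite sum_nat_const card_ord => h; apply: leq_ltn_trans h _.
  by rewrite ltn_pmul2l // prednK.
by rewrite (bigD1 (Ordinal n0)) //= addn_gt0 s0.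
Qed.

Lemma nice_intro (q r : R) n (s t : 'I_n -> nat) (H : digraph n) :
  2 <= q -> 0 < r -> n%:R * r ^+ 2 = 1 -> q ^+ 100 * r <= 1 ->
  0 < lam R s < 1 -> 1 <= q * (lam R s * (1 - lam R s)) ->
  (\sum_j s j = \sum_j t j)%N -> simple_digraph H ->
  (forall j, `|(s j)%:R - savg R s| <= q / r) ->
  (forall j, `|(t j)%:R - savg R s| <= q / r) ->
  (forall j, xdeg R H j + 1 <= q / r) -> (forall j, ydeg R H j + 1 <= q / r) ->
  Xarcs R H + n%:R <= q ^+ 2 * n%:R ->
  nice q r (lam R s) s t (H :|: loops n).
Proof.
move=> q2 r0 nr qr /andP[l0 l1] qL st sH hs ht hx hy hX.
have N0 : n%:R != 0 :> R by apply: contra_eq_neq nr => ->; rewrite mul0r eq_sym oner_eq0.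
have sE : savg R s = lam R s * n%:R by rewrite /lam divfK.
have ss : (\sum_j s j)%:R = lam R s * n%:R ^+ 2 by rewrite expr2 mulrA -sE /savg divfK.
split => //.
- exact: ltW.
- exact: ltW.
- by move=> j; rewrite -sE.
- by move=> j; rewrite -sE.
- by move=> j; rewrite outdeg_loops // natrD; exact: hx.
- by move=> j; rewrite indeg_loops // natrD; exact: hy.
- by rewrite card_loops // natrD; exact: hX.
- by rewrite -natr_sum.
- by rewrite -natr_sum -st.
Qed.

Lemma powRX (x y : R) k : powR x y ^+ k = powR x (y * k%:R).
Proof. by rewrite powRrM powR_mulrn // powR_ge0. Qed.

Lemma eventually_powR_ge (eps Z : R) : 0 < eps -> 0 <= Z ->
  exists N0 : nat, forall n, (N0 <= n)%N -> Z <= powR n%:R eps.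
Proof.
move=> e0 Z0; have e1 : eps != 0 by rewrite gt_eqF.
exists (Num.truncn (powR Z eps^-1)).+1 => n hn.
have : powR Z eps^-1 <= n%:R.
  have /andP[_ h] := truncn_itv (powR_ge0 Z eps^-1).
  by apply: ltW; apply: lt_le_trans h _; rewrite ler_nat.
move=> h; have := ge0_ler_powR (ltW e0) _ _ h; rewrite !nnegrE powR_ge0 ler0n => /(_ isT isT).
by rewrite -powRrM mulVf // powRr1.
Qed.

Lemma ln_le_powR (x eps : R) : 0 < x -> 0 < eps -> ln x <= eps^-1 * powR x eps.
Proof.
move=> x0 e0; have := ln_sublinear (powR_gt0 eps x0); rewrite ln_powR => /ltW h.
by rewrite mulrC ler_pdivlMr // mulrC.
Qed.

(** With [L = l (1 - l)] one has [(1 - 2 l) ^ 2 = 1 - 4 L], so the density hypothesis says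
    [1 / L <= 4 + 3/2 a log n], far below any power of [n]. *)
Lemma lam_lower (l a y q : R) : 0 < l < 1 -> 4 + 3 / 2 * (a * y) <= q ->
  (1 - 2 * l) ^+ 2 / (3 * (l * (1 - l) / 2)) <= a * y -> 1 <= q * (l * (1 - l)).
Proof.
move=> /andP[l0 l1] hq; have L0 : 0 < l * (1 - l) by rewrite mulr_gt0 // subr_gt0.
rewrite ler_pdivrMr; last by lra.
have := ler_wpM2r (ltW L0) hq; lra.
Qed.

(** [x] stands for [n]. Of the two factors [n ^ eps] in [q], one is the growth allowed to the
    degrees and the other absorbs the constants. *)
Variables (x K a b eps : R).
Hypotheses (x1 : 1 <= x) (K0 : 0 < K) (a0 : 0 < a) (e0 : 0 < eps) (b0 : 0 < b).
Hypothesis eb : eps < (2^-1 - b) / 4000.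
Hypothesis zZ : K + 5 + 3 / 2 * a * eps^-1 <= powR x eps.
Local Notation z := (powR x eps).
Local Notation q := (powR x eps ^+ 2).
Local Notation r := (powR x (- 2^-1)).

Let powR_add y1 y2 : powR x (y1 + y2) = powR x y1 * powR x y2.
Proof. by apply: powRD; rewrite (gt_eqF (lt_le_trans ltr01 x1)) implybT. Qed.

Lemma scale_r : 0 < r.
Proof. exact: powR_gt0 (lt_le_trans ltr01 x1). Qed.

Lemma scale_n : x * r ^+ 2 = 1.
Proof.
have x0 := lt_le_trans ltr01 x1.
rewrite powRX mulNr mulVf //; last by rewrite pnatr_eq0.
by rewrite powR_inv1 ?(ltW x0) // mulfV // gt_eqF.
Qed.

(** The powers of [q] that meet [r] are 100, 200, 312 and 625. *)
Lemma scale_small (k : nat) : (k <= 700)%N -> q ^+ k * r <= powR x (- b).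
Proof.
move=> kk; rewrite !powRX -powR_add; apply: ler_powR => //.
have k7 : k%:R <= 700 :> R by rewrite ler_nat.
have : eps * k%:R <= eps * 700 by apply: ler_wpM2l => //; exact: ltW.
move: eb e0; lra.
Qed.

Lemma scale_b : powR x (- b) <= 1.
Proof.
have h : - b <= 0 by rewrite oppr_le0 ltW.
by have := ler_powR x1 h; rewrite powRr0.
Qed.

Lemma scale_z : K + 5 <= z /\ 3 / 2 * a * eps^-1 + 5 <= z.
Proof.
have ei : 0 < eps^-1 by rewrite invr_gt0.
have ai : 0 <= 3 / 2 * a * eps^-1 by rewrite !mulr_ge0 ?invr_ge0 // ltW.
move: zZ K0 ai; set w := 3 / 2 * a * eps^-1; split; lra.
Qed.

Lemma scale_q (c : R) : c <= z -> c * z <= q.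
Proof. by move=> cz; rewrite expr2; apply: ler_wpM2r => //; exact: powR_ge0. Qed.

Lemma scale_q2 : 2 <= q.
Proof.
have [h _] := scale_z; have K0' := K0.
have z1 : 1 <= z by lra.
apply: le_trans (scale_q z1); lra.
Qed.

Lemma scale_degree : K * powR x (2^-1 + eps) + 1 <= q / r.
Proof.
have [h _] := scale_z; have K0' := K0.
have hK : K + 1 <= z by lra.
have h12 : 1 <= powR x 2^-1.
  have g : 0 <= 2^-1 :> R by rewrite invr_ge0.
  by have := ler_powR x1 g; rewrite powRr0.
rewrite [in leRHS]powRN invrK powR_add.
have : (K * z + 1) * powR x 2^-1 <= q * powR x 2^-1.
  apply: ler_wpM2r; first by lra.
  apply: le_trans (scale_q hK); lra.
move: (powR x 2^-1) h12 => w h12; lra.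
Qed.

Lemma scale_arcs : K * powR x (1 + 2 * eps) + x <= q ^+ 2 * x.
Proof.
have x0 := lt_le_trans ltr01 x1.
have [h _] := scale_z; have K0' := K0; have qz := scale_q2.
have hK : (K + 1) * z <= q by apply: scale_q; lra.
rewrite powR_add (mulrC 2) (powRrM x eps 2) (powR_mulrn 2 (powR_ge0 x eps)) powRr1 ?(ltW x0) //.
have -> : K * (x * q) + x = (K * q + 1) * x by ring.
apply: ler_wpM2r; first exact: ltW.
have : (K + 1) * q <= q * q.
  apply: ler_wpM2r; first by lra.
  have z1 : 1 <= z by lra.
  by apply: le_trans (scale_q z1); lra.
rewrite [q ^+ 2]expr2; move: (q) qz => w; lra.
Qed.

Lemma scale_log : 4 + 3 / 2 * (a * ln x) <= q.
Proof.
have x0 := lt_le_trans ltr01 x1.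
have [_ h] := scale_z.
have g : a * ln x <= a * (eps^-1 * z) by rewrite ler_pM2l // ln_le_powR.
have hz : 3 / 2 * a * eps^-1 + 4 <= z by lra.
have z1 : 1 <= z.
  have : 0 <= 3 / 2 * a * eps^-1 by rewrite !mulr_ge0 ?invr_ge0 // ltW.
  lra.
apply: le_trans (scale_q hz).
have : 0 <= z by lra.
lra.
Qed.

End Scales.

Theorem theorem3p2 (R : realType) (a b : R) :
  0 < a -> 0 < b -> a + b < 2^-1 ->
  exists eps0 : R, 0 < eps0 /\
  forall eps : R, 0 < eps -> eps < eps0 ->
  forall K : R, 0 < K ->
  exists (K' : R) (N0 : nat), 0 < K' /\
  forall (n : nat) (s t : 'I_n -> nat) (H : digraph n),
    (N0 <= n)%N ->
    (forall j, (0 < s j)%N) -> (forall j, (0 < t j)%N) ->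
    (\sum_j s j = \sum_j t j)%N ->
    simple_digraph H ->
    Dst s t != set0 ->
    (forall j, `|(s j)%:R - savg R s| <= K * powR (n%:R) (2^-1 + eps)) ->
    (forall j, `|(t j)%:R - savg R s| <= K * powR (n%:R) (2^-1 + eps)) ->
    (forall j, xdeg R H j <= K * powR (n%:R) (2^-1 + eps)) ->
    (forall j, ydeg R H j <= K * powR (n%:R) (2^-1 + eps)) ->
    Xarcs R H <= K * powR (n%:R) (1 + 2 * eps) ->
    (1 - 2 * lam R s) ^+ 2 / (3 * Aq R s) <= a * ln (n%:R) ->
    (exists d : R, `|d| <= K' * powR (n%:R) (- b) /\
       prob_disjoint R s t H
         = (1 - pq R s) ^+ #|H| * expR (M_main R s t H + d)) /\
    (exists d : R, `|d| <= K' * powR (n%:R) (- b) /\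
       prob_contains R s t H
         = pq R s ^+ #|H| * expR (T_main R s t H + d)).
Proof.
(* The requirement is [q ^ 700 r <= n ^ (-b)] with [q = n ^ (2 eps)], that is
   [1400 eps <= 1/2 - b]. *)
move=> a0 b0 ab; exists ((2^-1 - b) / 4000); split.
  by rewrite divr_gt0 // subr_gt0; apply: le_lt_trans ab; rewrite lerDr ltW.
move=> eps e0 e1 K K0.
pose Z : R := K + 5 + 3 / 2 * a * eps^-1.
have Z0 : 0 <= Z by rewrite /Z !addr_ge0 ?mulr_ge0 ?invr_ge0 // ltW.
have [N0 hN0] := eventually_powR_ge e0 Z0.
(* [K'] can be [1] because [N0] makes [n ^ eps] exceed the constants, [K] included; the successor
   excludes [n = 0]. *)
exists 1, N0.+1; split; first exact: ltr01.
move=> n s t H nN s0 t0 st sH D0 hs ht hx hy hX ha.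
have n0 : (0 < n)%N by exact: leq_trans nN.
have n1 : 1 <= n%:R :> R by rewrite ler1n.
have zZ : Z <= powR n%:R eps by apply: hN0; exact: ltnW.
have small := scale_small n1 e0 e1; have le1 := scale_b n1 b0.
have deg1 (y : R) : y <= K * powR n%:R (2^-1 + eps) ->
    y + 1 <= powR n%:R eps ^+ 2 / powR n%:R (- 2^-1).
  by move=> h; apply: le_trans (scale_degree n1 K0 a0 e0 zZ); rewrite lerD2r.
have deg0 (y : R) : y <= K * powR n%:R (2^-1 + eps) ->
    y <= powR n%:R eps ^+ 2 / powR n%:R (- 2^-1).
  by move=> /deg1; apply: le_trans; rewrite lerDl.
have lb := lam_bounds R n0 s0 D0.
have Hn : nice (powR n%:R eps ^+ 2) (powR n%:R (- 2^-1)) (lam R s) s t (H :|: loops n).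
  apply: nice_intro => //.
  - exact: scale_q2 K0 a0 e0 zZ.
  - exact: scale_r.
  - exact: scale_n.
  - by apply: le_trans le1; exact: small.
  - exact: lam_lower lb (scale_log n1 K0 a0 e0 zZ) ha.
  - by move=> j; apply: deg0.
  - by move=> j; apply: deg0.
  - by move=> j; apply: deg1.
  - by move=> j; apply: deg1.
  - by apply: le_trans (scale_arcs n1 K0 a0 e0 zZ); rewrite lerD2r.
split.
  have [f [fb fE]] := prob_disjoint_expansion sH Hn D0.
  by exists f; split => //; rewrite mul1r; apply: le_trans fb _; exact: small.
have q200 : (powR n%:R eps ^+ 2) ^+ 200 * powR n%:R (- 2^-1) <= 1.
  by apply: le_trans le1; exact: small.
have [f [fb fE]] := prob_contains_expansion sH Hn q200 D0.
by exists f; split => //; rewrite mul1r; apply: le_trans fb _; exact: small.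
Qed.
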